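(* Let $p,q$ be nonzero complex numbers with $|p|,|q|<1$, and let $t_1,\dots,t_6\in\mathbb{C}$ satisfy $|t_j|<1$ for $j=1,\dots,6$ and the balancing condition $\prod_{j=1}^6 t_j=pq$. Then $$\kappa\int_{\mathbb{T}}\frac{\prod_{j=1}^6\Gamma(t_jz^{\pm1};p,q)}{\Gamma(z^{\pm2};p,q)}\frac{dz}{z}=\prod_{1\le j<k\le 6}\Gamma(t_jt_k;p,q),\qquad \kappa=\frac{(p;p)_\infty(q;q)_\infty}{4\pi i},$$ where $\mathbb{T}$ is the unit circle with positive orientation.
   Context: For $|p|,|q|<1$ put $(z;q)_\infty=\prod_{j=0}^\infty(1-zq^j)$. The elliptic gamma function is, for $z\in\mathbb{C}^*=\mathbb{C}\setminus\{0\}$, $$\Gamma(z;p,q)=\prod_{j,k=0}^\infty\frac{1-z^{-1}p^{j+1}q^{k+1}}{1-zp^jq^k}.$$ It is a meromorphic function of $z\in\mathbb{C}^*$. Notation: $\Gamma(tz^{\pm1};p,q):=\Gamma(tz;p,q)\Gamma(tz^{-1};p,q)$ and $\Gamma(z^{\pm2};p,q):=\Gamma(z^2;p,q)\Gamma(z^{-2};p,q)$. The function $1/\Gamma(z^{\pm2};p,q)$ extends holomorphically to $z\in\mathbb{C}^*$ (with zeros at the poles of $\Gamma(z^{\pm 2};p,q)$, e.g. at $z=\pm1$), and it is understood in this sense on $\mathbb{T}$. *)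

(* Defs.v *)
From Stdlib Require Import Reals.
From HB Require Import structures.
From Coquelicot Require Import Coquelicot.
From mathcomp Require Import ssreflect ssrfun ssrbool eqtype ssrnat seq.
From mathcomp Require Import fintype bigop.

Set Implicit Arguments.
Unset Strict Implicit.
Unset Printing Implicit Defensive.

Local Open Scope C_scope.

HB.instance Definition _ := Monoid.isComLaw.Build C (RtoC 1) Cmult
  Cmult_assoc Cmult_comm Cmult_1_l.

Notation "\Cprod_ ( i < n ) F" := (\big[Cmult/RtoC 1]_(i < n) F)
  (at level 36, F at level 36, i, n at level 50,
   format "'[' \Cprod_ ( i  <  n ) '/  '  F ']'") : C_scope.
Notation "\Cprod_ ( i < n | P ) F" := (\big[Cmult/RtoC 1]_(i < n | P) F)
  (at level 36, F at level 36, i, n at level 50,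
   format "'[' \Cprod_ ( i  <  n  |  P ) '/  '  F ']'") : C_scope.

(* The limit of [f] along [F] when it exists (see [iota_filterlim_locally]);
   unspecified otherwise. *)
Definition Clim (T : Type) (F : (T -> Prop) -> Prop) (f : T -> C) : C :=
  @Hierarchy.iota C_R_CompleteNormedModule
    (fun l => filterlim f F (@locally C_UniformSpace l)).

(* (z; q)_oo *)
Definition qpoch (z q : C) : C :=
  Clim eventually (fun n : nat => \Cprod_(j < n) (1 - z * q ^ j)).

(* Gamma(z; p, q), the double product being the limit of its rectangular
   partial products as both sides tend to infinity independently.  The value
   at a pole is meaningless. *)
Definition ellGamma (p q z : C) : C :=
  Clim (filter_prod eventually eventually)
    (fun MN : nat * nat =>
       \Cprod_(j < MN.1) \Cprod_(k < MN.2)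
         ((1 - / z * p ^ j.+1 * q ^ k.+1) / (1 - z * p ^ j * q ^ k))).

(* Gamma(t z^{+-1}; p, q) *)
Definition ellGamma_pm (p q t z : C) : C :=
  ellGamma p q (t * z) * ellGamma p q (t * / z).

(* Gamma(z^{+-2}; p, q) *)
Definition ellGamma_pm2 (p q z : C) : C :=
  ellGamma p q (z ^ 2) * ellGamma p q (/ (z ^ 2)).

(* The value at [z] of the holomorphic extension of [f] across its removable
   singularities, namely the limit of [f w] as [w] tends to [z], [w <> z].
   Values of [f] at isolated singular points are never used. *)
Definition holo_ext (f : C -> C) (z : C) : C :=
  Clim (@locally' C_UniformSpace z) f.

Definition expi (theta : R) : C := (cos theta, sin theta).

(* The integrand of the contour integral of [f z dz] over the positively
   oriented unit circle, parametrized by z = expi theta, 0 <= theta <= 2 PI. *)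
Definition circle_pullback (f : C -> C) (theta : R) : C :=
  f (expi theta) * (Ci * expi theta).

Definition ex_circle_int (f : C -> C) : Prop :=
  @ex_RInt C_R_NormedModule (circle_pullback f) 0 (2 * PI).

Definition circle_int (f : C -> C) : C :=
  @RInt C_R_CompleteNormedModule (circle_pullback f) 0 (2 * PI).

(* 1 / Gamma(z^{+-2}; p, q) is understood as its holomorphic extension, which
   on the unit circle matters at z = 1 and z = -1. *)
Definition beta_integrand (p q : C) (t : 'I_6 -> C) (z : C) : C :=
  (\Cprod_(j < 6) ellGamma_pm p q (t j) z)
  * holo_ext (fun w => / ellGamma_pm2 p q w) z / z.

Definition kappa (p q : C) : C :=
  qpoch p p * qpoch q q / (4 * PI * Ci).

(* Main.v *)
Require Import Defs.
From Stdlib Require Import Reals Lra ClassicalEpsilon.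
From Coquelicot Require Import Coquelicot.
From mathcomp Require Import ssreflect ssrfun ssrbool eqtype ssrnat seq.
From mathcomp Require Import fintype bigop.

(* Let J(t) be the integral divided by the right-hand side. With s_6 = t_6 / q, a theta
   function identity turns the contiguity relation between the integrands at t and at
   (q t_1, t_2, ..., t_5, t_6 / q) into a q-difference phi(z) - phi(z / q) with phi
   holomorphic for 1 <= |z| <= 1 / |q|; integrating, J is unchanged by this shift.
   As a function of t_1 with t_1 t_6 fixed, J has a Laurent expansion, and invariance
   under t_1 -> q t_1 makes it constant as soon as |t_1 t_6| < |q|. When |t_1|, ..., |t_5|
   are close to 1 each of them can be moved freely in this way, and the identity theorem
   extends the constancy to all admissible t. The constant is found by letting t_1 -> i
   and t_2 -> - i: the contour is pinched at z = +-i, where the singular factor of the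
   integrand is a Poisson kernel in z^2. *)

Local Open Scope C_scope.

(** The shift t_1 -> q t_1 cannot be iterated freely: all six parameters have to stay in the unit
    disc, or poles would cross the contour. Hence the Laurent argument, which uses a single shift.
    It compares the circles |t_1| = r and |t_1| = |q| r; both must lie in the annulus |t_1 t_6| <
    |t_1| < 1 where t_1 and t_6 are admissible, and this forces |t_1 t_6| < |q|. Keeping |t_1|, ...,
    |t_5| near 1 makes |t_6| close to |p q|, so that the condition holds for every pair containing
    t_6. As t_1 t_2 -> 1 the integral diverges while 1 / Gamma(t_1 t_2; p, q) tends to 0, and the
    product has a limit. Taking t_1 = i u, t_2 = - i u keeps the pinch points away from z = 1 and z
    = -1, where 1 / Gamma(z^{+-2}; p, q) vanishes, and (1 - i u z)(1 + i u z) = 1 + u^2 z^2 leaves a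
    function of z^2. The zero supplies the factor 1 - u^2, whereas the Poisson kernel of parameter
    u^2 has numerator 1 - u^4; the missing 1 + u^2 -> 2 halves the limiting value. *)

(** * Limits in [C], inverses and the exponential on the circle *)

(** The balls of [C_UniformSpace] are squares; [sqrt 2] compares them with discs. *)
Lemma filterlim_Cmod (T : Type) (F : (T -> Prop) -> Prop) {FF : Filter F}
    (f : T -> C) (l : C) :
  filterlim f F (@locally C_UniformSpace l) <->
  (forall eps : R, (0 < eps)%R -> F (fun x => (Cmod (f x - l) < eps)%R)).
Proof.
have sqrt2 : (0 < sqrt 2)%R by apply: sqrt_lt_R0; lra.
split.
  move=> H eps e0.
  have e1 : (0 < eps / sqrt 2)%R by apply: Rdiv_lt_0_compat.
  move/(@filterlim_locally _ C_UniformSpace _ FF): H => /(_ (mkposreal _ e1)).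
  apply: filter_imp => x /C_NormedModule_mixin_compat2 /=.
  by replace (sqrt 2 * (eps / sqrt 2))%R with eps; [|field; lra].
move=> H; apply/(@filterlim_locally _ C_UniformSpace _ FF) => eps.
apply: filter_imp (H _ (cond_pos eps)) => x Hx.
exact: C_NormedModule_mixin_compat1.
Qed.

Lemma Clim_unique (T : Type) (F : (T -> Prop) -> Prop) {FF : ProperFilter F}
    (f : T -> C) (l : C) :
  filterlim f F (@locally C_UniformSpace l) -> Clim F f = l.
Proof.
move=> H; rewrite /Clim.
exact: (@iota_filterlim_locally _ C_R_CompleteNormedModule T F _ f l H).
Qed.

(** This default value makes [CinvK] and [CinvM] unconditional, so that inverting products creates
    no side conditions later. *)
Lemma Cinv0 : / (RtoC 0) = 0.
Proof. by rewrite /Cinv /= /Rdiv !Rmult_0_l Ropp_0 Rmult_0_l. Qed.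

Lemma CinvK (z : C) : / / z = z.
Proof.
have [->|z0] := Ceq_dec z 0; first by rewrite !Cinv0.
by field.
Qed.

Lemma CinvM (x y : C) : / (x * y) = / x * / y.
Proof.
have [->|x0] := Ceq_dec x 0; first by rewrite Cmult_0_l Cinv0 Cmult_0_l.
have [->|y0] := Ceq_dec y 0; first by rewrite Cmult_0_r Cinv0 Cmult_0_r.
by field.
Qed.

Lemma Cinv_neq0 (x : C) : x <> 0 -> / x <> 0.
Proof. by move=> x0 H; apply: x0; rewrite -(CinvK x) H Cinv0. Qed.

Lemma Cmod_inv' (x : C) : Cmod (/ x) = (/ Cmod x)%R.
Proof.
have [->|x0] := Ceq_dec x 0; last exact: Cmod_inv.
by rewrite Cinv0 Cmod_0 Rinv_0.
Qed.

Lemma Cmod_sub_sym (x y : C) : Cmod (x - y) = Cmod (y - x).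
Proof. by rewrite -Cmod_opp; congr Cmod; ring. Qed.

Lemma Cmod_neq0 (x : C) : (0 < Cmod x)%R -> x <> 0.
Proof. by move/Cmod_gt_0. Qed.

Lemma Cmod_le_eps0 (x : C) :
  (forall eps, (0 < eps)%R -> (Cmod x <= eps)%R) -> x = 0.
Proof.
move=> H; apply: Cmod_eq_0; have := Cmod_ge_0 x => H0.
case: (Req_dec (Cmod x) 0) => // H1.
have := H (Cmod x / 2)%R; lra.
Qed.

Lemma expiD (x y : R) : expi (x + y) = expi x * expi y.
Proof.
rewrite /expi cos_plus sin_plus /Cmult /=; congr pair; ring.
Qed.

Lemma expi0 : expi 0 = 1.
Proof. by rewrite /expi cos_0 sin_0. Qed.

Lemma Cmod_expi (x : R) : Cmod (expi x) = 1%R.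
Proof.
rewrite /Cmod /expi /= -[RHS]sqrt_1; congr sqrt.
have := sin2_cos2 x; rewrite /Rsqr; lra.
Qed.

Lemma expi_neq0 (x : R) : expi x <> 0.
Proof. by apply: Cmod_neq0; rewrite Cmod_expi; lra. Qed.

Lemma expi_inv (x : R) : / expi x = expi (- x).
Proof.
have H : expi (- x) * expi x = 1 by rewrite -expiD Rplus_opp_l expi0.
have := expi_neq0 x => e0.
by rewrite -[LHS]Cmult_1_l -H; field.
Qed.

Lemma expi_pow (x : R) (n : nat) : expi x ^ n = expi (INR n * x).
Proof.
elim: n => [|n IH]; first by rewrite /= Rmult_0_l expi0.
by rewrite Cpow_S IH S_INR -expiD; congr expi; ring.
Qed.

(** * Averages over circles centred at 0 *)

(** The scalars of [C_R_NormedModule] are real, so the complex factor is multiplied out on real and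
    imaginary parts. *)
Lemma is_RInt_Cscal (f : R -> C) (a b : R) (c v : C) :
  @is_RInt C_R_NormedModule f a b v ->
  @is_RInt C_R_NormedModule (fun x => c * f x) a b (c * v).
Proof.
move=> H.
have H1 := @is_RInt_fct_extend_fst R_NormedModule R_NormedModule _ _ _ _ H.
have H2 := @is_RInt_fct_extend_snd R_NormedModule R_NormedModule _ _ _ _ H.
apply: (@is_RInt_fct_extend_pair R_NormedModule R_NormedModule).
  exact: (@is_RInt_minus R_NormedModule _ _ _ _ _ _
    (@is_RInt_scal R_NormedModule _ _ _ c.1 _ H1)
    (@is_RInt_scal R_NormedModule _ _ _ c.2 _ H2)).
exact: (@is_RInt_plus R_NormedModule _ _ _ _ _ _
    (@is_RInt_scal R_NormedModule _ _ _ c.1 _ H2)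
    (@is_RInt_scal R_NormedModule _ _ _ c.2 _ H1)).
Qed.

(** Integrability and value in one predicate; the circle |z| = |w| is traversed starting from
    [w]. *)
Definition is_mean (f : C -> C) (w v : C) : Prop :=
  @is_RInt C_R_NormedModule (fun th => f (w * expi th)) 0 (2 * PI)
    (RtoC (2 * PI) * v).

Definition mean (f : C -> C) (w : C) : C :=
  / RtoC (2 * PI) * @RInt C_R_CompleteNormedModule
    (fun th => f (w * expi th)) 0 (2 * PI).

Lemma C2PI_neq0 : RtoC (2 * PI) <> 0.
Proof. by move=> /RtoC_inj; have := PI_RGT_0; lra. Qed.

Lemma is_mean_mean (f : C -> C) (w v : C) : is_mean f w v -> mean f w = v.
Proof.
rewrite /mean => H.
rewrite (@is_RInt_unique C_R_CompleteNormedModule _ _ _ _ H).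
by have := C2PI_neq0 => ?; field.
Qed.

Lemma is_mean_unique (f : C -> C) (w v v' : C) :
  is_mean f w v -> is_mean f w v' -> v = v'.
Proof. by move=> /is_mean_mean <- /is_mean_mean <-. Qed.

Lemma is_mean_ext (f g : C -> C) (w v : C) :
  (forall z, Cmod z = Cmod w -> f z = g z) -> is_mean f w v -> is_mean g w v.
Proof.
move=> fg; apply: is_RInt_ext => th _; apply: fg.
by rewrite Cmod_mult Cmod_expi Rmult_1_r.
Qed.

Lemma is_mean_add (f g : C -> C) (w v v' : C) :
  is_mean f w v -> is_mean g w v' -> is_mean (fun z => f z + g z) w (v + v').
Proof.
move=> H1 H2; rewrite /is_mean Cmult_plus_distr_l.
exact: (@is_RInt_plus C_R_NormedModule).
Qed.

Lemma is_mean_scal (f : C -> C) (w v c : C) :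
  is_mean f w v -> is_mean (fun z => c * f z) w (c * v).
Proof.
move=> H; rewrite /is_mean.
replace (RtoC (2 * PI) * (c * v)) with (c * (RtoC (2 * PI) * v)) by ring.
exact: is_RInt_Cscal.
Qed.

Lemma is_mean_sub (f g : C -> C) (w v v' : C) :
  is_mean f w v -> is_mean g w v' -> is_mean (fun z => f z - g z) w (v - v').
Proof.
move=> H1 H2.
replace (v - v') with (v + (- (1)) * v') by ring.
apply: is_mean_ext (is_mean_add _ _ _ _ _ H1 (is_mean_scal _ _ _ (- (1)) H2)).
by move=> z _; ring.
Qed.

Lemma is_mean_const (c w : C) : is_mean (fun _ => c) w c.
Proof.
rewrite /is_mean.
replace (RtoC (2 * PI) * c)
  with (@scal _ C_R_NormedModule (2 * PI - 0)%R c).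
  exact: (@is_RInt_const C_R_NormedModule).
by rewrite scal_R_Cmult Rminus_0_r.
Qed.

Lemma is_mean_close (f g : C -> C) (w v v' : C) (eps : R) :
  is_mean f w v -> is_mean g w v' ->
  (forall z, Cmod z = Cmod w -> (Cmod (f z - g z) <= eps)%R) ->
  (Cmod (v - v') <= eps)%R.
Proof.
move=> H1 H2 H.
have := is_mean_sub _ _ _ _ _ H1 H2; rewrite /is_mean => H3.
have p0 := PI_RGT_0.
have := @norm_RInt_le_const C_R_NormedModule _ _ _ _ eps _ _ H3.
rewrite -Cmod_norm Cmod_mult Cmod_R Rabs_pos_eq; last lra.
move=> H4; apply: (Rmult_le_reg_l (2 * PI)%R); first lra.
rewrite Rminus_0_r in H4; apply: H4; first lra.
move=> x _; rewrite -Cmod_norm; apply: H.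
by rewrite Cmod_mult Cmod_expi Rmult_1_r.
Qed.

(** The frequency [k] is a nonzero integer, presented as plus or minus a natural number. The
    primitives sin(k th) / k and - cos(k th) / k take equal values at 0 and 2 PI. *)
Lemma is_mean_expi (k : R) (w c : C) (g : C -> C) (n : nat) :
  (0 < n)%N -> (k = INR n \/ k = - INR n)%R ->
  (forall th, g (w * expi th) = c * expi (k * th)) ->
  is_mean g w 0.
Proof.
move=> n0 kn gE.
have n1 : (0 < INR n)%R by apply: lt_0_INR; apply/ltP.
have k0 : k <> 0%R by case: kn => ->; lra.
have E : expi (k * (2 * PI)) = expi (k * 0).
  rewrite Rmult_0_r expi0.
  have Hn m : expi (INR m * (2 * PI)) = 1.
    rewrite -expi_pow /expi cos_2PI sin_2PI; exact: Cpow_1_l.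
  case: kn => ->; first exact: Hn.
  rewrite -Ropp_mult_distr_l -expi_inv Hn; field.
rewrite /is_mean Cmult_0_r.
apply: (@is_RInt_ext C_R_NormedModule (fun th => c * expi (k * th))).
  by move=> th _; rewrite gE.
rewrite -(Cmult_0_r c).
apply: is_RInt_Cscal.
have E1 : ((sin (k * (2 * PI)) / k) - (sin (k * 0) / k) = 0)%R.
  by move/(congr1 snd): E; rewrite /expi /= => ->; ring.
have E2 : ((- cos (k * (2 * PI)) / k) - (- cos (k * 0) / k) = 0)%R.
  by move/(congr1 fst): E; rewrite /expi /= => ->; ring.
have cont_lin (x : R) : continuous (fun th => k * th)%R x.
  by apply: continuous_scal_r; exact: continuous_id.
have I1 : is_RInt (fun th => cos (k * th)) 0 (2 * PI) 0%R.
  have D x : is_derive (fun th => sin (k * th) / k)%R x (cos (k * x)).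
    by auto_derive => //; field.
  have := is_RInt_derive _ _ 0%R (2 * PI)%R (fun x _ => D x).
  rewrite /minus /plus /opp /= -/(Rminus _ _) E1; apply => x _.
  by apply: continuous_comp => //; exact: continuous_cos.
have I2 : is_RInt (fun th => sin (k * th)) 0 (2 * PI) 0%R.
  have D x : is_derive (fun th => - cos (k * th) / k)%R x (sin (k * x)).
    by auto_derive => //; field.
  have := is_RInt_derive _ _ 0%R (2 * PI)%R (fun x _ => D x).
  rewrite /minus /plus /opp /= -/(Rminus _ _) E2; apply => x _.
  by apply: continuous_comp => //; exact: continuous_sin.
exact: (@is_RInt_fct_extend_pair R_NormedModule R_NormedModule
  (fun th => expi (k * th)) _ _ _ _ I1 I2).
Qed.

(** * Uniform closures of Laurent polynomials *)

(** The integer exponents of [z] and [u] are the differences a - b and m - n. *)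
Definition lmono (a b m n : nat) (z u : C) : C :=
  z ^ a * (/ z) ^ b * u ^ m * (/ u) ^ n.

Inductive lpoly : (C -> C -> C) -> Prop :=
| lpoly_mono c a b m n : lpoly (fun z u => c * lmono a b m n z u)
| lpoly_add P Q : lpoly P -> lpoly Q -> lpoly (fun z u => P z u + Q z u).

(** Bounded and bounded away from 0: on such sets every Laurent polynomial is bounded and
    Lipschitz. *)
Definition tame (A : C -> Prop) : Prop :=
  exists M : R, (0 <= M)%R /\
    forall z, A z -> [/\ z <> 0, (Cmod z <= M)%R & (Cmod (/ z) <= M)%R].

(* Uniformly approximable on A x B by Laurent polynomials in two variables.
   Used in place of holomorphy: it is stable under sums, products, uniform limits
   and averaging over one variable, and Cauchy's theorem is immediate for it. *)
Definition inH (A B : C -> Prop) (f : C -> C -> C) : Prop :=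
  forall eps : R, (0 < eps)%R -> exists P, lpoly P /\
    forall z u, A z -> B u -> (Cmod (f z u - P z u) <= eps)%R.

Lemma lpoly_const c : exists2 P, lpoly P & forall z u, P z u = c.
Proof. by eexists; [exact: (lpoly_mono c 0 0 0 0)|move=> z u /=; rewrite /lmono /=; ring]. Qed.

Lemma lpoly_mul P Q : lpoly P -> lpoly Q ->
  exists2 S, lpoly S & forall z u, S z u = P z u * Q z u.
Proof.
move=> HP HQ; elim: HP => {P} [c a b m n|P1 P2 _ [S1 H1 E1] _ [S2 H2 E2]].
  elim: HQ => {Q} [c' a' b' m' n'|Q1 Q2 _ [S1 H1 E1] _ [S2 H2 E2]].
    exists (fun z u => (c * c') * lmono (a + a') (b + b') (m + m') (n + n') z u).
      exact: lpoly_mono.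
    by move=> z u; rewrite /lmono !Cpow_add_r; ring.
  exists (fun z u => S1 z u + S2 z u); first exact: lpoly_add.
  by move=> z u; rewrite E1 E2; ring.
exists (fun z u => S1 z u + S2 z u); first exact: lpoly_add.
by move=> z u; rewrite E1 E2; ring.
Qed.

Section Tame.
Variables A B : C -> Prop.
Hypotheses (tA : tame A) (tB : tame B).

Definition bounded2 (f : C -> C -> C) := exists2 M : R, (0 <= M)%R &
  forall z u, A z -> B u -> (Cmod (f z u) <= M)%R.

Definition lip2 (f : C -> C -> C) := exists2 L : R, (0 <= L)%R &
  forall z u z' u', A z -> B u -> A z' -> B u' ->
    (Cmod (f z u - f z' u') <= L * (Cmod (z - z') + Cmod (u - u')))%R.

Definition blip2 f := bounded2 f /\ lip2 f.

Lemma blip2_const c : blip2 (fun _ _ => c).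
Proof.
split; first by exists (Cmod c) => [|*]; [exact: Cmod_ge_0|lra].
exists 0%R => [|z u z' u' *]; first lra.
have -> : c - c = 0 by ring.
by rewrite Cmod_0; lra.
Qed.

Lemma blip2_add f g : blip2 f -> blip2 g -> blip2 (fun z u => f z u + g z u).
Proof.
move=> [[M M0 H] [L L0 H']] [[N N0 K] [O O0 K']]; split.
  exists (M + N)%R => [|z u Az Bu]; first lra.
  apply: Rle_trans (Cmod_triangle _ _) _; have := H z u Az Bu; have := K z u Az Bu; lra.
exists (L + O)%R => [|z u z' u' Az Bu Az' Bu']; first lra.
have -> : f z u + g z u - (f z' u' + g z' u') =
  (f z u - f z' u') + (g z u - g z' u') by ring.
apply: Rle_trans (Cmod_triangle _ _) _.
have := H' z u z' u' Az Bu Az' Bu'; have := K' z u z' u' Az Bu Az' Bu'; lra.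
Qed.

Lemma blip2_mul f g : blip2 f -> blip2 g -> blip2 (fun z u => f z u * g z u).
Proof.
move=> [[M M0 H] [L L0 H']] [[N N0 K] [O O0 K']]; split.
  exists (M * N)%R => [|z u Az Bu]; first nra.
  rewrite Cmod_mult; apply: Rmult_le_compat; try exact: Cmod_ge_0.
    exact: H.
  exact: K.
exists (M * O + L * N)%R => [|z u z' u' Az Bu Az' Bu']; first nra.
have -> : f z u * g z u - f z' u' * g z' u' =
  f z u * (g z u - g z' u') + (f z u - f z' u') * g z' u' by ring.
apply: Rle_trans (Cmod_triangle _ _) _; rewrite !Cmod_mult Rmult_plus_distr_r.
set D := (Cmod (z - z') + Cmod (u - u'))%R.
have D0 : (0 <= D)%R by apply: Rplus_le_le_0_compat; exact: Cmod_ge_0.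
have -> : (M * O * D + L * N * D = M * (O * D) + (L * D) * N)%R by ring.
apply: Rplus_le_compat; apply: Rmult_le_compat; try exact: Cmod_ge_0.
- exact: H.
- exact: K'.
- exact: H'.
exact: K.
Qed.

Lemma Cmod_inv_sub (z z' : C) : z <> 0 -> z' <> 0 ->
  Cmod (/ z - / z') = (Cmod (/ z) * Cmod (/ z') * Cmod (z - z'))%R.
Proof.
move=> z0 z0'; rewrite (Cmod_sub_sym z z') -!Cmod_mult.
by congr Cmod; field.
Qed.

Lemma blip2_z : blip2 (fun z _ => z).
Proof.
case: tA => M [M0 H]; split; first by exists M => // z u /H [].
exists 1%R => [|z u z' u' *]; first lra.
have := Cmod_ge_0 (u - u'); lra.
Qed.

Lemma blip2_u : blip2 (fun _ u => u).
Proof.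
case: tB => M [M0 H]; split; first by exists M => // z u _ /H [].
exists 1%R => [|z u z' u' *]; first lra.
have := Cmod_ge_0 (z - z'); lra.
Qed.

Lemma blip2_zinv : blip2 (fun z _ => / z).
Proof.
case: tA => M [M0 H]; split; first by exists M => // z u /H [].
exists (M * M)%R => [|z u z' u' /H [z0 _ zM] _ /H [z0' _ zM'] _]; first nra.
rewrite Cmod_inv_sub //; apply: Rmult_le_compat.
- by apply: Rmult_le_pos; exact: Cmod_ge_0.
- exact: Cmod_ge_0.
- by apply: Rmult_le_compat => //; exact: Cmod_ge_0.
have := Cmod_ge_0 (u - u'); lra.
Qed.

Lemma blip2_uinv : blip2 (fun _ u => / u).
Proof.
case: tB => M [M0 H]; split; first by exists M => // z u _ /H [].
exists (M * M)%R => [|z u z' u' _ /H [z0 _ zM] _ /H [z0' _ zM']]; first nra.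
rewrite Cmod_inv_sub //; apply: Rmult_le_compat.
- by apply: Rmult_le_pos; exact: Cmod_ge_0.
- exact: Cmod_ge_0.
- by apply: Rmult_le_compat => //; exact: Cmod_ge_0.
have := Cmod_ge_0 (z - z'); lra.
Qed.

Lemma blip2_pow f n : blip2 f -> blip2 (fun z u => f z u ^ n).
Proof.
move=> H; elim: n => [|n IH]; first exact: blip2_const.
exact: blip2_mul.
Qed.

Lemma lpoly_blip P : lpoly P -> blip2 P.
Proof.
elim=> {P} [c a b m n|P Q _ HP _ HQ]; last exact: blip2_add.
apply: blip2_mul; first exact: blip2_const.
rewrite /lmono.
do 3 (apply: blip2_mul; last by
  [apply: (blip2_pow _ _ blip2_uinv)|apply: (blip2_pow _ _ blip2_u)
  |apply: (blip2_pow _ _ blip2_zinv)]).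
exact: (blip2_pow _ _ blip2_z).
Qed.

Lemma inH_ext f g : (forall z u, A z -> B u -> f z u = g z u) -> inH A B f -> inH A B g.
Proof.
move=> E H eps e0; have [P [HP HPf]] := H eps e0.
by exists P; split=> // z u Az Bu; rewrite -E //; apply: HPf.
Qed.

Lemma inH_lpoly P : lpoly P -> inH A B P.
Proof.
move=> HP eps e0; exists P; split=> // z u _ _.
have -> : P z u - P z u = 0 by ring.
by rewrite Cmod_0; lra.
Qed.

Lemma inH_ulim f :
  (forall eps, (0 < eps)%R -> exists2 g, inH A B g &
    forall z u, A z -> B u -> (Cmod (f z u - g z u) <= eps)%R) -> inH A B f.
Proof.
move=> H eps e0; have e2 : (0 < eps / 2)%R by lra.
have [g Hg fg] := H _ e2; have [P [HP gP]] := Hg _ e2.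
exists P; split=> // z u Az Bu.
have -> : f z u - P z u = (f z u - g z u) + (g z u - P z u) by ring.
apply: Rle_trans (Cmod_triangle _ _) _.
have := fg z u Az Bu; have := gP z u Az Bu; lra.
Qed.

Lemma inH_const c : inH A B (fun _ _ => c).
Proof.
have [P HP E] := lpoly_const c.
by apply: inH_ext (inH_lpoly _ HP) => z u _ _; rewrite E.
Qed.

Lemma inH_lmono a b m n : inH A B (lmono a b m n).
Proof.
by apply: inH_ext (inH_lpoly _ (lpoly_mono 1 a b m n)) => z u _ _; ring.
Qed.

Lemma inH_z : inH A B (fun z _ => z).
Proof. by apply: inH_ext (inH_lmono 1 0 0 0) => z u _ _; rewrite /lmono /=; ring. Qed.
Lemma inH_zinv : inH A B (fun z _ => / z).
Proof. by apply: inH_ext (inH_lmono 0 1 0 0) => z u _ _; rewrite /lmono /=; ring. Qed.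
Lemma inH_u : inH A B (fun _ u => u).
Proof. by apply: inH_ext (inH_lmono 0 0 1 0) => z u _ _; rewrite /lmono /=; ring. Qed.
Lemma inH_uinv : inH A B (fun _ u => / u).
Proof. by apply: inH_ext (inH_lmono 0 0 0 1) => z u _ _; rewrite /lmono /=; ring. Qed.

Lemma inH_add f g : inH A B f -> inH A B g -> inH A B (fun z u => f z u + g z u).
Proof.
move=> Hf Hg eps e0; have e2 : (0 < eps / 2)%R by lra.
have [P [HP fP]] := Hf _ e2; have [Q [HQ gQ]] := Hg _ e2.
exists (fun z u => P z u + Q z u); split; first exact: lpoly_add.
move=> z u Az Bu.
have -> : f z u + g z u - (P z u + Q z u) = (f z u - P z u) + (g z u - Q z u) by ring.
apply: Rle_trans (Cmod_triangle _ _) _.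
have := fP z u Az Bu; have := gQ z u Az Bu; lra.
Qed.

Lemma inH_bounded f : inH A B f -> bounded2 f.
Proof.
move=> /(_ 1%R Rlt_0_1) [P [/lpoly_blip [[M M0 HM] _] H]].
exists (1 + M)%R => [|z u Az Bu]; first lra.
have -> : f z u = (f z u - P z u) + P z u by ring.
apply: Rle_trans (Cmod_triangle _ _) _.
have := H z u Az Bu; have := HM z u Az Bu; lra.
Qed.

Lemma inH_mul f g : inH A B f -> inH A B g -> inH A B (fun z u => f z u * g z u).
Proof.
move=> Hf Hg eps e0.
have [M M0 HM] := inH_bounded _ Hf.
have e2 : (0 < eps / 2 / (1 + M))%R by apply: Rdiv_lt_0_compat; lra.
have [Q [HQ gQ]] := Hg _ e2.
have [[N N0 HN] _] := lpoly_blip _ HQ.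
(* The precision for [f] is fixed only after [Q], since the bound [N] of [Q] enters it. *)
have e3 : (0 < eps / 2 / (1 + N))%R by apply: Rdiv_lt_0_compat; lra.
have [P [HP fP]] := Hf _ e3.
have [S HS SE] := lpoly_mul _ _ HP HQ.
exists S; split=> // z u Az Bu; rewrite SE.
have -> : f z u * g z u - P z u * Q z u =
  f z u * (g z u - Q z u) + (f z u - P z u) * Q z u by ring.
apply: Rle_trans (Cmod_triangle _ _) _; rewrite !Cmod_mult.
have H1 : (Cmod (f z u) * Cmod (g z u - Q z u) <= (1 + M) * (eps / 2 / (1 + M)))%R.
  apply: Rmult_le_compat; try exact: Cmod_ge_0; last exact: gQ.
  by have := HM z u Az Bu; lra.
have H2 : (Cmod (f z u - P z u) * Cmod (Q z u) <= (eps / 2 / (1 + N)) * (1 + N))%R.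
  apply: Rmult_le_compat; try exact: Cmod_ge_0; first exact: fP.
  by have := HN z u Az Bu; lra.
have E1 : ((1 + M) * (eps / 2 / (1 + M)) = eps / 2)%R by field; lra.
have E2 : (eps / 2 / (1 + N) * (1 + N) = eps / 2)%R by field; lra.
lra.
Qed.

Lemma inH_scal c f : inH A B f -> inH A B (fun z u => c * f z u).
Proof. by apply: inH_mul; exact: inH_const. Qed.

Lemma inH_sub f g : inH A B f -> inH A B g -> inH A B (fun z u => f z u - g z u).
Proof.
move=> Hf Hg; apply: inH_ext (inH_add _ _ Hf (inH_scal (- (1)) _ Hg)) => z u _ _; ring.
Qed.

Lemma inH_pow f n : inH A B f -> inH A B (fun z u => f z u ^ n).
Proof.
by move=> H; elim: n => [|n IH]; [exact: inH_const|exact: inH_mul].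
Qed.

Lemma inH_prod n (f : 'I_n -> C -> C -> C) :
  (forall i, inH A B (f i)) -> inH A B (fun z u => \Cprod_(i < n) f i z u).
Proof.
elim: n f => [|n IH] f H.
  by apply: inH_ext (inH_const 1) => z u _ _; rewrite big_ord0.
apply: inH_ext (inH_mul _ _ (IH _ (fun i => H (widen_ord (leqnSn n) i))) (H ord_max)).
by move=> z u _ _; rewrite big_ord_recr.
Qed.

Lemma geom_tail (y : C) (R0 : R) (n : nat) : (Cmod y <= R0 < 1)%R ->
  exists2 s : C, (1 - y) * s = 1 - y ^ n & (Cmod (/ (1 - y) - s) <= R0 ^ n / (1 - R0))%R.
Proof.
move=> [yR R1].
have y1 : 1 - y <> 0.
  move=> H; have : y = 1 by rewrite -[LHS]Cplus_0_r -H; ring.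
  by move=> E; rewrite E Cmod_1 in yR; lra.
exists ((1 - y ^ n) / (1 - y)); first by field.
have -> : / (1 - y) - (1 - y ^ n) / (1 - y) = y ^ n / (1 - y) by field.
rewrite Cmod_div // Cmod_pow /Rdiv.
have H1 : (1 - R0 <= Cmod (1 - y))%R.
  have := Cmod_triangle (1 - y) y; have -> : 1 - y + y = 1 by ring.
  rewrite Cmod_1; lra.
apply: Rmult_le_compat.
- by apply: pow_le; exact: Cmod_ge_0.
- apply: Rlt_le; apply: Rinv_0_lt_compat; lra.
- by apply: pow_incr; split; [exact: Cmod_ge_0|].
apply: Rinv_le_contravar; lra.
Qed.

(** Partial sums of the geometric series are the approximants. Reciprocals other than those of
    monomials come into [inH] through this lemma, one factor 1 - y at a time. *)
Lemma inH_geom y (R0 : R) : inH A B y -> (R0 < 1)%R ->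
  (forall z u, A z -> B u -> (Cmod (y z u) <= R0)%R) ->
  inH A B (fun z u => / (1 - y z u)).
Proof.
move=> Hy R1 yR; apply: inH_ulim => eps e0.
(* [R0] may be negative when [A] or [B] is empty. *)
pose R2 := Rmax R0 0.
have R20 : (0 <= R2 < 1)%R by rewrite /R2; split; [exact: Rmax_r|apply: Rmax_lub_lt; lra].
have e1 : (0 < eps * (1 - R2))%R by nra.
have [n Hn] := pow_lt_1_zero R2 (ltac:(rewrite Rabs_pos_eq; lra)) _ e1.
pose s := fix s (n : nat) z u := match n with O => RtoC 0 | S n => s n z u + y z u ^ n end.
have sE m z u : (1 - y z u) * s m z u = 1 - y z u ^ m.
  elim: m => [|m IH] /=; first ring.
  by rewrite Cmult_plus_distr_l IH; ring.
exists (s n).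
  elim: n {Hn} => [|n IH] /=; first exact: inH_const.
  by apply: inH_add => //; exact: inH_pow.
move=> z u Az Bu.
have yR2 : (Cmod (y z u) <= R2 < 1)%R.
  by split; [apply: Rle_trans (Rmax_l _ _); exact: yR|lra].
have [t tE tH] := geom_tail (y z u) R2 n yR2.
have y1 : 1 - y z u <> 0.
  move=> H; have : y z u = 1 by rewrite -[LHS]Cplus_0_r -H; ring.
  by move=> E; rewrite E Cmod_1 in yR2; lra.
have -> : s n z u = t.
  have H : (1 - y z u) * s n z u = (1 - y z u) * t by rewrite sE tE.
  have : / (1 - y z u) * ((1 - y z u) * s n z u) = / (1 - y z u) * ((1 - y z u) * t) by rewrite H.
  by rewrite !Cmult_assoc Cinv_l // !Cmult_1_l.
apply: Rle_trans tH _.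
have := Hn n (Nat.le_refl n); rewrite Rabs_pos_eq; last by apply: pow_le; lra.
move=> H; apply/Rlt_le/(Rmult_lt_reg_r (1 - R2)); first lra.
by have -> : (R2 ^ n / (1 - R2) * (1 - R2) = R2 ^ n)%R by field; lra.
Qed.

Lemma inH_cont f : inH A B f -> forall eps, (0 < eps)%R -> exists2 d, (0 < d)%R &
  forall z u z' u', A z -> B u -> A z' -> B u' ->
    (Cmod (z - z') < d)%R -> (Cmod (u - u') < d)%R -> (Cmod (f z u - f z' u') < eps)%R.
Proof.
move=> Hf eps e0; have e4 : (0 < eps / 4)%R by lra.
have [P [/lpoly_blip [_ [L L0 HL]] HP]] := Hf _ e4.
exists (eps / (8 * (L + 1)))%R; first by apply: Rdiv_lt_0_compat; lra.
move=> z u z' u' Az Bu Az' Bu' dz du.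
have -> : f z u - f z' u' = (f z u - P z u) + ((P z u - P z' u') + - (f z' u' - P z' u')) by ring.
apply: Rle_lt_trans (Cmod_triangle _ _) _.
have H1 := Cmod_triangle (P z u - P z' u') (- (f z' u' - P z' u')).
rewrite Cmod_opp in H1.
have H2 := HL z u z' u' Az Bu Az' Bu'.
have H3 := HP z u Az Bu; have H4 := HP z' u' Az' Bu'.
have H5 : (L * (Cmod (z - z') + Cmod (u - u')) <= (L + 1) * (2 * (eps / (8 * (L + 1)))))%R.
  apply: Rmult_le_compat; try lra.
  by apply: Rplus_le_le_0_compat; exact: Cmod_ge_0.
have H6 : ((L + 1) * (2 * (eps / (8 * (L + 1)))) = eps / 4)%R by field; lra.
lra.
Qed.

End Tame.

Lemma inH_swap (A B : C -> Prop) f : inH A B f -> inH B A (fun z u => f u z).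
Proof.
move=> H eps e0; have [P [HP E]] := H _ e0.
have [Q HQ QE] : exists2 Q, lpoly Q & forall z u, Q z u = P u z.
  elim: HP => {P E} [c a b m n|P1 P2 _ [Q1 H1 E1] _ [Q2 H2 E2]].
    by eexists; [exact: (lpoly_mono c m n a b)|move=> z u; rewrite /lmono; ring].
  by eexists; [exact: (lpoly_add _ _ H1 H2)|move=> z u /=; rewrite E1 E2].
by exists Q; split=> // z u Az Bu; rewrite QE; apply: E.
Qed.

(** * Circle means *)

(** Choice turns the approximants of precision 1 / (n + 1) into a sequence, to which the exchange of
    uniform limit and integral applies. *)
Lemma is_mean_lim (f : C -> C) (w : C) :
  (forall eps : R, (0 < eps)%R -> exists g v, is_mean g w v /\
     forall z, Cmod z = Cmod w -> (Cmod (f z - g z) <= eps)%R) ->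
  is_mean f w (mean f w).
Proof.
move=> H.
have e (n : nat) : (0 < / (INR n + 1))%R.
  by apply: Rinv_0_lt_compat; have := pos_INR n; lra.
have H' n : exists gv : (C -> C) * C, is_mean gv.1 w gv.2 /\
     forall z, Cmod z = Cmod w -> (Cmod (f z - gv.1 z) <= / (INR n + 1))%R.
  by have [g [v Hgv]] := H _ (e n); exists (g, v).
pose G n := proj1_sig (constructive_indefinite_description _ (H' n)).
have GH n := proj2_sig (constructive_indefinite_description _ (H' n)).
rewrite -/(G _) in GH.
have [||If [_ HI]] := @filterlim_RInt nat C_R_CompleteNormedModule
  (fun n th => (G n).1 (w * expi th)) 0 (2 * PI) eventually _
  (fun th => f (w * expi th)) (fun n => RtoC (2 * PI) * (G n).2).
- by move=> n; case: (GH n).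
- apply/filterlim_locally => eps.
  have [N HN] := archimed_cor1 _ (cond_pos eps).
  exists N => n nN th; apply: C_NormedModule_mixin_compat1.
  rewrite /minus /plus /opp /= -/(Cminus _ _) Cmod_sub_sym.
  case: (GH n) => _ /(_ (w * expi th)) H1.
  apply: Rle_lt_trans (H1 _) _; first by rewrite Cmod_mult Cmod_expi Rmult_1_r.
  case: HN => H2 H3; apply: Rlt_trans H2.
  apply: Rinv_lt_contravar; last by have := le_INR _ _ nN; lra.
  have := pos_INR n; have := lt_0_INR _ H3; nra.
have -> // : mean f w = / RtoC (2 * PI) * If.
  rewrite /mean; congr Cmult.
  exact: (@is_RInt_unique C_R_CompleteNormedModule).
rewrite /is_mean Cmult_assoc Cinv_r ?Cmult_1_l //.
exact: C2PI_neq0.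
Qed.

Lemma Cpow_inv' (z : C) n : (/ z) ^ n = / (z ^ n).
Proof.
elim: n => [|n IH] /=; first by field.
by rewrite IH CinvM.
Qed.

Lemma Cpow_mul_inv (z : C) n : z <> 0 -> z ^ n * (/ z) ^ n = 1.
Proof. by move=> z0; rewrite Cpow_inv' Cinv_r //; exact: Cpow_nz. Qed.

Lemma is_mean_zpow (w : C) (a b : nat) : w <> 0 ->
  is_mean (fun z => z ^ a * (/ z) ^ b) w (if a == b then 1 else 0).
Proof.
move=> w0; have [->|ab] := eqVneq a b.
  apply: is_mean_ext (is_mean_const 1 w) => z zw.
  rewrite Cpow_mul_inv //; apply: Cmod_neq0; rewrite zw; exact/Cmod_gt_0.
have E k : (k = INR a - INR b)%R ->
    forall th, (w * expi th) ^ a * (/ (w * expi th)) ^ b =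
    w ^ a * (/ w) ^ b * expi (k * th).
  move=> -> th; rewrite CinvM expi_inv !Cpow_mult_l !expi_pow.
  have -> : ((INR a - INR b) * th = INR a * th + INR b * - th)%R by ring.
  by rewrite expiD; ring.
have [lt_ab|le_ba] := ltnP a b.
  apply: (is_mean_expi (INR a - INR b) _ (w ^ a * (/ w) ^ b) _ (b - a)).
  - by rewrite subn_gt0.
  - by right; rewrite minus_INR; [ring|apply/leP; exact: ltnW].
  exact: E.
apply: (is_mean_expi (INR a - INR b) _ (w ^ a * (/ w) ^ b) _ (a - b)).
- by rewrite subn_gt0 ltn_neqAle eq_sym ab.
- by left; rewrite minus_INR; [ring|apply/leP].
exact: E.
Qed.

(** Only the monomials with a = b survive, whatever the radius: this is Cauchy's theorem for Laurent
    polynomials. What remains is a Laurent polynomial in [u]; the second argument [v] of [Q] is a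
    dummy. *)
Lemma lpoly_mean P : lpoly P -> exists2 Q, lpoly Q &
  forall (w u v : C), w <> 0 -> is_mean (fun z => P z u) w (Q u v).
Proof.
elim=> {P} [c a b m n|P1 P2 _ [Q1 H1 E1] _ [Q2 H2 E2]]; last first.
  exists (fun u v => Q1 u v + Q2 u v); first exact: lpoly_add.
  by move=> w u v w0; apply: is_mean_add; [exact: E1|exact: E2].
exists (fun u v => (if a == b then c else 0) * lmono m n 0 0 u v); first exact: lpoly_mono.
move=> w u v w0.
have := is_mean_scal _ _ _ (c * (u ^ m * (/ u) ^ n)) (is_mean_zpow w a b w0).
have -> : (if a == b then c else 0) * lmono m n 0 0 u v =
  c * (u ^ m * (/ u) ^ n) * (if a == b then 1 else 0).
  by rewrite /lmono /=; case: eqP => _; ring.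
by apply: is_mean_ext => z _; rewrite /lmono; ring.
Qed.

Section MeanH.
Variables A B : C -> Prop.
Hypotheses (tA : tame A) (tB : tame B).

Definition circ (w : C) := forall z, Cmod z = Cmod w -> A z.

Lemma circ_neq0 w : circ w -> w <> 0.
Proof. by case: tA => M [_ H] /(_ w erefl) /H []. Qed.

Lemma inH_is_mean f u w : inH A B f -> B u -> circ w ->
  is_mean (fun z => f z u) w (mean (fun z => f z u) w).
Proof.
move=> Hf Bu cw; apply: is_mean_lim => eps e0.
have [P [/lpoly_mean [Q _ PQ] H]] := Hf _ e0.
exists (fun z => P z u), (Q u 1); split; first by apply: PQ; exact: circ_neq0.
by move=> z /cw Az; apply: H.
Qed.

Lemma inH_mean f w D : inH A B f -> circ w ->
  inH B D (fun u _ => mean (fun z => f z u) w).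
Proof.
move=> Hf cw eps e0.
have [P [/lpoly_mean [Q HQ PQ] H]] := Hf _ e0.
exists Q; split=> // u v Bu _.
apply: (is_mean_close _ _ _ _ _ _ (inH_is_mean _ _ _ Hf Bu cw)).
  by apply: PQ; exact: circ_neq0 cw.
by move=> z /cw Az; apply: H.
Qed.

(** Cauchy's theorem: an approximating Laurent polynomial has the same mean [Q u 1] on both
    circles. *)
Lemma mean_indep f u w w' : inH A B f -> B u -> circ w -> circ w' ->
  mean (fun z => f z u) w = mean (fun z => f z u) w'.
Proof.
move=> Hf Bu cw cw'.
suff : mean (fun z => f z u) w - mean (fun z => f z u) w' = 0.
  by move=> H; rewrite -[RHS]Cplus_0_r -H; ring.
apply: Cmod_le_eps0 => eps e0; have e2 : (0 < eps / 2)%R by lra.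
have [P [/lpoly_mean [Q HQ PQ] H]] := Hf _ e2.
have K v (cv : circ v) : (Cmod (mean (fun z => f z u) v - Q u 1) <= eps / 2)%R.
  apply: (is_mean_close _ _ _ _ _ _ (inH_is_mean _ _ _ Hf Bu cv)).
    by apply: PQ; exact: circ_neq0 cv.
  by move=> z /cv Az; apply: H.
have -> : mean (fun z => f z u) w - mean (fun z => f z u) w' =
  (mean (fun z => f z u) w - Q u 1) + - (mean (fun z => f z u) w' - Q u 1) by ring.
apply: Rle_trans (Cmod_triangle _ _) _; rewrite Cmod_opp.
have := K w cw; have := K w' cw'; lra.
Qed.

(** The substitution z -> 1 / z is checked on monomials, where it exchanges the exponents [a] and
    [b] and so preserves the constant term; uniform approximation does the rest. *)
Lemma mean_inv f u w : inH A B f -> B u -> circ w -> circ (/ w) ->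
  is_mean (fun z => f (/ z) u) w (mean (fun z => f z u) (/ w)).
Proof.
move=> Hf Bu cw cw'.
have w0 := circ_neq0 _ cw; have w0' := circ_neq0 _ cw'.
have aux eps : (0 < eps)%R -> exists g v, is_mean g w v /\
   (forall z : C, Cmod z = Cmod w -> (Cmod (f (/ z)%C u - g z) <= eps)%R) /\
   (Cmod (mean (fun z => f z u) (/ w) - v) <= eps)%R.
  move=> e0; have [P [HP H]] := Hf _ e0.
  have [v [Pv Pv']] : exists v, is_mean (fun z => P z u) (/ w) v /\ is_mean (fun z => P (/ z) u) w v.
    elim: HP {H} => {P} [c a b m n|P1 P2 _ [v1 [H1 H1']] _ [v2 [H2 H2']]]; last first.
      by exists (v1 + v2); split; apply: is_mean_add.
    exists (c * (u ^ m * (/ u) ^ n) * (if a == b then 1 else 0)); split.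
      have := is_mean_scal _ _ _ (c * (u ^ m * (/ u) ^ n)) (is_mean_zpow _ a b w0').
      by apply: is_mean_ext => z _; rewrite /lmono; ring.
    have := is_mean_scal _ _ _ (c * (u ^ m * (/ u) ^ n)) (is_mean_zpow _ b a w0).
    rewrite eq_sym.
    by apply: is_mean_ext => z _; rewrite /lmono CinvK; ring.
  exists (fun z => P (/ z) u), v; split=> //; split.
    by move=> z zw; apply: H => //; apply: cw'; rewrite !Cmod_inv' zw.
  apply: (is_mean_close _ _ _ _ _ _ (inH_is_mean _ _ _ Hf Bu cw') Pv).
  by move=> z /cw' Az; apply: H.
have M : is_mean (fun z => f (/ z) u) w (mean (fun z => f (/ z) u) w).
  by apply: is_mean_lim => eps /aux [g [v [H1 [H2 _]]]]; exists g, v.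
suff <- : mean (fun z => f (/ z) u) w = mean (fun z => f z u) (/ w) by [].
suff : mean (fun z => f (/ z) u) w - mean (fun z => f z u) (/ w) = 0.
  by move=> H; rewrite -[RHS]Cplus_0_r -H; ring.
apply: Cmod_le_eps0 => eps e0; have e2 : (0 < eps / 2)%R by lra.
have [g [v [H1 [H2 H3]]]] := aux _ e2.
have H4 := is_mean_close _ _ _ _ _ _ M H1 H2.
rewrite Cmod_sub_sym in H3.
have := Cmod_triangle (mean (fun z => f (/ z) u) w - v) (v - mean (fun z => f z u) (/ w)).
have -> : mean (fun z => f (/ z) u) w - v + (v - mean (fun z => f z u) (/ w)) =
  mean (fun z => f (/ z) u) w - mean (fun z => f z u) (/ w) by ring.
lra.
Qed.

End MeanH.

(** * Uniqueness of Laurent coefficients *)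

(** The primitive of [h] lies between 0 and the total integral 0, so it is locally constant at [x],
    and its derivative there is [h x]. *)
Lemma continuous_int_zero (h : R -> R) (b x : R) :
  (forall y, continuous h y) -> (forall y, 0 <= h y)%R ->
  is_RInt h 0 b 0 -> (0 < x < b)%R -> h x = 0%R.
Proof.
move=> hc h0 hi xb.
have ex a c : ex_RInt h a c by apply: ex_RInt_continuous => z _; apply: hc.
pose F y := RInt h 0 y.
have F0 y : (0 < y < b)%R -> F y = 0%R.
  move=> yb; apply: Rle_antisym.
    have H := RInt_Chasles h 0 y b (ex _ _) (ex _ _).
    rewrite (is_RInt_unique _ _ _ _ hi) /plus /= in H.
    have H1 : (0 <= RInt h y b)%R by apply: RInt_ge_0 => //; lra.
    rewrite /F; lra.
  by apply: RInt_ge_0 => //; lra.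
have D : is_derive F x (h x).
  apply: (is_derive_RInt h F 0 x _ (hc x)).
  apply: filter_forall => y; exact: RInt_correct.
have D0 : is_derive F x 0%R.
  apply: (is_derive_ext_loc (fun _ => 0%R)); last exact: is_derive_const.
  have e0 : (0 < Rmin x (b - x))%R by apply: Rmin_glb_lt; lra.
  exists (mkposreal _ e0) => y; rewrite /ball /= /AbsRing_ball /= /abs /minus /plus /opp /= => H.
  symmetry; apply: F0.
  have := Rmin_l x (b - x); have := Rmin_r x (b - x).
  by move/Rabs_def2: H; lra.
by rewrite -(is_derive_unique _ _ _ D) (is_derive_unique _ _ _ D0).
Qed.

Lemma expi_cont (x eps : R) : (0 < eps)%R ->
  locally x (fun y => (Cmod (expi y - expi x) < eps)%R).
Proof.
move=> e0.
have e2 : (0 < eps / 2)%R by lra.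
have H1 : locally x (fun y => ball (cos x) (mkposreal _ e2) (cos y)).
  by have /filterlim_locally := continuous_cos x; apply.
have H2 : locally x (fun y => ball (sin x) (mkposreal _ e2) (sin y)).
  by have /filterlim_locally := continuous_sin x; apply.
apply: filter_imp (filter_and _ _ H1 H2) => y [B1 B2].
rewrite /ball /= /AbsRing_ball /= /abs /minus /plus /opp /= in B1 B2.
have -> : expi y - expi x = RtoC (cos y - cos x) + Ci * RtoC (sin y - sin x).
  by rewrite /expi /Cminus /Copp /Cplus /Cmult /=; congr pair; ring.
apply: Rle_lt_trans (Cmod_triangle _ _) _.
rewrite Cmod_mult Cmod_Ci !Cmod_R Rmult_1_l /Rminus; lra.
Qed.

Section Fourier.
Variables A B : C -> Prop.
Hypotheses (tA : tame A) (tB : tame B).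

Lemma inH_circle_cont f u w x : inH A B f -> B u -> circ A w ->
  forall eps, (0 < eps)%R ->
  locally x (fun y => (Cmod (f (w * expi y)%C u - f (w * expi x)%C u) < eps)%R).
Proof.
move=> Hf Bu cw eps e0; have [d d0 Hd] := inH_cont _ _ tA tB _ Hf _ e0.
have wm : (0 < Cmod w)%R by apply/Cmod_gt_0/(circ_neq0 _ tA).
have e1 : (0 < d / Cmod w)%R by apply: Rdiv_lt_0_compat.
have cA y : A (w * expi y) by apply: cw; rewrite Cmod_mult Cmod_expi Rmult_1_r.
apply: filter_imp (expi_cont x _ e1) => y H; apply: Hd => //.
  have -> : w * expi y - w * expi x = w * (expi y - expi x) by ring.
  rewrite Cmod_mult; apply: (Rmult_lt_reg_r (/ Cmod w)%R); first exact: Rinv_0_lt_compat.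
  have -> : (Cmod w * Cmod (expi y - expi x) * / Cmod w = Cmod (expi y - expi x))%R.
    by field; lra.
  exact: H.
have -> : u - u = 0 by ring.
by rewrite Cmod_0.
Qed.

(* mean |f|^2 = mean (f * conj (f - P)) for every Laurent polynomial P. *)
Lemma fourier_zero f u w0 w : inH A B f -> B u -> circ A w0 -> circ A w ->
  (forall a b : nat, mean (fun z => f z u * (z ^ a * (/ z) ^ b)) w0 = 0) ->
  f w u = 0.
Proof.
move=> Hf Bu cw0 cw coef.
(* The circle is started one radian before [w]: then [w] is reached at angle 1, an interior point of
   (0, 2 PI) as [continuous_int_zero] asks. *)
pose v := w * expi (- 1).
have vw : Cmod v = Cmod w by rewrite /v Cmod_mult Cmod_expi Rmult_1_r.
have cv : circ A v by move=> z; rewrite vw; apply: cw.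
have v0 := circ_neq0 _ tA _ cv.
have Hc P : lpoly P -> is_mean (fun z => f z u * P z u) v 0.
  elim=> {P} [c a b m n|P Q _ HP _ HQ]; last first.
    rewrite -(Cplus_0_r 0); apply: is_mean_ext (is_mean_add _ _ _ _ _ HP HQ) => z _; ring.
  have HH : inH A B (fun z u => f z u * (z ^ a * (/ z) ^ b)).
    apply: inH_mul => //; apply: inH_mul => //; apply: inH_pow => //.
      exact: inH_z.
    exact: inH_zinv.
  have := is_mean_scal _ _ _ (c * (u ^ m * (/ u) ^ n)) (inH_is_mean _ _ tA _ _ _ HH Bu cv).
  rewrite (mean_indep _ _ tA _ _ _ _ HH Bu cv cw0) coef Cmult_0_r.
  by apply: is_mean_ext => z _; rewrite /lmono; ring.
(* On the circle conj(z) = |v|^2 / z, so conj(P) is again a Laurent polynomial there and is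
   orthogonal to [f] by [Hc]. *)
have Hconj P : lpoly P -> exists2 Q, lpoly Q &
    forall z, Cmod z = Cmod v -> Q z u = Cconj (P z u).
  elim=> {P} [c a b m n|P1 P2 _ [Q1 H1 E1] _ [Q2 H2 E2]]; last first.
    exists (fun z u => Q1 z u + Q2 z u); first exact: lpoly_add.
    by move=> z zv; rewrite Cplus_conj E1 // E2.
  pose r2 : C := RtoC (Cmod v ^ 2)%R.
  exists (fun z u' => (Cconj (c * (u ^ m * (/ u) ^ n)) * r2 ^ a * (/ r2) ^ b) * lmono b a 0 0 z u').
    exact: lpoly_mono.
  move=> z zv.
  have z0 : z <> 0 by apply: Cmod_neq0; rewrite zv; apply/Cmod_gt_0.
  have zc : Cconj z = r2 * / z.
    have E : r2 = z * Cconj z by rewrite /r2 -zv Cmod2_conj.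
    by rewrite E; field.
  have -> : c * lmono a b m n z u = c * (u ^ m * (/ u) ^ n) * (z ^ a * (/ z) ^ b).
    by rewrite /lmono; ring.
  move: (c * _) => k.
  by rewrite /lmono !Cmult_conj !Cpow_conj Cinv_conj // zc CinvM CinvK !Cpow_mult_l /=; ring.
have aux eps : (0 < eps)%R -> exists g, is_mean g v 0 /\
     forall z : C, Cmod z = Cmod v -> (Cmod (f z u * Cconj (f z u) - g z) <= eps)%R.
  move=> e0; have [M M0 HM] := inH_bounded _ _ tA tB _ Hf.
  have e1 : (0 < eps / (M + 1))%R by apply: Rdiv_lt_0_compat; lra.
  have [P [HP PE]] := Hf _ e1.
  have [Q HQ QE] := Hconj _ HP.
  exists (fun z => f z u * Q z u); split; first exact: Hc.
  move=> z zv; have Az := cv _ zv; rewrite QE //.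
  have -> : f z u * Cconj (f z u) - f z u * Cconj (P z u) =
    f z u * Cconj (f z u - P z u) by rewrite Cminus_conj; ring.
  rewrite Cmod_mult Cmod_conj.
  have := PE z u Az Bu; have := HM z u Az Bu => H1 H2.
  apply: Rle_trans (Rmult_le_compat _ _ _ _ (Cmod_ge_0 _) (Cmod_ge_0 _) H1 H2) _.
  have -> : (M * (eps / (M + 1)) = eps * (M / (M + 1)))%R by field; lra.
  have : (M / (M + 1) <= 1)%R.
    by apply: (Rmult_le_reg_r (M + 1)%R); [lra|rewrite /Rdiv Rmult_assoc Rinv_l; lra].
  nra.
have Mn : is_mean (fun z => f z u * Cconj (f z u)) v 0.
  have H := is_mean_lim (fun z => f z u * Cconj (f z u)) v
    (fun eps e0 => let: ex_intro g Hg := aux eps e0 in ex_intro _ g (ex_intro _ (RtoC 0) Hg)).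
  have <- // : mean (fun z => f z u * Cconj (f z u)) v = 0.
  apply: Cmod_le_eps0 => eps /aux [g [H1 H2]].
  have := is_mean_close _ _ _ _ _ _ H H1 H2.
  by have -> : forall x : C, x - 0 = x by move=> x; ring.
pose h th := (Cmod (f (v * expi th)%C u) ^ 2)%R.
have hi : is_RInt h 0 (2 * PI) 0.
  have := @is_RInt_fct_extend_fst R_NormedModule R_NormedModule _ _ _ _ Mn.
  rewrite Cmult_0_r; apply: is_RInt_ext => x _.
  by rewrite -(Cmod2_conj (f (v * expi x) u)).
have hcont y : continuous h y.
  have C1 : continuous (fun th => Cmod (f (v * expi th)%C u)) y.
    apply/filterlim_locally => eps.
    apply: filter_imp (inH_circle_cont _ _ _ y Hf Bu cv _ (cond_pos eps)) => x.
    rewrite /ball /= /AbsRing_ball /= /abs /minus /plus /opp /=.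
    apply: Rle_lt_trans.
    have := Cmod_triangle (f (v * expi x)%C u - f (v * expi y)%C u) (f (v * expi y)%C u).
    have := Cmod_triangle (f (v * expi y)%C u - f (v * expi x)%C u) (f (v * expi x)%C u).
    rewrite (Cmod_sub_sym (f (v * expi y)%C u)).
    have -> : forall a b : C, a - b + b = a by move=> a b; ring.
    have -> : forall a b : C, a - b + b = a by move=> a b; ring.
    by move=> H1 H2; apply: Rabs_le; lra.
  apply: (continuous_ext (fun th => Cmod (f (v * expi th)%C u) * Cmod (f (v * expi th)%C u))%R).
    by move=> x; rewrite /h /=; ring.
  exact: (@continuous_mult _ R_AbsRing).
have h1 : h 1%R = 0%R.
  apply: (continuous_int_zero h (2 * PI)) => //.
    by move=> y; apply: pow2_ge_0.
  have := PI2_1; lra.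
have : Cmod (f (v * expi 1)%C u) = 0%R.
  by rewrite /h in h1; apply: Rsqr_0_uniq; rewrite /Rsqr; lra.
move/Cmod_eq_0; rewrite /v -Cmult_assoc -expiD Rplus_opp_l expi0 Cmult_1_r.
by [].
Qed.

Lemma fourier_const f u w0 w : inH A B f -> B u -> circ A w0 -> circ A w ->
  (forall a b : nat, a <> b -> mean (fun z => f z u * (z ^ a * (/ z) ^ b)) w0 = 0) ->
  f w u = mean (fun z => f z u) w0.
Proof.
move=> Hf Bu cw0 cw coef; set c := mean _ _.
have w00 := circ_neq0 _ tA _ cw0.
have Hg : inH A B (fun z u => f z u - c) by apply: inH_sub => //; exact: inH_const.
suff : f w u - c = 0 by move=> H; rewrite -[RHS]Cplus_0_r -H; ring.
apply: (fourier_zero _ _ _ _ Hg Bu cw0 cw) => a b.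
have HH : inH A B (fun z u => f z u * (z ^ a * (/ z) ^ b)).
  apply: inH_mul => //; apply: inH_mul => //; apply: inH_pow => //.
    exact: inH_z.
  exact: inH_zinv.
have M1 := inH_is_mean _ _ tA _ _ _ HH Bu cw0.
have M2 := is_mean_scal _ _ _ c (is_mean_zpow w0 a b w00).
have M3 := is_mean_sub _ _ _ _ _ M1 M2.
have E : mean (fun z => (f z u - c) * (z ^ a * (/ z) ^ b)) w0 =
  mean (fun z => f z u * (z ^ a * (/ z) ^ b)) w0 - c * (if a == b then 1 else 0).
  by apply: is_mean_mean; apply: is_mean_ext M3 => z _; ring.
rewrite E; have [ab|/eqP ab] := eqVneq a b; last by rewrite coef //; ring.
subst b.
have -> : mean (fun z => f z u * (z ^ a * (/ z) ^ a)) w0 = c.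
  apply: is_mean_mean; apply: is_mean_ext (inH_is_mean _ _ tA _ _ _ Hf Bu cw0) => z zw.
  by rewrite Cpow_mul_inv ?Cmult_1_r //; apply: Cmod_neq0; rewrite zw; apply/Cmod_gt_0.
ring.
Qed.

(** The identity theorem: the Laurent coefficients are the same on every circle of [A], and on the
    circle of [w0] all but the constant one vanish. *)
Lemma identity_const f u w0 w c : inH A B f -> B u -> circ A w0 -> circ A w ->
  (forall z, Cmod z = Cmod w0 -> f z u = c) -> f w u = c.
Proof.
move=> Hf Bu cw0 cw H.
have w00 := circ_neq0 _ tA _ cw0.
rewrite (fourier_const _ _ w0 _ Hf Bu cw0 cw).
  apply: is_mean_mean; apply: is_mean_ext (is_mean_const c w0) => z zw; by rewrite H.
move=> a b /eqP ab; apply: is_mean_mean.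
have := is_mean_scal _ _ _ c (is_mean_zpow w0 a b w00).
rewrite (negbTE ab) Cmult_0_r; apply: is_mean_ext => z zw; by rewrite H.
Qed.

(* f(qz) = f(z) forces c_k q^k = c_k for the Laurent coefficients. *)
Lemma qperiodic_const f u (q w0 w : C) : inH A B f -> B u ->
  (0 < Cmod q < 1)%R -> circ A w0 -> circ A (q * w0) -> circ A w ->
  (forall z, Cmod z = Cmod w0 -> f (q * z) u = f z u) ->
  f w u = mean (fun z => f z u) w0.
Proof.
move=> Hf Bu [q0 q1] cw0 cqw cw H.
have qn : q <> 0 by apply: Cmod_neq0.
apply: fourier_const => // a b ab.
have HH : inH A B (fun z u => f z u * (z ^ a * (/ z) ^ b)).
  apply: inH_mul => //; apply: inH_mul => //; apply: inH_pow => //.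
    exact: inH_z.
  exact: inH_zinv.
set m := mean _ _.
have M1 := inH_is_mean _ _ tA _ _ _ HH Bu cw0.
have M2 := inH_is_mean _ _ tA _ _ _ HH Bu cqw.
rewrite (mean_indep _ _ tA _ _ _ _ HH Bu cqw cw0) -/m in M2.
have M3 := is_mean_scal _ _ _ (q ^ a * (/ q) ^ b) M1.
have pt z : Cmod z = Cmod w0 -> f (q * z) u * ((q * z) ^ a * (/ (q * z)) ^ b) =
    q ^ a * (/ q) ^ b * (f z u * (z ^ a * (/ z) ^ b)).
  by move=> zw; rewrite H // !Cpow_mult_l CinvM !Cpow_mult_l; ring.
have E : m = q ^ a * (/ q) ^ b * m.
  apply: (is_mean_unique _ _ _ _ _ M3); move: M2; rewrite /is_mean.
  apply: is_RInt_ext => th _.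
  by rewrite -Cmult_assoc pt // Cmod_mult Cmod_expi Rmult_1_r.
have [//|m0] := Ceq_dec m 0.
have E1 : Cmod (q ^ a * (/ q) ^ b) = 1%R.
  have := congr1 Cmod E; rewrite Cmod_mult => E2.
  have := proj1 (Cmod_gt_0 m) m0 => m1.
  apply: (Rmult_eq_reg_r (Cmod m)); lra.
exfalso; move: E1.
rewrite Cmod_mult Cpow_inv' Cmod_inv' !Cmod_pow.
have pw n : (0 < n)%N -> (0 < Cmod q ^ n < 1)%R.
  move=> n0; split; first exact: pow_lt.
  by have [] := pow_lt_1_compat (Cmod q) n (ltac:(lra)) (elimT ltP n0); lra.
have [le|le] := leqP a b.
  have lt : (a < b)%N by rewrite ltn_neqAle le andbT; apply/eqP.
  rewrite -(subnK le) addnC pow_add Rinv_mult -Rmult_assoc Rinv_r.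
    have := pw (b - a)%N; rewrite subn_gt0 => /(_ lt) [H1 H2].
    by have := Rinv_lt_contravar _ _ (ltac:(lra) : (0 < Cmod q ^ (b - a) * 1)%R) H2; lra.
  by have := pow_lt _ a q0; lra.
have le' := ltnW le.
rewrite -(subnK le') pow_add Rmult_assoc Rinv_r.
  by have := pw (a - b)%N; rewrite subn_gt0 => /(_ le) [H1 H2]; lra.
by have := pow_lt _ b q0; lra.
Qed.

End Fourier.

(** * Infinite products *)

Lemma filterlim_Cmul (T : Type) (F : (T -> Prop) -> Prop) {FF : Filter F}
    (f g : T -> C) (l m : C) :
  filterlim f F (@locally C_UniformSpace l) ->
  filterlim g F (@locally C_UniformSpace m) ->
  filterlim (fun x => f x * g x) F (@locally C_UniformSpace (l * m)).
Proof.
rewrite !filterlim_Cmod => Hf Hg eps e0.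
pose M := (1 + Cmod l + Cmod m)%R.
have l0 := Cmod_ge_0 l; have m0 := Cmod_ge_0 m.
have e1 : (0 < Rmin 1 (eps / (2 * M)))%R.
  by apply: Rmin_glb_lt; [lra|apply: Rdiv_lt_0_compat; rewrite /M; lra].
apply: filter_imp (filter_and _ _ (Hf _ e1) (Hg _ e1)) => x [H1 H2].
have -> : f x * g x - l * m = (f x - l) * (g x - m) + (l * (g x - m) + (f x - l) * m) by ring.
apply: Rle_lt_trans (Cmod_triangle _ _) _.
apply: Rle_lt_trans (Rplus_le_compat_l _ _ _ (Cmod_triangle _ _)) _.
rewrite !Cmod_mult.
have d1 := Cmod_ge_0 (f x - l); have d2 := Cmod_ge_0 (g x - m).
have a1 := Rmin_l 1 (eps / (2 * M)); have a2 := Rmin_r 1 (eps / (2 * M)).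
move: (Rmin 1 _) a1 a2 H1 H2 e1 => e a1 a2 H1 H2 e1.
have : (Cmod (f x - l) * Cmod (g x - m) <= e * 1)%R by apply: Rmult_le_compat; lra.
have : (Cmod l * Cmod (g x - m) <= Cmod l * e)%R by apply: Rmult_le_compat_l; lra.
have : (Cmod (f x - l) * Cmod m <= e * Cmod m)%R by apply: Rmult_le_compat_r; lra.
have : (M * e <= eps / 2)%R.
  have -> : (eps / 2 = M * (eps / (2 * M)))%R by field; rewrite /M; lra.
  by apply: Rmult_le_compat_l => //; rewrite /M; lra.
rewrite /M; lra.
Qed.

Lemma filterlim_Cinv (T : Type) (F : (T -> Prop) -> Prop) {FF : Filter F}
    (f : T -> C) (l : C) : l <> 0 ->
  filterlim f F (@locally C_UniformSpace l) ->
  filterlim (fun x => / f x) F (@locally C_UniformSpace (/ l)).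
Proof.
move=> /Cmod_gt_0 l0; rewrite !filterlim_Cmod => Hf eps e0.
have e1 : (0 < Rmin (Cmod l / 2) (eps * Cmod l * Cmod l / 2))%R.
  by apply: Rmin_glb_lt; [lra|have : (0 < eps * Cmod l * Cmod l)%R by do 2 apply: Rmult_lt_0_compat => //]; lra.
apply: filter_imp (Hf _ e1) => x H.
have a1 := Rmin_l (Cmod l / 2) (eps * Cmod l * Cmod l / 2).
have a2 := Rmin_r (Cmod l / 2) (eps * Cmod l * Cmod l / 2).
have H1 : (Cmod l / 2 < Cmod (f x))%R.
  have := Cmod_triangle (f x) (l - f x).
  have -> : f x + (l - f x) = l by ring.
  rewrite (Cmod_sub_sym l); lra.
rewrite Cmod_inv_sub; [|by apply: Cmod_neq0; lra..].
rewrite !Cmod_inv'.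
have H2 : (/ Cmod (f x) < 2 * / Cmod l)%R.
  have -> : (2 * / Cmod l = / (Cmod l / 2))%R by field; lra.
  apply: Rinv_lt_contravar => //; apply: Rmult_lt_0_compat; lra.
have il : (0 < / Cmod l)%R by apply: Rinv_0_lt_compat.
have ifx : (0 < / Cmod (f x))%R by apply: Rinv_0_lt_compat; lra.
apply: (Rle_lt_trans _ (2 * / Cmod l * / Cmod l * Cmod (f x - l))%R).
  apply: Rmult_le_compat_r; first exact: Cmod_ge_0.
  by apply: Rmult_le_compat_r; lra.
apply: (Rlt_le_trans _ (2 * / Cmod l * / Cmod l * (eps * Cmod l * Cmod l / 2))%R).
  apply: Rmult_lt_compat_l; last lra.
  by do 2 (apply: Rmult_lt_0_compat => //); lra.
by right; field; lra.
Qed.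

Lemma filterlim_C_unique (T : Type) (F : (T -> Prop) -> Prop) {FF : ProperFilter F}
    (f : T -> C) (l m : C) :
  filterlim f F (@locally C_UniformSpace l) ->
  filterlim f F (@locally C_UniformSpace m) -> l = m.
Proof. by move=> /Clim_unique <- /Clim_unique <-. Qed.

(** The factor [g] is a parameter because both 1 - y and its inverse are needed: convergence and
    approximation are then proved once for the two products. *)
Definition rect_prod (g : C -> C) (p q x : C) (M N : nat) : C :=
  \Cprod_(j < M) \Cprod_(k < N) g (x * p ^ j * q ^ k).

Definition dprod (g : C -> C) (p q x : C) : C :=
  Clim (filter_prod eventually eventually) (fun MN : nat * nat => rect_prod g p q x MN.1 MN.2).

Lemma rect_prod_addM g p q x M m N :
  rect_prod g p q x (M + m) N = rect_prod g p q x M N * rect_prod g p q (x * p ^ M) m N.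
Proof.
rewrite /rect_prod big_split_ord; congr Cmult.
apply: eq_bigr => j _; apply: eq_bigr => k _; congr g.
by rewrite /= Cpow_add_r; ring.
Qed.

Lemma rect_prod_swap g p q x M N : rect_prod g p q x M N = rect_prod g q p x N M.
Proof.
rewrite /rect_prod exchange_big; apply: eq_bigr => j _; apply: eq_bigr => k _; congr g; ring.
Qed.

Lemma exp_le (x y : R) : (x <= y)%R -> (exp x <= exp y)%R.
Proof. by case=> [/exp_increasing|->]; lra. Qed.

(** 1 + |a - 1| is submultiplicative, so deviations of the form exp s - 1 combine by adding the
    exponents. *)
Lemma near1_mul (a b : C) (s t : R) :
  (Cmod (a - 1) <= exp s - 1)%R -> (Cmod (b - 1) <= exp t - 1)%R ->
  (Cmod (a * b - 1) <= exp (s + t) - 1)%R.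
Proof.
move=> Ha Hb; have -> : a * b - 1 = (a - 1) * (b - 1) + ((a - 1) + (b - 1)) by ring.
apply: Rle_trans (Cmod_triangle _ _) _.
apply: Rle_trans (Rplus_le_compat_l _ _ _ (Cmod_triangle _ _)) _.
rewrite Cmod_mult exp_plus.
have a0 := Cmod_ge_0 (a - 1); have b0 := Cmod_ge_0 (b - 1).
have := Rmult_le_compat _ _ _ _ a0 b0 Ha Hb; lra.
Qed.

Lemma geom_sum_bound (r : R) (n : nat) : (0 <= r < 1)%R ->
  ((1 - r ^ n) / (1 - r) + r ^ n = (1 - r ^ n.+1) / (1 - r))%R.
Proof. by move=> r1; rewrite /=; field; lra. Qed.

Lemma geom_sum_le (r : R) (n : nat) : (0 <= r < 1)%R ->
  (0 <= (1 - r ^ n) / (1 - r) <= / (1 - r))%R.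
Proof.
move=> r1.
have H : (0 <= r ^ n <= 1)%R.
  split; first by apply: pow_le; lra.
  by rewrite -(pow1 n); apply: pow_incr; lra.
have i0 : (0 < / (1 - r))%R by apply: Rinv_0_lt_compat; lra.
rewrite /Rdiv; nra.
Qed.

Section Product.
Variables (g : C -> C) (K R0 : R) (p q : C).
Hypotheses (K0 : (0 <= K)%R) (gK : forall y, (Cmod y <= R0)%R -> (Cmod (g y - 1) <= K * Cmod y)%R).
Hypotheses (hp : (Cmod p < 1)%R) (hq : (Cmod q < 1)%R).

Lemma Cmod_mul_pow_le (x c : C) n : (Cmod c < 1)%R -> (Cmod (x * c ^ n) <= Cmod x)%R.
Proof.
move=> c1; rewrite Cmod_mult Cmod_pow -[X in (_ <= X)%R]Rmult_1_r.
apply: Rmult_le_compat_l; first exact: Cmod_ge_0.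
by rewrite -(pow1 n); apply: pow_incr; split; [exact: Cmod_ge_0|lra].
Qed.

Lemma row_near1 x N : (Cmod x <= R0)%R ->
  (Cmod (\Cprod_(k < N) g (x * q ^ k) - 1) <= exp (K * Cmod x * / (1 - Cmod q)) - 1)%R.
Proof.
move=> xR.
have q01 : (0 <= Cmod q < 1)%R by split; [exact: Cmod_ge_0|].
(* The induction keeps the partial geometric sum, which grows by exactly the exponent of the new
   factor; it is replaced by the full sum at the end. *)
have H : (Cmod (\Cprod_(k < N) g (x * q ^ k) - 1) <=
   exp (K * Cmod x * ((1 - Cmod q ^ N) / (1 - Cmod q))) - 1)%R.
  elim: N => [|N IH].
    rewrite big_ord0 /=; have -> : 1 - 1 = RtoC 0 by ring.
    rewrite Cmod_0 Rminus_diag /Rdiv !Rmult_0_l Rmult_0_r exp_0; lra.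
  rewrite big_ord_recr /= -/(pow (Cmod q) N.+1) -geom_sum_bound // Rmult_plus_distr_l.
  apply: near1_mul => //.
  apply: Rle_trans (gK _ _) _; first exact: Rle_trans (Cmod_mul_pow_le _ _ _ hq) xR.
  rewrite Cmod_mult Cmod_pow -Rmult_assoc.
  by have := exp_ineq1_le (K * Cmod x * Cmod q ^ N); lra.
apply: Rle_trans H _.
have := geom_sum_le _ N q01 => -[_ H].
have kx : (0 <= K * Cmod x)%R by apply: Rmult_le_pos => //; exact: Cmod_ge_0.
have := Rmult_le_compat_l _ _ _ kx H => /exp_le; lra.
Qed.

Definition geom_cst : R := (/ (1 - Cmod q) * / (1 - Cmod p))%R.

Lemma geom_cst_ge0 : (0 <= geom_cst)%R.
Proof. by apply: Rmult_le_pos; apply/Rlt_le/Rinv_0_lt_compat; lra. Qed.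

Lemma rect_prod_near1 x M N : (Cmod x <= R0)%R ->
  (Cmod (rect_prod g p q x M N - 1) <= exp (K * Cmod x * geom_cst) - 1)%R.
Proof.
move=> xR.
have p01 : (0 <= Cmod p < 1)%R by split; [exact: Cmod_ge_0|].
have iq : (0 < / (1 - Cmod q))%R by apply: Rinv_0_lt_compat; lra.
have kx : (0 <= K * Cmod x * / (1 - Cmod q))%R.
  by apply: Rmult_le_pos; [apply: Rmult_le_pos => //; exact: Cmod_ge_0|lra].
have H : (Cmod (rect_prod g p q x M N - 1) <=
   exp (K * Cmod x * / (1 - Cmod q) * ((1 - Cmod p ^ M) / (1 - Cmod p))) - 1)%R.
  elim: M => [|M IH].
    rewrite /rect_prod big_ord0 /=; have -> : 1 - 1 = RtoC 0 by ring.
    rewrite Cmod_0 Rminus_diag /Rdiv Rmult_0_l Rmult_0_r exp_0; lra.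
  rewrite /rect_prod big_ord_recr /= -/(pow (Cmod p) M.+1) -geom_sum_bound // Rmult_plus_distr_l.
  apply: near1_mul => //.
  have -> : (K * Cmod x * / (1 - Cmod q) * Cmod p ^ M = K * Cmod (x * p ^ M) * / (1 - Cmod q))%R.
    by rewrite Cmod_mult Cmod_pow; ring.
  apply: row_near1; exact: Rle_trans (Cmod_mul_pow_le _ _ _ hp) xR.
apply: Rle_trans H _.
have := geom_sum_le _ M p01 => -[_ H].
have := Rmult_le_compat_l _ _ _ kx H => /exp_le.
by rewrite /geom_cst -Rmult_assoc; lra.
Qed.

(** With a = K r [geom_cst], exp a bounds every partial product, and a exp a times |p|^M bounds the
    deviation of the tail from 1 by [exp_scaled]. *)
Definition prod_cst (r : R) : R := (exp (K * r * geom_cst) * (K * r * geom_cst * exp (K * r * geom_cst)))%R.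

Lemma prod_cst_mono r s : (0 <= r <= s)%R -> (0 <= prod_cst r <= prod_cst s)%R.
Proof.
move=> rs; have S0 := geom_cst_ge0.
have H : (0 <= K * r * geom_cst <= K * s * geom_cst)%R.
  split; first by apply: Rmult_le_pos => //; apply: Rmult_le_pos; lra.
  by apply: Rmult_le_compat_r => //; apply: Rmult_le_compat_l; lra.
have E := exp_le _ _ (proj2 H); have e0 := exp_pos (K * r * geom_cst).
rewrite /prod_cst; move: (K * r * geom_cst)%R (K * s * geom_cst)%R (exp (K * r * geom_cst)) (exp (K * s * geom_cst)) E e0 H => a b c d *; split.
  by repeat apply: Rmult_le_pos; lra.
by repeat (apply: Rmult_le_compat; try lra; try by repeat apply: Rmult_le_pos; lra).
Qed.

Lemma rect_prod_bound x M N : (Cmod x <= R0)%R ->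
  (Cmod (rect_prod g p q x M N) <= exp (K * Cmod x * geom_cst))%R.
Proof.
move=> xR; have := rect_prod_near1 x M N xR.
have := Cmod_triangle (rect_prod g p q x M N - 1) 1.
have -> : rect_prod g p q x M N - 1 + 1 = rect_prod g p q x M N by ring.
rewrite Cmod_1; lra.
Qed.

(** exp(-y) >= 1 - y gives exp y - 1 <= y exp y; take y = a t. The linear factor [t] becomes the
    geometric rate |p|^M. *)
Lemma exp_scaled (a t : R) : (0 <= a)%R -> (0 <= t <= 1)%R ->
  (exp (a * t) - 1 <= t * (a * exp a))%R.
Proof.
move=> a0 t01.
have H1 := exp_ineq1_le (- (a * t)); rewrite exp_Ropp in H1.
have e0 := exp_pos (a * t).
have H2 : (exp (a * t) * (1 + - (a * t)) <= 1)%R.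
  by have := Rmult_le_compat_l _ _ _ (Rlt_le _ _ e0) H1; rewrite Rinv_r; lra.
have H3 : (exp (a * t) <= exp a)%R by apply: exp_le; nra.
have at0 : (0 <= a * t)%R by nra.
have := Rmult_le_compat_l _ _ _ at0 H3; lra.
Qed.

Lemma rect_prod_stepM x M m N : (Cmod x <= R0)%R ->
  (Cmod (rect_prod g p q x (M + m) N - rect_prod g p q x M N) <= prod_cst (Cmod x) * Cmod p ^ M)%R.
Proof.
move=> xR; rewrite rect_prod_addM.
have -> : forall a b : C, a * b - a = a * (b - 1) by move=> a b; ring.
rewrite Cmod_mult /prod_cst Rmult_assoc; apply: Rmult_le_compat; try exact: Cmod_ge_0.
  exact: rect_prod_bound.
have H := Cmod_mul_pow_le x p M hp.
apply: Rle_trans (rect_prod_near1 _ _ _ (Rle_trans _ _ _ H xR)) _.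
rewrite Cmod_mult Cmod_pow.
have -> : (K * (Cmod x * Cmod p ^ M) * geom_cst = (K * Cmod x * geom_cst) * Cmod p ^ M)%R by ring.
rewrite [X in (_ <= X)%R]Rmult_comm; apply: exp_scaled.
  by apply: Rmult_le_pos; [apply: Rmult_le_pos => //; exact: Cmod_ge_0|exact: geom_cst_ge0].
split; first by apply: pow_le; exact: Cmod_ge_0.
by rewrite -(pow1 M); apply: pow_incr; split; [exact: Cmod_ge_0|lra].
Qed.

End Product.

Section Product2.
Variables (g : C -> C) (K R0 : R) (p q : C).
Hypotheses (K0 : (0 <= K)%R) (gK : forall y, (Cmod y <= R0)%R -> (Cmod (g y - 1) <= K * Cmod y)%R).
Hypotheses (hp : (Cmod p < 1)%R) (hq : (Cmod q < 1)%R).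

Lemma rect_prod_stepN x M N n : (Cmod x <= R0)%R ->
  (Cmod (rect_prod g p q x M (N + n) - rect_prod g p q x M N) <= prod_cst K p q (Cmod x) * Cmod q ^ N)%R.
Proof.
move=> xR; rewrite !(rect_prod_swap _ p q).
have -> : prod_cst K p q (Cmod x) = prod_cst K q p (Cmod x).
  by rewrite /prod_cst /geom_cst (Rmult_comm (/ (1 - Cmod q))).
by apply: rect_prod_stepM xR.
Qed.

Lemma rect_prod_step x M N M' N' : (Cmod x <= R0)%R -> (M <= M')%N -> (N <= N')%N ->
  (Cmod (rect_prod g p q x M' N' - rect_prod g p q x M N) <= prod_cst K p q (Cmod x) * (Cmod p ^ M + Cmod q ^ N))%R.
Proof.
move=> xR /subnKC <- /subnKC <-.
have H1 := rect_prod_stepM _ _ _ _ _ K0 gK hp hq x M (M' - M) (N + (N' - N)) xR.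
have H2 := rect_prod_stepN x M N (N' - N) xR.
have := Cmod_triangle (rect_prod g p q x (M + (M' - M)) (N + (N' - N)) - rect_prod g p q x M (N + (N' - N)))
  (rect_prod g p q x M (N + (N' - N)) - rect_prod g p q x M N).
have -> : forall a b c : C, a - b + (b - c) = a - c by move=> a b c; ring.
lra.
Qed.

Lemma pow_ev (r eps : R) : (0 <= r < 1)%R -> (0 < eps)%R ->
  exists N, forall n, (N <= n)%coq_nat -> (r ^ n < eps)%R.
Proof.
move=> r1 e0; have [N HN] := pow_lt_1_zero r (ltac:(rewrite Rabs_pos_eq; lra)) _ e0.
by exists N => n /HN; rewrite Rabs_pos_eq //; apply: pow_le; lra.
Qed.

Lemma dprod_lim x : (Cmod x <= R0)%R ->
  filterlim (fun MN : nat * nat => rect_prod g p q x MN.1 MN.2) (filter_prod eventually eventually)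
    (@locally C_UniformSpace (dprod g p q x)).
Proof.
move=> xR.
suff [y Hy] : exists y, filterlim (fun MN : nat * nat => rect_prod g p q x MN.1 MN.2)
    (filter_prod eventually eventually) (@locally C_UniformSpace y).
  by rewrite /dprod (Clim_unique _ _ _ _ Hy).
apply/(@filterlim_locally_cauchy _ C_R_CompleteNormedModule) => eps.
pose c := prod_cst K p q (Cmod x).
have c0 : (0 <= c)%R.
  by have [] := prod_cst_mono _ _ _ K0 hp hq (Cmod x) (Cmod x) (conj (Cmod_ge_0 _) (Rle_refl _)).
have e1 : (0 < eps / (4 * (c + 1)))%R.
  by apply: Rdiv_lt_0_compat; [exact: cond_pos|lra].
have [M0 HM] := pow_ev (Cmod p) _ (conj (Cmod_ge_0 _) hp) e1.
have [N0 HN] := pow_ev (Cmod q) _ (conj (Cmod_ge_0 _) hq) e1.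
exists (fun MN : nat * nat => (M0 <= MN.1)%coq_nat /\ (N0 <= MN.2)%coq_nat); split.
  by apply: (Filter_prod _ _ _ (fun M => (M0 <= M)%coq_nat) (fun N => (N0 <= N)%coq_nat));
    [exists M0|exists N0|].
have key MN : (M0 <= MN.1)%coq_nat /\ (N0 <= MN.2)%coq_nat ->
    (Cmod (rect_prod g p q x MN.1 MN.2 - rect_prod g p q x M0 N0) < eps / 2)%R.
  move=> [/leP h1 /leP h2]; apply: Rle_lt_trans (rect_prod_step _ _ _ _ _ xR h1 h2) _.
  have H1 := HM M0 (Nat.le_refl _); have H2 := HN N0 (Nat.le_refl _).
  have E : ((c + 1) * (eps / (4 * (c + 1)) + eps / (4 * (c + 1))) = eps / 2)%R by field; lra.
  rewrite -E -/c.
  have H3 : (0 <= Cmod p ^ M0)%R by apply: pow_le; exact: Cmod_ge_0.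
  have H4 : (0 <= Cmod q ^ N0)%R by apply: pow_le; exact: Cmod_ge_0.
  by nra.
move=> u v /key Hu /key Hv; apply: C_NormedModule_mixin_compat1.
rewrite /minus /plus /opp /= -/(Cminus _ _).
have -> : rect_prod g p q x v.1 v.2 - rect_prod g p q x u.1 u.2 =
  (rect_prod g p q x v.1 v.2 - rect_prod g p q x M0 N0) + - (rect_prod g p q x u.1 u.2 - rect_prod g p q x M0 N0) by ring.
apply: Rle_lt_trans (Cmod_triangle _ _) _; rewrite Cmod_opp; lra.
Qed.

Lemma dprod_comp (T : Type) (F : (T -> Prop) -> Prop) (FF : Filter F) (m n : T -> nat) x :
  (Cmod x <= R0)%R -> filterlim m F eventually -> filterlim n F eventually ->
  filterlim (fun i => rect_prod g p q x (m i) (n i)) F (@locally C_UniformSpace (dprod g p q x)).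
Proof.
move=> xR Hm Hn.
exact: (filterlim_comp _ _ _ (fun i => (m i, n i)) _ _ _ _ (filterlim_pair _ _ Hm Hn) (dprod_lim x xR)).
Qed.

Lemma dprod_err x M N : (Cmod x <= R0)%R ->
  (Cmod (dprod g p q x - rect_prod g p q x M N) <= prod_cst K p q (Cmod x) * (Cmod p ^ M + Cmod q ^ N))%R.
Proof.
move=> xR; apply: le_epsilon => eps e0.
have /filterlim_Cmod /(_ _ e0) := dprod_lim x xR.
case=> Q1 Q2 [M1 H1] [N1 H2] /(_ (maxn M1 M) (maxn N1 N)) /= H.
have := H (H1 _ (elimT leP (leq_maxl _ _))) (H2 _ (elimT leP (leq_maxl _ _))).
have := rect_prod_step x M N (maxn M1 M) (maxn N1 N) xR (leq_maxr _ _) (leq_maxr _ _).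
set a := rect_prod _ _ _ _ _ _; set b := rect_prod _ _ _ _ _ _; set l := dprod _ _ _ _ => H3 H4.
have := Cmod_triangle (l - a) (a - b).
have -> : l - a + (a - b) = l - b by ring.
rewrite (Cmod_sub_sym l a); lra.
Qed.

(** The error bound [dprod_err] is uniform over |x| <= [R0], so a finite rectangular product
    approximates the infinite one uniformly. *)
Lemma inH_dprod (A B : C -> Prop) (x : C -> C -> C) : tame A -> tame B -> (0 <= R0)%R ->
  (forall y, inH A B y -> (forall z u, A z -> B u -> (Cmod (y z u) <= R0)%R) ->
     inH A B (fun z u => g (y z u))) ->
  inH A B x -> (forall z u, A z -> B u -> (Cmod (x z u) <= R0)%R) ->
  inH A B (fun z u => dprod g p q (x z u)).
Proof.
move=> tA tB R00 Hg Hx xR; apply: inH_ulim => eps e0.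
pose c := prod_cst K p q R0.
have c0 : (0 <= c)%R by have [] := prod_cst_mono _ _ _ K0 hp hq R0 R0 (conj R00 (Rle_refl _)).
have e1 : (0 < eps / (2 * (c + 1)))%R by apply: Rdiv_lt_0_compat; lra.
have [M0 HM] := pow_ev (Cmod p) _ (conj (Cmod_ge_0 _) hp) e1.
have [N0 HN] := pow_ev (Cmod q) _ (conj (Cmod_ge_0 _) hq) e1.
exists (fun z u => rect_prod g p q (x z u) M0 N0).
  apply: (inH_prod _ _ tA tB _ (fun (j : 'I_M0) z u => \Cprod_(k < N0) g (x z u * p ^ j * q ^ k))) => j.
  apply: (inH_prod _ _ tA tB _ (fun (k : 'I_N0) z u => g (x z u * p ^ j * q ^ k))) => k.
  apply: Hg.
    have H := inH_scal _ _ tA tB (p ^ j * q ^ k) _ Hx.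
    by apply: inH_ext H => z u _ _; ring.
  move=> z u Az Bu.
  apply: Rle_trans (Cmod_mul_pow_le _ _ _ hq) _.
  by apply: Rle_trans (Cmod_mul_pow_le _ _ _ hp) _; exact: xR.
move=> z u Az Bu; apply: Rle_trans (dprod_err _ _ _ (xR z u Az Bu)) _.
have [H6 H5] := prod_cst_mono _ _ _ K0 hp hq (Cmod (x z u)) R0 (conj (Cmod_ge_0 _) (xR z u Az Bu)).
rewrite -/c in H5.
have H1 := HM M0 (Nat.le_refl _); have H2 := HN N0 (Nat.le_refl _).
have H3 : (0 <= Cmod p ^ M0)%R by apply: pow_le; exact: Cmod_ge_0.
have H4 : (0 <= Cmod q ^ N0)%R by apply: pow_le; exact: Cmod_ge_0.
apply: (Rle_trans _ ((c + 1) * (eps / (2 * (c + 1)) + eps / (2 * (c + 1))))%R).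
  by apply: Rmult_le_compat; lra.
by right; field; lra.
Qed.

End Product2.

(* For p = 0 this is the single product (x; q)_oo, since 0^0 = 1. *)
Definition dpoch (p q x : C) : C := dprod (fun y => 1 - y) p q x.

Lemma one_sub_near1 (R0 : R) y : (Cmod y <= R0)%R -> (Cmod (1 - y - 1) <= 1 * Cmod y)%R.
Proof. by move=> _; rewrite Rmult_1_l -Cmod_opp; right; congr Cmod; ring. Qed.

Lemma sub1_neq0 (y : C) : (Cmod y < 1)%R -> 1 - y <> 0.
Proof.
move=> y1 H; have E : y = 1 by rewrite -[LHS]Cplus_0_r -H; ring.
by rewrite E Cmod_1 in y1; lra.
Qed.

Lemma inv_one_sub_near1 (R0 : R) y : (R0 < 1)%R -> (Cmod y <= R0)%R ->
  (Cmod (/ (1 - y) - 1) <= / (1 - R0) * Cmod y)%R.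
Proof.
move=> R1 yR.
have y1 : 1 - y <> 0 by apply: sub1_neq0; lra.
have -> : / (1 - y) - 1 = / (1 - y) * y by field.
rewrite Cmod_mult Cmod_inv'; apply: Rmult_le_compat_r; first exact: Cmod_ge_0.
apply: Rinv_le_contravar; first lra.
have := Cmod_triangle (1 - y) y; have -> : 1 - y + y = 1 by ring.
rewrite Cmod_1; lra.
Qed.

Section DpochProps.
Variables p q : C.
Hypotheses (hp : (Cmod p < 1)%R) (hq : (Cmod q < 1)%R).

Lemma dpoch_comp (T : Type) (F : (T -> Prop) -> Prop) (FF : Filter F) (m n : T -> nat) x :
  filterlim m F eventually -> filterlim n F eventually ->
  filterlim (fun i => rect_prod (fun y => 1 - y) p q x (m i) (n i)) F (@locally C_UniformSpace (dpoch p q x)).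
Proof. exact: (dprod_comp _ 1 (Cmod x) _ _ Rle_0_1 (one_sub_near1 _) hp hq _ _ _ _ _ _ (Rle_refl _)). Qed.

Lemma rect_prod_inv x M N :
  rect_prod (fun y => 1 - y) p q x M N * rect_prod (fun y => / (1 - y)) p q x M N =
  \Cprod_(j < M) \Cprod_(k < N) ((1 - x * p ^ j * q ^ k) / (1 - x * p ^ j * q ^ k)).
Proof.
rewrite /rect_prod -big_split; apply: eq_bigr => j _; rewrite -big_split; exact: eq_bigr.
Qed.

(** Having the reciprocal as a convergent product of its own gives both [dpoch_neq0] and the
    regularity of the reciprocal in [inH_inv_dpoch]. *)
Lemma dpoch_inv x : (Cmod x < 1)%R -> dpoch p q x * dprod (fun y => / (1 - y)) p q x = 1.
Proof.
move=> x1.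
have i0 : (0 <= / (1 - Cmod x))%R by apply/Rlt_le/Rinv_0_lt_compat; lra.
have L1 : filterlim (fun MN : nat * nat => rect_prod (fun y => 1 - y) p q x MN.1 MN.2)
    (filter_prod eventually eventually) (@locally C_UniformSpace (dpoch p q x)).
  by apply: dpoch_comp; [exact: filterlim_fst|exact: filterlim_snd].
have L2 := dprod_lim _ _ _ p q i0 (fun y => inv_one_sub_near1 _ y x1) hp hq x (Rle_refl _).
have L3 := filterlim_Cmul _ _ _ _ _ _ L1 L2.
have PF : ProperFilter (filter_prod (@eventually) eventually) by apply: filter_prod_proper.
suff L4 : filterlim (fun MN : nat * nat => rect_prod (fun y => 1 - y) p q x MN.1 MN.2 *
    rect_prod (fun y => / (1 - y)) p q x MN.1 MN.2) (filter_prod eventually eventually)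
    (@locally C_UniformSpace (RtoC 1)) by exact: (filterlim_C_unique _ _ _ _ _ (L3 _) L4).
apply: (filterlim_ext (fun _ => RtoC 1)); last exact: filterlim_const.
move=> [M N]; rewrite rect_prod_inv big1 // => j _; rewrite big1 // => k _.
apply: Cinv_r; apply: sub1_neq0.
apply: Rle_lt_trans (Cmod_mul_pow_le _ _ _ hq) _.
exact: Rle_lt_trans (Cmod_mul_pow_le _ _ _ hp) _.
Qed.

Lemma dpoch_neq0 x : (Cmod x < 1)%R -> dpoch p q x <> 0.
Proof.
move=> /dpoch_inv H E; rewrite E Cmult_0_l in H.
have : Cmod 0 = 1%R by rewrite H Cmod_1.
by rewrite Cmod_0; lra.
Qed.

Lemma inH_dpoch (A B : C -> Prop) x : tame A -> tame B -> inH A B x ->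
  inH A B (fun z u => dpoch p q (x z u)).
Proof.
move=> tA tB Hx; have [M M0 HM] := inH_bounded _ _ tA tB _ Hx.
apply: (inH_dprod _ 1 M _ _ Rle_0_1 (one_sub_near1 _) hp hq) => // y Hy _.
by apply: inH_sub => //; exact: inH_const.
Qed.

Lemma inH_inv_dpoch (A B : C -> Prop) x (R0 : R) : tame A -> tame B -> inH A B x -> (0 <= R0 < 1)%R ->
  (forall z u, A z -> B u -> (Cmod (x z u) <= R0)%R) ->
  inH A B (fun z u => / dpoch p q (x z u)).
Proof.
move=> tA tB Hx R01 xR.
apply: (inH_ext _ _ (fun z u => dprod (fun y => / (1 - y)) p q (x z u))).
  move=> z u Az Bu; have x1 : (Cmod (x z u) < 1)%R by have := xR z u Az Bu; lra.
  have := dpoch_inv _ x1; have := dpoch_neq0 _ x1 => H0 H1.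
  have := congr1 (Cmult (/ dpoch p q (x z u))) H1.
  by rewrite Cmult_assoc Cinv_l // Cmult_1_l Cmult_1_r => ->.
have i0 : (0 <= / (1 - R0))%R by apply/Rlt_le/Rinv_0_lt_compat; lra.
apply: (inH_dprod _ _ R0 _ _ i0 (fun y => inv_one_sub_near1 _ y (proj2 R01)) hp hq) => //; first lra.
by move=> y Hy yR; apply: inH_geom yR => //; lra.
Qed.

End DpochProps.

(** * The elliptic gamma and theta functions *)

Lemma Cmod_lt1_0 : (Cmod 0 < 1)%R.
Proof. rewrite Cmod_0; lra. Qed.

Lemma filterlim_nat_ge (f : nat -> nat) : (forall n, (n <= f n)%N) -> filterlim f eventually eventually.
Proof. by move=> H P [N HN]; exists N => n /leP nN; apply: HN; apply/leP; apply: leq_trans nN (H n). Qed.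

Lemma dpoch_seq p q x (m n : nat -> nat) : (Cmod p < 1)%R -> (Cmod q < 1)%R ->
  (forall i, (i <= m i)%N) -> (forall i, (i <= n i)%N) ->
  filterlim (fun i => rect_prod (fun y => 1 - y) p q x (m i) (n i)) eventually
    (@locally C_UniformSpace (dpoch p q x)).
Proof. by move=> hp hq hm hn; apply: dpoch_comp => //; exact: filterlim_nat_ge. Qed.

Lemma dpoch_swap p q x : (Cmod p < 1)%R -> (Cmod q < 1)%R -> dpoch p q x = dpoch q p x.
Proof.
move=> hp hq.
have L1 := dpoch_seq p q x id id hp hq (fun _ => leqnn _) (fun _ => leqnn _).
have L2 := dpoch_seq q p x id id hq hp (fun _ => leqnn _) (fun _ => leqnn _).
apply: (filterlim_C_unique _ _ _ _ _ L1).
by apply: filterlim_ext L2 => n; rewrite rect_prod_swap.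
Qed.

(** For base 0 every row but the first consists of factors g 0 = 1. *)
Lemma rect_prod_p0 (g : C -> C) q x m n : g 0 = RtoC 1 -> rect_prod g 0 q x m.+1 n = \Cprod_(k < n) g (x * q ^ k).
Proof.
move=> g0; rewrite -(add1n m) rect_prod_addM.
have -> : rect_prod g 0 q (x * 0 ^ 1) m n = 1.
  rewrite /rect_prod big1 // => j _; rewrite big1 // => k _.
  by rewrite -[RHS]g0; congr g; ring.
rewrite Cmult_1_r /rect_prod big_ord_recr big_ord0 /= Cmult_1_l.
by apply: eq_bigr => k _; congr g; ring.
Qed.

Lemma sub10 : 1 - 0 = RtoC 1.
Proof. ring. Qed.

Lemma dpoch0_lim q x : (Cmod q < 1)%R ->
  filterlim (fun n => \Cprod_(k < n) (1 - x * q ^ k)) eventually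
    (@locally C_UniformSpace (dpoch 0 q x)).
Proof.
move=> hq; have L := dpoch_seq 0 q x S id Cmod_lt1_0 hq leqnSn (fun _ => leqnn _).
by apply: filterlim_ext L => n; rewrite (rect_prod_p0 _ _ _ _ _ sub10).
Qed.

Lemma qpochE z q : (Cmod q < 1)%R -> qpoch z q = dpoch 0 q z.
Proof. by move=> hq; apply: Clim_unique; exact: dpoch0_lim. Qed.

Lemma dpoch_rec p q x : (Cmod p < 1)%R -> (Cmod q < 1)%R ->
  dpoch p q x = dpoch 0 q x * dpoch p q (p * x).
Proof.
move=> hp hq.
have L1 := dpoch_seq p q x S id hp hq leqnSn (fun _ => leqnn _).
have L2 := dpoch_seq p q (p * x) id id hp hq (fun _ => leqnn _) (fun _ => leqnn _).
have L3 := filterlim_Cmul _ _ _ _ _ _ (dpoch0_lim q x hq) L2.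
apply: (filterlim_C_unique _ _ _ _ _ L1).
apply: filterlim_ext (L3 _) => n; rewrite -(add1n n) rect_prod_addM; congr Cmult.
  rewrite /rect_prod big_ord_recr big_ord0 /= Cmult_1_l.
  by apply: eq_bigr => k _; congr Cminus; ring.
by congr rect_prod; rewrite /=; ring.
Qed.

Lemma dpoch_rec' p q x : (Cmod p < 1)%R -> (Cmod q < 1)%R ->
  dpoch p q x = dpoch 0 p x * dpoch p q (q * x).
Proof. by move=> hp hq; rewrite !(dpoch_swap p q) //; exact: dpoch_rec. Qed.

(** An instance of [dpoch_rec'] at p = 0, whose first factor is a product with both bases 0 and so
    reduces to 1 - x. *)
Lemma dpoch0_rec q x : (Cmod q < 1)%R -> dpoch 0 q x = (1 - x) * dpoch 0 q (q * x).
Proof.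
move=> hq; rewrite (dpoch_rec' 0 q x Cmod_lt1_0 hq); congr Cmult.
have L := dpoch0_lim 0 x Cmod_lt1_0.
have E : eventually (fun n => \Cprod_(k < n) (1 - x * 0 ^ k) = 1 - x).
  exists 1%N => -[|n] H; first by inversion H.
  rewrite big_ord_recl /= big1 ?Cmult_1_r //.
  by move=> i _; rewrite /bump /=; ring.
apply: (filterlim_C_unique _ _ _ _ _ L).
by apply: filterlim_ext_loc (filterlim_const (1 - x)); apply: filter_imp E => n ->.
Qed.

(** The multiplicative Jacobi theta function, without its factor (p; p)_oo. *)
Definition theta (p z : C) : C := dpoch 0 p z * dpoch 0 p (p / z).

Lemma theta_inv (p z : C) : (Cmod p < 1)%R -> z <> 0 -> theta p (/ z) = - / z * theta p z.
Proof.
move=> hp z0; rewrite /theta (dpoch0_rec p (/ z)) // (dpoch0_rec p z) //.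
have -> : p / / z = p * z by rewrite /Cdiv CinvK.
by rewrite /Cdiv; field.
Qed.

Lemma theta_mulp (p z : C) : (Cmod p < 1)%R -> p <> 0 -> z <> 0 -> theta p (p * z) = - / z * theta p z.
Proof.
move=> hp p0 z0; rewrite -theta_inv // /theta.
have -> : p / (p * z) = / z by field.
have -> : p / / z = p * z by rewrite /Cdiv CinvK.
by rewrite Cmult_comm.
Qed.

Lemma Cmod_div_lt (a b : C) : (Cmod a < Cmod b)%R -> (Cmod (a / b) < 1)%R.
Proof.
move=> H; have a0 := Cmod_ge_0 a.
rewrite Cmod_div; last by apply: Cmod_neq0; lra.
by apply: (Rmult_lt_reg_r (Cmod b)); [lra|rewrite /Rdiv Rmult_assoc Rinv_l; lra].
Qed.

Lemma theta_neq0 p z : (Cmod p < 1)%R -> (Cmod p < Cmod z < 1)%R -> theta p z <> 0.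
Proof.
move=> hp [z1 z2]; apply: Cmult_neq_0; apply: dpoch_neq0 => //; try exact: Cmod_lt1_0.
exact: Cmod_div_lt.
Qed.

Section Gamma.
Variables p q : C.
Hypotheses (hp0 : p <> 0) (hq0 : q <> 0) (hp : (Cmod p < 1)%R) (hq : (Cmod q < 1)%R).

(** The form of [ellGamma] used in the proof: numerator and denominator converge separately and are
    approximated by [inH_dpoch] and [inH_inv_dpoch]. *)
Definition egamma (z : C) : C := dpoch p q (p * q / z) * / dpoch p q z.

Lemma ellGammaE z : dpoch p q z <> 0 -> ellGamma p q z = egamma z.
Proof.
move=> Dz; apply: Clim_unique.
have L x : filterlim (fun MN : nat * nat => rect_prod (fun y => 1 - y) p q x MN.1 MN.2)
    (filter_prod eventually eventually) (@locally C_UniformSpace (dpoch p q x)).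
  by apply: dpoch_comp => //; [exact: filterlim_fst|exact: filterlim_snd].
have L1 := filterlim_Cinv _ _ _ _ Dz (L z).
have FF : Filter (filter_prod (@eventually) eventually) by exact: (@filter_filter _ _ filter_prod_proper).
have L2 : filterlim (fun MN : nat * nat => rect_prod (fun y => 1 - y) p q (p * q / z) MN.1 MN.2 *
    / rect_prod (fun y => 1 - y) p q z MN.1 MN.2) (filter_prod eventually eventually)
    (@locally C_UniformSpace (egamma z)).
  exact: (filterlim_Cmul _ _ _ _ _ _ (L (p * q / z)) (L1 _)).
apply: filterlim_ext L2 => -[M N] /=.
have -> : / rect_prod (fun y => 1 - y) p q z M N = rect_prod (fun y => / (1 - y)) p q z M N.
  have inv1 : / RtoC 1 = 1 by field.
  rewrite /rect_prod (big_morph Cinv CinvM inv1); apply: eq_bigr => j _.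
  exact: (big_morph Cinv CinvM inv1).
rewrite /rect_prod -big_split; apply: eq_bigr => j _; rewrite -big_split; apply: eq_bigr => k _ /=.
by rewrite /Cdiv; congr Cmult; congr Cminus; ring.
Qed.

Lemma Cmod_mul_lt1 (a b : C) : (Cmod a < 1)%R -> (Cmod b < 1)%R -> (Cmod (a * b) < 1)%R.
Proof.
move=> a1 b1; rewrite Cmod_mult.
have := Cmod_ge_0 a; have := Cmod_ge_0 b; nra.
Qed.

Lemma egamma_mulq (z : C) : z <> 0 -> (Cmod z < 1)%R -> egamma (q * z) = theta p z * egamma z.
Proof.
move=> z0 z1; rewrite /egamma /theta.
have -> : p * q / (q * z) = p / z by field.
rewrite (dpoch_rec' p q (p / z)) // (dpoch_rec' p q z) //.
have -> : q * (p / z) = p * q / z by field.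
have := dpoch_neq0 _ _ Cmod_lt1_0 hp z z1.
have := dpoch_neq0 _ _ hp hq (q * z) (Cmod_mul_lt1 _ _ hq z1).
by move=> *; field.
Qed.

Lemma egamma_neq0 z : (Cmod (p * q) < Cmod z < 1)%R -> egamma z <> 0.
Proof.
move=> [z1 z2]; apply: Cmult_neq_0; last by apply: Cinv_neq0; exact: dpoch_neq0.
by apply: dpoch_neq0 => //; exact: Cmod_div_lt.
Qed.

(** Reaches beyond the unit disc: once 1 - x is split off, the remaining products have arguments
    [q * x] and [p * x] in the disc. *)
Lemma dpoch_neq0' (x : C) : x <> 1 -> (Cmod (p * x) < 1)%R -> (Cmod (q * x) < 1)%R -> dpoch p q x <> 0.
Proof.
move=> x1 px qx; rewrite dpoch_rec // dpoch0_rec //.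
apply: Cmult_neq_0; last exact: dpoch_neq0.
apply: Cmult_neq_0; last by apply: dpoch_neq0 => //; exact: Cmod_lt1_0.
by move=> H; apply: x1; rewrite -[LHS]Cplus_0_r -H; ring.
Qed.

(** The right-hand side is still regular at z = 1; at z^2 it provides the holomorphic extension of 1
    / Gamma(z^{+-2}; p, q). *)
Lemma egamma_pm_inv (z : C) : z <> 0 -> z <> 1 ->
  (Cmod (p * z) < 1)%R -> (Cmod (q * z) < 1)%R ->
  (Cmod (p * / z) < 1)%R -> (Cmod (q * / z) < 1)%R ->
  / (egamma z * egamma (/ z)) = theta p z * theta q (/ z).
Proof.
move=> z0 z1 pz qz pz' qz'.
have z1' : / z <> 1 by move=> H; apply: z1; rewrite -(CinvK z) H; field.
rewrite /egamma.
have -> : p * q / / z = p * (q * z) by rewrite /Cdiv CinvK; ring.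
have -> : p * q / z = p * (q * / z) by rewrite /Cdiv; ring.
have D1 := dpoch_neq0' _ z1 pz qz; have D2 := dpoch_neq0' _ z1' pz' qz'.
have D3 := dpoch_neq0 _ _ hp hq _ (Cmod_mul_lt1 _ _ hp qz).
have D4 := dpoch_neq0 _ _ hp hq _ (Cmod_mul_lt1 _ _ hp qz').
have E1 : dpoch p q z = dpoch 0 p z * (dpoch 0 q (q * z) * dpoch p q (p * (q * z))).
  by rewrite (dpoch_rec' p q z) // (dpoch_rec p q (q * z)).
have E2 : dpoch p q (/ z) = dpoch 0 q (/ z) * (dpoch 0 p (p * / z) * dpoch p q (p * (q * / z))).
  rewrite (dpoch_rec p q (/ z)) // (dpoch_rec' p q (p * / z)) //.
  by congr (_ * (_ * dpoch p q _)); ring.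
rewrite /theta /Cdiv CinvK.
have -> : / (dpoch p q (p * (q * / z)) * / dpoch p q z * (dpoch p q (p * (q * z)) * / dpoch p q (/ z))) =
   dpoch p q z * dpoch p q (/ z) / (dpoch p q (p * (q * / z)) * dpoch p q (p * (q * z))).
  by field.
by rewrite E1 E2; field.
Qed.

Lemma locally'_proper (z : C) : ProperFilter (@locally' C_UniformSpace z).
Proof.
constructor; last exact: within_filter.
move=> P [eps H].
have e0 := cond_pos eps.
exists (z + RtoC (eps / 2)); apply: H.
  apply: C_NormedModule_mixin_compat1.
  rewrite /minus /plus /opp /=.
  have -> : z + RtoC (eps / 2) + - z = RtoC (eps / 2) by ring.
  rewrite Cmod_R Rabs_pos_eq; lra.
move=> E.
have : RtoC (eps / 2) = 0.
  have -> : RtoC (eps / 2) = z + RtoC (eps / 2) - z by ring.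
  by rewrite E; ring.
by move=> /RtoC_inj; lra.
Qed.

Lemma tame_ann a b : (0 < a)%R -> tame (fun z => a <= Cmod z <= b)%R.
Proof.
move=> a0; exists (Rmax (Rabs b) (/ a)); split.
  by apply: Rle_trans (Rmax_l _ _); exact: Rabs_pos.
move=> z [az zb]; split; first by apply: Cmod_neq0; lra.
  by apply: Rle_trans (Rmax_l _ _); apply: Rle_trans zb (RRle_abs _).
rewrite Cmod_inv'; apply: Rle_trans (Rmax_r _ _).
exact: Rinv_le_contravar.
Qed.

Lemma inH_theta (A B : C -> Prop) r x : (Cmod r < 1)%R -> tame A -> tame B -> inH A B x ->
  inH A B (fun z u => / x z u) -> inH A B (fun z u => theta r (x z u)).
Proof.
move=> hr tA tB Hx Hx'; apply: inH_mul => //; apply: inH_dpoch => //; try exact: Cmod_lt1_0.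
exact: inH_scal.
Qed.

(* 1 / Gamma(z^{+-2}; p, q) *)
Definition inv_gamma_pm2 (z : C) : C := theta p (z ^ 2) * theta q (/ z ^ 2).

Lemma inH_inv_gamma_pm2 (A B : C -> Prop) : tame A -> tame B -> inH A B (fun z _ => inv_gamma_pm2 z).
Proof.
move=> tA tB; apply: inH_mul => //; apply: inH_theta => //.
- by apply: inH_pow => //; exact: inH_z.
- apply: inH_ext (inH_pow _ _ tA tB _ 2 (inH_zinv A B)) => z u _ _; exact: Cpow_inv'.
- apply: inH_ext (inH_pow _ _ tA tB _ 2 (inH_zinv A B)) => z u _ _; exact: Cpow_inv'.
apply: inH_ext (inH_pow _ _ tA tB _ 2 (inH_z A B)) => z u _ _; by rewrite CinvK.
Qed.

Lemma holo_ext_pm2 z : Cmod z = 1%R ->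
  holo_ext (fun w => / ellGamma_pm2 p q w) z = inv_gamma_pm2 z.
Proof.
move=> z1; have z0 : z <> 0 by apply: Cmod_neq0; lra.
have PF := locally'_proper z.
apply: Clim_unique; apply/filterlim_Cmod => eps e0.
have tA := tame_ann (1 / 2) 2 (ltac:(lra)).
have [d1 d10 Hd1] := inH_cont _ _ tA tA _ (inH_inv_gamma_pm2 _ _ tA tA) _ e0.
pose m := Rmax (Cmod p) (Cmod q).
have m1 : (m < 1)%R by apply: Rmax_lub_lt.
have pm : (Cmod p <= m)%R := Rmax_l _ _; have qm : (Cmod q <= m)%R := Rmax_r _ _.
have p_0 := Cmod_ge_0 p; have q_0 := Cmod_ge_0 q.
(* For |w - z| < [d2], |w^2| stays strictly between [m] and 1 / [m], as [egamma_pm_inv] requires for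
   p and q. *)
pose d2 := ((1 - m) / 4)%R.
(* [d3] keeps w^2 off 1. If z^2 = 1, the only other root - z is at distance 2 from z. Otherwise |w^2
   - z^2| < 3 [d3] <= |z^2 - 1|. *)
have [d3 [d30 [d3a d3b]]] : exists d3, (0 < d3)%R /\ (z ^ 2 = 1 -> (d3 <= 1)%R) /\
    (z ^ 2 <> 1 -> (3 * d3 <= Cmod (z ^ 2 - 1))%R).
  have [zE|zn] := Ceq_dec (z ^ 2) 1; first by exists 1%R; split; [lra|split=> // _; lra].
  have H : (0 < Cmod (z ^ 2 - 1))%R.
    by apply/Cmod_gt_0 => H; apply: zn; rewrite -[RHS]Cplus_0_r -H; ring.
  by exists (Cmod (z ^ 2 - 1) / 3)%R; split; [lra|split=> // _; lra].
pose d := Rmin d1 (Rmin d2 d3).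
have d0 : (0 < d)%R by rewrite /d /d2; do 2 (apply: Rmin_glb_lt => //); lra.
have L : @locally C_UniformSpace z (fun w => Cmod (w - z) < d)%R.
  by have /filterlim_Cmod := @filterlim_id C (@locally C_UniformSpace z); apply.
suff key : forall w : C, (Cmod (w - z) < d)%R -> w <> z ->
    (Cmod (/ ellGamma_pm2 p q w - inv_gamma_pm2 z) < eps)%R.
  by rewrite /locally' /within; apply: filter_imp L => w; exact: key.
move=> w dw wz.
have dd1 : (d <= d1)%R := Rmin_l _ _.
have dd2 : (d <= d2)%R := Rle_trans _ _ _ (Rmin_r _ _) (Rmin_l _ _).
have dd3 : (d <= d3)%R := Rle_trans _ _ _ (Rmin_r _ _) (Rmin_r _ _).
have w_up : (Cmod w < 1 + d2)%R.
  have := Cmod_triangle (w - z) z; have -> : w - z + z = w by ring.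
  lra.
have w_lo : (1 - d2 < Cmod w)%R.
  have := Cmod_triangle w (z - w); have -> : w + (z - w) = z by ring.
  rewrite (Cmod_sub_sym z w); lra.
have w2 : Cmod (w ^ 2) = (Cmod w * Cmod w)%R by rewrite Cmod_pow /=; ring.
have d2E : (d2 = (1 - m) / 4)%R by [].
have w0 : w <> 0 by apply: Cmod_neq0; lra.
have m0 : (0 <= m)%R by lra.
have d20 : (0 < d2 <= 1 / 4)%R by lra.
have up : (Cmod (w ^ 2) * m < 1)%R.
  have H : (Cmod w * Cmod w <= (1 + d2) * (1 + d2))%R by apply: Rmult_le_compat; lra.
  have H1 : (Cmod w * Cmod w <= 1 + 3 * d2)%R by nra.
  have -> : m = (1 - 4 * d2)%R by lra.
  by rewrite w2; nra.
have lo : (m < Cmod (w ^ 2))%R.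
  have H : ((1 - d2) * (1 - d2) <= Cmod w * Cmod w)%R by apply: Rmult_le_compat; lra.
  by rewrite w2; nra.
have wi : (0 < Cmod w)%R by lra.
have bnd r : (Cmod r <= m)%R -> (Cmod (r * w ^ 2) < 1)%R /\ (Cmod (r * / w ^ 2) < 1)%R.
  move=> rm; split.
    rewrite Cmod_mult; have := Cmod_ge_0 (w ^ 2); have := Cmod_ge_0 r; nra.
  by apply: Cmod_div_lt; lra.
have [pw pw'] := bnd _ pm; have [qw qw'] := bnd _ qm.
have w20 : w ^ 2 <> 0 by exact: Cpow_nz.
have w21 : w ^ 2 <> 1.
  move=> E; have [zE|zn] := Ceq_dec (z ^ 2) 1.
    have d31 := d3a zE.
    have : (w - z) * (w + z) = 0.
      have -> : (w - z) * (w + z) = w ^ 2 - z ^ 2 by rewrite /=; ring.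
      by rewrite E zE; ring.
    have wz0 : w - z <> 0.
      by move=> H; apply: wz; rewrite -[RHS]Cplus_0_r -H; ring.
    have wz1 : w + z <> 0.
      move=> H; have E1 : w = - z by rewrite -[RHS]Cplus_0_r -H; ring.
      rewrite E1 in dw.
      have E2 : - z - z = - (2 * z) by ring.
      rewrite E2 Cmod_opp Cmod_mult Cmod_R Rabs_pos_eq in dw; lra.
    exact: Cmult_neq_0.
  have E1 : z ^ 2 - 1 = (z - w) * (z + w) by rewrite -E /=; ring.
  have : (Cmod (z ^ 2 - 1) <= d * 3)%R.
    rewrite E1 Cmod_mult (Cmod_sub_sym z w); apply: Rmult_le_compat; try exact: Cmod_ge_0.
      lra.
    have := Cmod_triangle z w; lra.
  have : (d * 3 <= Cmod (z ^ 2 - 1))%R by have := d3b zn; lra.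
  move=> H1 H2.
  have : (Cmod (z ^ 2 - 1) < d * 3)%R.
    rewrite E1 Cmod_mult (Cmod_sub_sym z w).
    have := Cmod_triangle z w; have := Cmod_ge_0 (z + w); have := Cmod_ge_0 (w - z); nra.
  lra.
have w21' : / w ^ 2 <> 1 by move=> H; apply: w21; rewrite -(CinvK (w ^ 2)) H; field.
have -> : / ellGamma_pm2 p q w = inv_gamma_pm2 w.
  by rewrite /ellGamma_pm2 !ellGammaE ?egamma_pm_inv //; exact: dpoch_neq0'.
apply: (Hd1 _ 1 _ 1); try (rewrite ?Cmod_1; lra).
have -> : 1 - 1 = RtoC 0 by ring.
by rewrite Cmod_0.
Qed.

End Gamma.

(** * A theta function identity *)

(** The singleton {1} serves as range of the second variable for functions of [z] alone. *)
Lemma tame_one : tame (eq (RtoC 1)).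
Proof.
have [M [M0 H]] := tame_ann 1 1 Rlt_0_1.
by exists M; split=> // z <-; apply: H; rewrite Cmod_1; lra.
Qed.

Lemma Copp_neq0 (x : C) : x <> 0 -> - x <> 0.
Proof.
move=> x0 H; apply: x0; have -> : x = - - x by ring.
rewrite H; ring.
Qed.

Lemma Copp_eq0 (x : C) : - x = 0 -> x = 0.
Proof.
move=> H; have -> : x = - - x by ring.
rewrite H; ring.
Qed.

Lemma Ceq_opp_eq0 (x : C) : x = - x -> x = 0.
Proof.
have E0 : 2 * x = x + x by ring.
move=> H; have E : 2 * x = 0 by rewrite E0 -[RHS](Cplus_opp_r x) -H.
have [//|x0] := Ceq_dec x 0; exfalso; apply: (Cmult_neq_0 2 x _ x0 E).
by move=> /RtoC_inj; lra.
Qed.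

Section Theta.
Variable p : C.
Hypotheses (hp0 : p <> 0) (hp : (Cmod p < 1)%R).

Definition ann_p (z : C) : Prop := (Cmod p <= Cmod z <= / Cmod p)%R.

Lemma Cmod_p_gt0 : (0 < Cmod p)%R. Proof. exact/Cmod_gt_0. Qed.

Lemma tame_ann_p : tame ann_p.
Proof. exact: tame_ann Cmod_p_gt0. Qed.

Lemma inv_Cmod_p : (1 < / Cmod p)%R.
Proof. by rewrite -Rinv_1; apply: Rinv_lt_contravar; have := Cmod_p_gt0; lra. Qed.

Lemma circ1 : circ ann_p 1.
Proof. by move=> z; rewrite Cmod_1 /ann_p => ->; have := inv_Cmod_p; lra. Qed.

Lemma circp : circ ann_p p.
Proof. by move=> z; rewrite /ann_p => ->; have := inv_Cmod_p; lra. Qed.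

Lemma circ_ann_p z : ann_p z -> circ ann_p z.
Proof. by move=> H y; rewrite /ann_p => ->. Qed.

(* A space of dimension 2: theta functions of degree 6 with the symmetry of
   z theta(z^2; p). *)
Definition thetaV (f : C -> C) : Prop :=
  [/\ inH ann_p (eq (RtoC 1)) (fun z _ => f z),
      forall z, Cmod z = 1%R -> f (p * z) = / p * (/ z) ^ 6 * f z &
      forall z, Cmod z = 1%R -> f (/ z) = - (/ z) ^ 4 * f z].

(** The Laurent coefficient of z^(b - a). *)
Definition lcoef (f : C -> C) (a b : nat) : C := mean (fun z => f z * (z ^ a * (/ z) ^ b)) 1.

Lemma inH_lcoef f a b : inH ann_p (eq (RtoC 1)) (fun z _ => f z) ->
  inH ann_p (eq (RtoC 1)) (fun z _ => f z * (z ^ a * (/ z) ^ b)).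
Proof.
move=> Hf; have tA := tame_ann_p; have tB := tame_one.
apply: inH_mul => //; apply: inH_mul => //; apply: inH_pow => //.
  exact: inH_z.
exact: inH_zinv.
Qed.

Lemma lcoef_is_mean f a b : inH ann_p (eq (RtoC 1)) (fun z _ => f z) ->
  is_mean (fun z => f z * (z ^ a * (/ z) ^ b)) 1 (lcoef f a b).
Proof.
move=> Hf.
exact: (inH_is_mean _ _ tame_ann_p _ _ _ (inH_lcoef f a b Hf) erefl circ1).
Qed.

Lemma lcoefS f a b : lcoef f a.+1 b.+1 = lcoef f a b.
Proof.
rewrite /lcoef /mean; congr Cmult; apply: (@RInt_ext C_R_CompleteNormedModule) => x _.
have := expi_neq0 x => e0.
by rewrite Cmult_1_l /=; field.
Qed.

Local Opaque mean.

Lemma lcoef_shift f k a b : lcoef f (a + k) (b + k) = lcoef f a b.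
Proof.
elim: k => [|k IH]; first by rewrite !addn0.
by rewrite !addnS lcoefS.
Qed.

Lemma lcoef_quasi f a b : thetaV f -> p * lcoef f a b = p ^ a * (/ p) ^ b * lcoef f a (b + 6).
Proof.
move=> [Hf Hq _].
have H1 := inH_is_mean _ _ tame_ann_p _ _ _ (inH_lcoef f a b Hf) erefl circp.
rewrite (mean_indep _ _ tame_ann_p _ _ _ _ (inH_lcoef f a b Hf) erefl circp circ1) -/(lcoef f a b) in H1.
have H2 := is_mean_scal _ _ _ (/ p * p ^ a * (/ p) ^ b) (lcoef_is_mean f a (b + 6) Hf).
have -> : lcoef f a b = / p * p ^ a * (/ p) ^ b * lcoef f a (b + 6); last by field.
apply: (is_mean_unique _ _ _ _ _ H2); move: H1; rewrite /is_mean.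
apply: is_RInt_ext => x _.
have pt z : Cmod z = 1%R -> f (p * z) * ((p * z) ^ a * (/ (p * z)) ^ b) =
  / p * p ^ a * (/ p) ^ b * (f z * (z ^ a * (/ z) ^ (b + 6))).
  by move=> /Hq ->; rewrite CinvM !Cpow_mult_l Cpow_add_r; ring.
by rewrite pt ?Cmod_expi // Cmult_1_l.
Qed.

Lemma Cmult_eq0_l (x y : C) : x * y = 0 -> y <> 0 -> x = 0.
Proof.
move=> H y0; have [//|x0] := Ceq_dec x 0.
by case: (Cmult_neq_0 _ _ x0 y0).
Qed.

Lemma lcoef_quasi0 f b : thetaV f -> lcoef f 0 b = 0 -> lcoef f 0 (b + 6) = 0.
Proof.
move=> Vf b0; have := lcoef_quasi f 0 b Vf; rewrite b0 Cmult_0_r Cmult_1_l Cmult_comm => E.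
by apply: (Cmult_eq0_l _ _ (esym E)); apply: Cpow_nz; exact: Cinv_neq0.
Qed.

Lemma lcoef_inv f a b : thetaV f -> lcoef f a b = - lcoef f b (a + 4).
Proof.
move=> [Hf _ Hi].
have E1 : / RtoC 1 = 1 by field.
have c1 : circ ann_p (/ 1) by rewrite E1; exact: circ1.
have H1 := mean_inv _ _ tame_ann_p _ _ _ (inH_lcoef f a b Hf) erefl circ1 c1.
rewrite E1 -/(lcoef f a b) in H1.
have H2 := is_mean_scal _ _ _ (- (1)) (lcoef_is_mean f b (a + 4) Hf).
have -> : - lcoef f b (a + 4) = - (1) * lcoef f b (a + 4) by ring.
apply: (is_mean_unique _ _ _ _ _ H2); move: H1.
apply: is_mean_ext => z; rewrite Cmod_1 => z1.
by rewrite Hi // Cpow_add_r CinvK; ring.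
Qed.

(** For the coefficients c_k of z^k, the symmetry reads c_k = - c_(4-k) and quasi-periodicity
    c_(k+6) = p^(k+1) c_k. Hence c_2 = 0, c_3 = - c_1, c_4 = - c_0, and c_5 = c_(-1) = - c_5 = 0. So
    c_0 and c_1 determine [f]. *)
Lemma thetaV_zero f z : thetaV f -> ann_p z -> lcoef f 0 0 = 0 -> lcoef f 0 1 = 0 -> f z = 0.
Proof.
move=> Vf Az d0 d1.
have d2 : lcoef f 0 2 = 0.
  by apply: Ceq_opp_eq0; rewrite {1}(lcoef_inv f 0 2 Vf) (lcoef_shift f 2 0 2).
have d3 : lcoef f 0 3 = 0.
  by apply: Copp_eq0; rewrite -(lcoef_shift f 1 0 3) -(lcoef_inv f 0 1 Vf).
have d4 : lcoef f 0 4 = 0 by apply: Copp_eq0; rewrite -(lcoef_inv f 0 0 Vf).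
have d5 : lcoef f 0 5 = 0.
  have E := lcoef_quasi f 1 0 Vf; rewrite lcoefS in E.
  have E1 : lcoef f 0 5 = lcoef f 1 0.
    apply: esym; rewrite -[LHS](Cmult_1_l) -(Cinv_l p hp0) -Cmult_assoc E /=; field; exact: hp0.
  by apply: Ceq_opp_eq0; rewrite {1}E1 (lcoef_inv f 1 0 Vf).
have dall k : lcoef f 0 k = 0.
  elim/ltn_ind: k => k IH.
  case: k IH => [//|[//|[//|[//|[//|[//|k]]]]]] IH.
  rewrite -[k.+4.+2]/(6 + k)%N addnC; apply: (lcoef_quasi0 f k Vf); apply: IH.
  by rewrite -[k.+4.+2]/(6 + k)%N -[X in (X < _)%N]add0n ltn_add2r.
have [Hf _ _] := Vf.
apply: (fourier_zero _ _ tame_ann_p tame_one (fun z _ => f z) 1 1 z Hf erefl circ1 (circ_ann_p _ Az)) => a b.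
rewrite -/(lcoef f a b).
have [le|/ltnW le] := leqP a b.
  by rewrite -(subnK le) -[X in lcoef f X _]add0n lcoef_shift.
rewrite -(subnK le) -[X in lcoef f _ X]add0n lcoef_shift lcoef_inv // dall; ring.
Qed.

Lemma thetaV_lin f g x y : thetaV f -> thetaV g -> thetaV (fun z => x * f z + y * g z).
Proof.
move=> [Hf Qf If] [Hg Qg Ig]; split.
- apply: inH_add; apply: inH_scal => //; by [exact: tame_ann_p|exact: tame_one].
- by move=> z z1; rewrite Qf // Qg //; ring.
by move=> z z1; rewrite If // Ig //; ring.
Qed.

Lemma lcoef_lin f g x y a b : thetaV f -> thetaV g ->
  lcoef (fun z => x * f z + y * g z) a b = x * lcoef f a b + y * lcoef g a b.
Proof.
move=> [Hf _ _] [Hg _ _]; apply: is_mean_mean.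
have := is_mean_add _ _ _ _ _ (is_mean_scal _ _ _ x (lcoef_is_mean f a b Hf))
  (is_mean_scal _ _ _ y (lcoef_is_mean g a b Hg)).
by apply: is_mean_ext => z _; ring.
Qed.

Lemma thetaV_det0 f g w : thetaV f -> thetaV g -> ann_p w ->
  lcoef f 0 0 * lcoef g 0 1 = lcoef f 0 1 * lcoef g 0 0 ->
  lcoef g 0 0 * f w = lcoef f 0 0 * g w /\ lcoef g 0 1 * f w = lcoef f 0 1 * g w.
Proof.
move=> Vf Vg Aw E.
have sub0 (x y k : C) : x + - y * k = 0 -> x = y * k.
  move=> H; have -> : x = (x + - y * k) + y * k by ring.
  by rewrite H Cplus_0_l.
split; apply: sub0.
  apply: (thetaV_zero _ w (thetaV_lin f g (lcoef g 0 0) (- lcoef f 0 0) Vf Vg) Aw).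
  - by rewrite lcoef_lin //; ring.
  have -> : lcoef (fun z => lcoef g 0 0 * f z + - lcoef f 0 0 * g z) 0 1 =
      lcoef f 0 1 * lcoef g 0 0 - lcoef f 0 0 * lcoef g 0 1 by rewrite lcoef_lin //; ring.
  by rewrite E; ring.
apply: (thetaV_zero _ w (thetaV_lin f g (lcoef g 0 1) (- lcoef f 0 1) Vf Vg) Aw).
- by rewrite lcoef_lin // (Cmult_comm (lcoef g 0 1)) E; ring.
by rewrite lcoef_lin //; ring.
Qed.

(** Cramer's rule on the coefficients (c_0, c_1) gives D G = al u + be v. Evaluation at [x] yields
    be = 0, at [y] al = 0. If D = 0, then u and v have proportional coefficients, and u x = 0 with v
    x <> 0 makes u vanish, against u y <> 0. *)
Lemma thetaV_two_points u v G x y :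
  thetaV u -> thetaV v -> thetaV G -> ann_p x -> ann_p y ->
  u x = 0 -> G x = 0 -> v x <> 0 -> v y = 0 -> G y = 0 -> u y <> 0 ->
  forall z, ann_p z -> G z = 0.
Proof.
move=> Vu Vv VG Ax Ay ux Gx vx vy Gy uy z Az.
pose al := lcoef G 0 0 * lcoef v 0 1 - lcoef G 0 1 * lcoef v 0 0.
pose be := lcoef u 0 0 * lcoef G 0 1 - lcoef u 0 1 * lcoef G 0 0.
pose D := lcoef u 0 0 * lcoef v 0 1 - lcoef u 0 1 * lcoef v 0 0.
pose F := fun w => 1 * (D * G w + - al * u w) + - be * v w.
have V1 : thetaV (fun w => D * G w + - al * u w) by exact: thetaV_lin.
have VF : thetaV F by exact: thetaV_lin.
have F0 w : ann_p w -> F w = 0.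
  move=> Aw; apply: (thetaV_zero F w VF Aw); rewrite /F (lcoef_lin (fun w => D * G w + - al * u w)) // lcoef_lin //;
  rewrite /D /al /be; ring.
have be0 : be = 0.
  have := F0 x Ax; rewrite /F ux Gx => H.
  have {}H : be * v x = 0 by apply: Copp_eq0; rewrite -[RHS]H; ring.
  exact: (Cmult_eq0_l _ _ H vx).
have al0 : al = 0.
  have := F0 y Ay; rewrite /F vy Gy => H.
  have {}H : al * u y = 0 by apply: Copp_eq0; rewrite -[RHS]H; ring.
  exact: (Cmult_eq0_l _ _ H uy).
have H := F0 z Az; rewrite /F al0 be0 in H.
have {}H : G z * D = 0 by rewrite -[RHS]H; ring.
apply: (Cmult_eq0_l _ _ H) => D0.
have E : lcoef u 0 0 * lcoef v 0 1 = lcoef u 0 1 * lcoef v 0 0.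
  by rewrite -[RHS]Cplus_0_r -D0 /D; ring.
have [e3 e1] := thetaV_det0 u v x Vu Vv Ax E.
rewrite ux Cmult_0_r in e1; rewrite ux Cmult_0_r in e3.
apply: uy; apply: (thetaV_zero u y Vu Ay).
  exact: Cmult_eq0_l (esym e3) vx.
exact: Cmult_eq0_l (esym e1) vx.
Qed.

Definition theta_base (s z : C) : C := z * theta p (z ^ 2) * theta p (s * z) * theta p (s / z).

Lemma circle_neq0 z : Cmod z = 1%R -> z <> 0.
Proof. by move=> z1; apply: Cmod_neq0; rewrite z1; lra. Qed.

Lemma inH_theta_mul (s : C) : s <> 0 -> inH ann_p (eq (RtoC 1)) (fun z _ => theta p (s * z)).
Proof.
move=> s0; have tA := tame_ann_p; have tB := tame_one.
apply: inH_theta => //; first by apply: inH_scal => //; exact: inH_z.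
apply: inH_ext (inH_scal _ _ tA tB (/ s) _ (inH_zinv _ _)) => z u _ _.
by rewrite CinvM.
Qed.

Lemma inH_theta_div (s : C) : s <> 0 -> inH ann_p (eq (RtoC 1)) (fun z _ => theta p (s / z)).
Proof.
move=> s0; have tA := tame_ann_p; have tB := tame_one.
apply: inH_theta => //; first by apply: inH_scal => //; exact: inH_zinv.
apply: inH_ext (inH_scal _ _ tA tB (/ s) _ (inH_z _ _)) => z u _ _.
by rewrite /Cdiv CinvM CinvK.
Qed.

Lemma theta_div_mulp (s z : C) : s <> 0 -> z <> 0 -> theta p (s / (p * z)) = - (s / (p * z)) * theta p (s / z).
Proof.
move=> s0 z0.
have y0 : s / (p * z) <> 0 by apply: Cmult_neq_0 => //; apply: Cinv_neq0; exact: Cmult_neq_0.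
have -> : s / z = p * (s / (p * z)) by field.
by rewrite (theta_mulp p (s / (p * z))) //; field; repeat split.
Qed.

Lemma theta_base_V (s : C) : s <> 0 -> thetaV (theta_base s).
Proof.
move=> s0; have tA := tame_ann_p; have tB := tame_one; split.
- apply: inH_mul => //; last exact: inH_theta_div.
  apply: inH_mul => //; last exact: inH_theta_mul.
  apply: inH_mul => //; first exact: inH_z.
  apply: inH_theta => //; first by apply: inH_pow => //; exact: inH_z.
  apply: inH_ext (inH_pow _ _ tA tB _ 2 (inH_zinv _ _)) => z u _ _; exact: Cpow_inv'.
- move=> z /circle_neq0 z0; rewrite /theta_base theta_div_mulp //.
  have -> : s * (p * z) = p * (s * z) by ring.
  have -> : (p * z) ^ 2 = p * (p * z ^ 2) by rewrite /=; ring.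
  have z20 : z ^ 2 <> 0 by exact: Cpow_nz.
  have pz20 : p * z ^ 2 <> 0 by exact: Cmult_neq_0.
  have sz0 : s * z <> 0 by exact: Cmult_neq_0.
  by rewrite !theta_mulp //; field; repeat split.
move=> z /circle_neq0 z0; rewrite /theta_base Cpow_inv' theta_inv //; last exact: Cpow_nz.
have -> : s / / z = s * z by rewrite /Cdiv CinvK.
have -> : s * / z = s / z by [].
by field.
Qed.

Section Identity.
Variables t0 s5 a b c d : C.
Hypotheses (nt0 : t0 <> 0) (ns5 : s5 <> 0) (na : a <> 0) (nb : b <> 0) (nc : c <> 0) (nd : d <> 0).
Hypothesis bal : t0 * a * b * c * d * s5 = p.

Definition theta_prod (z : C) : C :=
  theta p (t0 * z) * theta p (a * z) * theta p (b * z) * theta p (c * z) * theta p (d * z) * theta p (s5 * z).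
Definition theta_prod_inv (z : C) : C :=
  theta p (t0 / z) * theta p (a / z) * theta p (b / z) * theta p (c / z) * theta p (d / z) * theta p (s5 / z).
Definition theta_diff (z : C) : C := theta_prod z - z ^ 4 * theta_prod_inv z.

(** The six multipliers - / (x z) of [theta_prod] have product / (p z^6) because the parameters
    multiply to p. The power z^4 gives the second product the same multiplier, and z -> 1 / z
    exchanges the two terms up to - z^(-4). *)
Lemma theta_diff_V : thetaV theta_diff.
Proof.
have tA := tame_ann_p; have tB := tame_one; split.
- apply: inH_sub => //.
    by repeat (apply: inH_mul => //; last exact: inH_theta_mul); exact: inH_theta_mul.
  apply: inH_mul => //; first by apply: inH_pow => //; exact: inH_z.
  by repeat (apply: inH_mul => //; last exact: inH_theta_div); exact: inH_theta_div.
- move=> z /circle_neq0 z0; rewrite /theta_diff /theta_prod /theta_prod_inv !theta_div_mulp //.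
  have sw x : x * (p * z) = p * (x * z) by ring.
  rewrite !sw !theta_mulp //; try by apply: Cmult_neq_0.
  have -> : (p * z) ^ 4 = p ^ 4 * z ^ 4 by rewrite Cpow_mult_l.
  by rewrite -bal; field; repeat split.
move=> z /circle_neq0 z0; rewrite /theta_diff /theta_prod /theta_prod_inv.
have sw x : x / / z = x * z by rewrite /Cdiv CinvK.
have sw' x : x * / z = x / z by [].
by rewrite !sw !sw'; field.
Qed.

Definition theta_pairs (s : C) : C := theta p (s * a) * theta p (s * b) * theta p (s * c) * theta p (s * d).

Lemma theta_1 : theta p 1 = 0.
Proof.
rewrite /theta dpoch0_rec //; have -> : 1 - 1 = RtoC 0 by ring.
by rewrite !Cmult_0_l.
Qed.

Hypotheses (lt0 : (Cmod t0 < 1)%R) (l5 : (Cmod s5 < Cmod t0)%R) (l5p : (Cmod p < Cmod s5 * Cmod s5)%R).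

(** All three terms lie in [thetaV], so the points 1 / t0 and 1 / s5 suffice. At each of them one
    [theta_base] and the product [theta_prod] contain theta(1) = 0, and the two surviving terms
    cancel. The size conditions put the two points into the annulus and keep theta(t0^2),
    theta(s5^2), theta(t0 s5) and theta(s5 / t0) away from 0. *)
Lemma theta_identity z : ann_p z ->
  theta_pairs s5 * theta_base t0 z - theta_pairs t0 * theta_base s5 z + t0 * theta p (s5 / t0) * theta_diff z = 0.
Proof.
have p0 := Cmod_p_gt0.
have s51 : (Cmod s5 < 1)%R by lra.
have s5p := Cmod_ge_0 s5.
have s5m : (Cmod p < Cmod s5)%R by nra.
have t0m : (Cmod p < Cmod t0)%R by nra.
have AI w : (Cmod p < Cmod w < 1)%R -> ann_p (/ w).
  move=> [w1 w2]; rewrite /ann_p Cmod_inv'; split.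
    apply: (Rle_trans _ 1%R); first lra.
    by rewrite -Rinv_1; apply: Rinv_le_contravar; lra.
  by apply: Rinv_le_contravar; lra.
pose G := fun z => 1 * (theta_pairs s5 * theta_base t0 z + - theta_pairs t0 * theta_base s5 z) + (t0 * theta p (s5 / t0)) * theta_diff z.
have VG : thetaV G.
  by apply: thetaV_lin; [apply: thetaV_lin; exact: theta_base_V|exact: theta_diff_V].
move=> Az; have -> : theta_pairs s5 * theta_base t0 z - theta_pairs t0 * theta_base s5 z + t0 * theta p (s5 / t0) * theta_diff z = G z.
  by rewrite /G; ring.
have dv x y : x / / y = x * y by rewrite /Cdiv CinvK.
have self (x : C) : x <> 0 -> x * / x = 1 by move=> x0; rewrite Cinv_r.
have u0 : theta_base t0 (/ t0) = 0 by rewrite /theta_base self // theta_1; ring.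
have v0 : theta_base s5 (/ s5) = 0 by rewrite /theta_base self // theta_1; ring.
have swap : theta p (t0 / s5) = - (t0 / s5) * theta p (s5 / t0).
  have -> : t0 / s5 = / (s5 / t0) by field; split.
  by rewrite theta_inv ?CinvK //; apply: Cmult_neq_0 => //; exact: Cinv_neq0.
have sq w : (Cmod w < 1)%R -> (Cmod p < Cmod w * Cmod w)%R -> theta p (w * w) <> 0.
  move=> w1 w2; apply: theta_neq0 => //; rewrite Cmod_mult; split=> //.
  by have := Cmod_ge_0 w; nra.
have inv2 (w : C) : w <> 0 -> theta p ((/ w) ^ 2) = - / (w * w) * theta p (w * w).
  by move=> w0; rewrite Cpow_inv' /= Cmult_1_r theta_inv //; exact: Cmult_neq_0.
have st : theta p (s5 * t0) <> 0.
  by apply: theta_neq0 => //; rewrite Cmod_mult; split; have := Cmod_ge_0 t0; nra.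
have st' : theta p (s5 / t0) <> 0.
  apply: theta_neq0 => //; split; last exact: Cmod_div_lt.
  rewrite Cmod_div //; apply: (Rmult_lt_reg_r (Cmod t0)); first lra.
  by rewrite /Rdiv Rmult_assoc Rinv_l; [nra|lra].
apply: (thetaV_two_points (theta_base t0) (theta_base s5) G (/ t0) (/ s5)) => //.
- exact: theta_base_V.
- exact: theta_base_V.
- exact: AI.
- exact: AI.
- rewrite /G u0 /theta_diff /theta_prod /theta_prod_inv /theta_base /theta_pairs !dv self // theta_1 inv2 //.
  by rewrite (Cmult_comm a t0) (Cmult_comm b t0) (Cmult_comm c t0) (Cmult_comm d t0) /Cdiv; field.
- rewrite /theta_base inv2 // dv.
  apply: Cmult_neq_0 => //; apply: Cmult_neq_0 => //; apply: Cmult_neq_0; first exact: Cinv_neq0.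
  apply: Cmult_neq_0; first by apply/Copp_neq0/Cinv_neq0; exact: Cmult_neq_0.
  by apply: sq => //; nra.
- rewrite /G v0 /theta_diff /theta_prod /theta_prod_inv /theta_base /theta_pairs !dv self // theta_1 inv2 // -/(Cdiv t0 s5) swap (Cmult_comm t0 s5).
  by rewrite (Cmult_comm a s5) (Cmult_comm b s5) (Cmult_comm c s5) (Cmult_comm d s5) /Cdiv; field; repeat split.
rewrite /theta_base inv2 // dv -/(Cdiv t0 s5) swap (Cmult_comm t0 s5).
apply: Cmult_neq_0 => //; apply: Cmult_neq_0.
  apply: Cmult_neq_0; first exact: Cinv_neq0.
  apply: Cmult_neq_0; first by apply/Copp_neq0/Cinv_neq0; exact: Cmult_neq_0.
  exact: sq.
by apply: Cmult_neq_0 => //; apply: Copp_neq0; apply: Cmult_neq_0 => //; exact: Cinv_neq0.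
Qed.

End Identity.
End Theta.

(** * The q-difference equation *)

Definition unit_circle (z : C) : Prop := (1 <= Cmod z <= 1)%R.

Lemma tame_unit_circle : tame unit_circle. Proof. exact: (tame_ann 1 1 Rlt_0_1). Qed.

Lemma unit_circle_circ (w : C) : Cmod w = 1%R -> circ unit_circle w.
Proof. by move=> w1 z; rewrite w1 /unit_circle; lra. Qed.

Lemma unit_circle_circ1 : circ unit_circle 1.
Proof. by apply: unit_circle_circ; rewrite Cmod_1. Qed.

Section NormBeta.
Variables p q : C.
Hypotheses (hp0 : p <> 0) (hq0 : q <> 0) (hp : (Cmod p < 1)%R) (hq : (Cmod q < 1)%R).

Local Notation G := (egamma p q).
Local Notation iG x := (/ egamma p q x).

Lemma inH_egamma (A B : C -> Prop) x (R0 : R) : tame A -> tame B ->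
  inH A B x -> inH A B (fun z u => / x z u) -> (0 <= R0 < 1)%R ->
  (forall z u, A z -> B u -> (Cmod (x z u) <= R0)%R) ->
  inH A B (fun z u => G (x z u)).
Proof.
move=> tA tB Hx Hx' R01 xR; apply: inH_mul => //.
  by apply: inH_dpoch => //; apply: inH_scal.
exact: inH_inv_dpoch xR.
Qed.

Lemma inH_inv_egamma (A B : C -> Prop) x (R0 : R) : tame A -> tame B ->
  inH A B x -> inH A B (fun z u => / x z u) -> (0 <= R0 < 1)%R ->
  (forall z u, A z -> B u -> (Cmod (p * q * / x z u) <= R0)%R) ->
  inH A B (fun z u => iG (x z u)).
Proof.
move=> tA tB Hx Hx' R01 xR.
apply: (inH_ext _ _ (fun z u => / dpoch p q (p * q * / x z u) * dpoch p q (x z u))).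
  by move=> z u _ _; rewrite /egamma CinvM CinvK.
apply: inH_mul => //; last exact: inH_dpoch.
by apply: inH_inv_dpoch xR => //; exact: inH_scal.
Qed.

Definition gamma_pm (t z : C) : C := G (t * z) * G (t * / z).

Definition beta_kernel (t0 t1 t2 t3 t4 t5 z : C) : C :=
  inv_gamma_pm2 p q z * (gamma_pm t0 z * gamma_pm t1 z * gamma_pm t2 z * gamma_pm t3 z * gamma_pm t4 z * gamma_pm t5 z).

Definition inv_gamma_prod (t0 t1 t2 t3 t4 t5 : C) : C :=
  iG (t0 * t1) * iG (t0 * t2) * iG (t0 * t3) * iG (t0 * t4) * iG (t0 * t5) *
  (iG (t1 * t2) * iG (t1 * t3) * iG (t1 * t4) * iG (t1 * t5)) *
  (iG (t2 * t3) * iG (t2 * t4) * iG (t2 * t5)) *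
  (iG (t3 * t4) * iG (t3 * t5)) * iG (t4 * t5).

(* The beta integral divided by its claimed value, up to a constant factor. *)
Definition norm_beta (t0 t1 t2 t3 t4 t5 : C) : C :=
  mean (beta_kernel t0 t1 t2 t3 t4 t5) 1 * inv_gamma_prod t0 t1 t2 t3 t4 t5.

(** A parameter of the integral depending on [u]: staying uniformly inside the unit disc, it keeps
    the poles of the kernel off the unit circle. *)
Definition small_param (B : C -> Prop) (f : C -> C) : Prop :=
  [/\ inH unit_circle B (fun _ u => f u), inH unit_circle B (fun _ u => / f u) &
      exists2 R0, (0 <= R0 < 1)%R & forall u, B u -> (Cmod (f u) <= R0)%R].

Lemma inH_gamma_pm (B : C -> Prop) f : tame B -> small_param B f -> inH unit_circle B (fun z u => gamma_pm (f u) z).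
Proof.
move=> tB [Hf Hf' [R0 R01 fR]]; have tA := tame_unit_circle.
have Hz := inH_z unit_circle B; have Hz' := inH_zinv unit_circle B.
apply: inH_mul => //.
  apply: (inH_egamma _ _ _ R0) => //; first exact: inH_mul.
    by apply: inH_ext (inH_mul _ _ tA tB _ _ Hf' Hz') => z u _ _; rewrite CinvM.
  by move=> z u [z1 z2] Bu; rewrite Cmod_mult; have := fR u Bu; have := Cmod_ge_0 (f u); nra.
apply: (inH_egamma _ _ _ R0) => //; first exact: inH_mul.
  by apply: inH_ext (inH_mul _ _ tA tB _ _ Hf' Hz) => z u _ _; rewrite CinvM CinvK.
move=> z u [z1 z2] Bu; rewrite Cmod_mult Cmod_inv'.
have -> : Cmod z = 1%R by lra.
by have := fR u Bu; lra.
Qed.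

Lemma inH_beta_kernel (B : C -> Prop) f0 f1 f2 f3 f4 f5 : tame B ->
  small_param B f0 -> small_param B f1 -> small_param B f2 -> small_param B f3 -> small_param B f4 -> small_param B f5 ->
  inH unit_circle B (fun z u => beta_kernel (f0 u) (f1 u) (f2 u) (f3 u) (f4 u) (f5 u) z).
Proof.
move=> tB *; have tA := tame_unit_circle.
apply: inH_mul => //; first exact: inH_inv_gamma_pm2.
by do 5 (apply: inH_mul => //; last exact: inH_gamma_pm); exact: inH_gamma_pm.
Qed.

Lemma small_param_const B t : tame B -> (Cmod t < 1)%R -> small_param B (fun _ => t).
Proof.
move=> tB t1; have tA := tame_unit_circle; split; try exact: inH_const.
by exists (Cmod t); [split=> //; exact: Cmod_ge_0|move=> *; lra].
Qed.

Lemma beta_kernel_is_mean t0 t1 t2 t3 t4 t5 :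
  (Cmod t0 < 1)%R -> (Cmod t1 < 1)%R -> (Cmod t2 < 1)%R ->
  (Cmod t3 < 1)%R -> (Cmod t4 < 1)%R -> (Cmod t5 < 1)%R ->
  is_mean (beta_kernel t0 t1 t2 t3 t4 t5) 1 (mean (beta_kernel t0 t1 t2 t3 t4 t5) 1).
Proof.
move=> *; have tB := tame_one.
have H := inH_beta_kernel (eq (RtoC 1)) (fun _ => t0) (fun _ => t1) (fun _ => t2) (fun _ => t3)
  (fun _ => t4) (fun _ => t5) tB.
by apply: (inH_is_mean _ _ tame_unit_circle _ _ _ (H _ _ _ _ _ _) erefl unit_circle_circ1); exact: small_param_const.
Qed.

Lemma Cmod_pair (x y w : C) : x * y * w = p -> (Cmod w < 1)%R -> (Cmod p < Cmod (x * y))%R.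
Proof.
move=> E w1; have p0 := Cmod_p_gt0 p hp0.
rewrite -E (Cmod_mult (x * y)) in p0 *.
have := Cmod_ge_0 (x * y); have := Cmod_ge_0 w; nra.
Qed.

Lemma Cmod_mul4_lt1 (x y z w : C) : (Cmod x < 1)%R -> (Cmod y < 1)%R -> (Cmod z < 1)%R ->
  (Cmod w < 1)%R -> (Cmod (x * y * z * w) < 1)%R.
Proof. by move=> *; do 3 (apply: Cmod_mul_lt1 => //). Qed.

Lemma inv_egamma_mulq (x : C) : (Cmod p < Cmod x < 1)%R -> iG x = theta p x * iG (q * x).
Proof.
move=> [x1 x2]; have x0 : x <> 0 by apply: Cmod_neq0; have := Cmod_ge_0 p; lra.
rewrite egamma_mulq // CinvM Cmult_assoc Cinv_r ?Cmult_1_l //; exact: theta_neq0.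
Qed.

Section Shift.
Variables t0 a b c d s5 : C.
Hypothesis bal : t0 * a * b * c * d * s5 = p.
Hypotheses (lt0 : (Cmod t0 < 1)%R) (lta : (Cmod a < 1)%R) (ltb : (Cmod b < 1)%R)
  (ltc : (Cmod c < 1)%R) (ltd : (Cmod d < 1)%R) (l5 : (Cmod s5 < Cmod t0)%R)
  (l5p : (Cmod p < Cmod s5 * Cmod s5)%R).

Let lt5 : (Cmod s5 < 1)%R. Proof. lra. Qed.

Let nz : t0 <> 0 /\ a <> 0 /\ b <> 0 /\ c <> 0 /\ d <> 0 /\ s5 <> 0.
Proof. by repeat split; move=> H; apply: hp0; rewrite -bal H; ring. Qed.

Definition shift_factor (s z : C) : C := G (q * s * z) * G (s * / z).
(* Antisymmetric under z -> 1 / (q z): hence its values at z and 1 / z add up to a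
   q-difference, whose mean over the unit circle vanishes. *)
Definition shift_fun (z : C) : C :=
  shift_factor t0 z * shift_factor a z * shift_factor b z * shift_factor c z * shift_factor d z * shift_factor s5 z * theta q (/ z ^ 2) * / z.

Definition ann_q (z : C) : Prop := (1 <= Cmod z <= / Cmod q)%R.

Lemma tame_ann_q : tame ann_q. Proof. exact: tame_ann Rlt_0_1. Qed.

(** On 1 <= |z| <= 1 / |q| both q s z and s / z have modulus at most |s|; the annulus is exactly as
    wide as the shift by q. *)
Lemma inH_shift_factor (s : C) : (Cmod s < 1)%R -> s <> 0 -> inH ann_q (eq (RtoC 1)) (fun z _ => shift_factor s z).
Proof.
move=> s1 s0; have tA := tame_ann_q; have tB := tame_one.
have Hz := inH_z ann_q (eq (RtoC 1)); have Hz' := inH_zinv ann_q (eq (RtoC 1)).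
have q0 : (0 < Cmod q)%R by exact/Cmod_gt_0.
apply: inH_mul => //.
  apply: (inH_egamma _ _ _ (Cmod s)) => //; first exact: inH_scal.
  - by apply: inH_ext (inH_scal _ _ tA tB (/ (q * s)) _ Hz') => z u _ _; rewrite !CinvM.
  - by split=> //; exact: Cmod_ge_0.
  move=> z u [z1 z2] _; rewrite !Cmod_mult.
  have H : (Cmod q * Cmod z <= 1)%R.
    have -> : (1 = Cmod q * / Cmod q)%R by field; lra.
    by apply: Rmult_le_compat_l; lra.
  have := Cmod_ge_0 s; nra.
apply: (inH_egamma _ _ _ (Cmod s)) => //; first exact: inH_scal.
- by apply: inH_ext (inH_scal _ _ tA tB (/ s) _ Hz) => z u _ _; rewrite CinvM CinvK.
- by split=> //; exact: Cmod_ge_0.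
move=> z u [z1 z2] _; rewrite Cmod_mult Cmod_inv'.
have : (/ Cmod z <= 1)%R by rewrite -Rinv_1; apply: Rinv_le_contravar; lra.
have := Cmod_ge_0 s; nra.
Qed.

Lemma inH_shift_fun : inH ann_q (eq (RtoC 1)) (fun z _ => shift_fun z).
Proof.
have tA := tame_ann_q; have tB := tame_one; have [? [? [? [? [? ?]]]]] := nz.
apply: inH_mul => //; last exact: inH_zinv.
apply: inH_mul => //; last first.
  apply: inH_theta => //.
    by apply: inH_ext (inH_pow _ _ tA tB _ 2 (inH_zinv _ _)) => z u _ _; exact: Cpow_inv'.
  by apply: inH_ext (inH_pow _ _ tA tB _ 2 (inH_z _ _)) => z u _ _; rewrite CinvK.
by do 5 (apply: inH_mul => //; last exact: inH_shift_factor); exact: inH_shift_factor.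
Qed.

Lemma shift_fun_mean : is_mean (fun z => shift_fun z + shift_fun (/ z)) 1 0.
Proof.
have q0 : (0 < Cmod q)%R by exact/Cmod_gt_0.
have iq : (1 < / Cmod q)%R by rewrite -Rinv_1; apply: Rinv_lt_contravar; lra.
have c1 : circ ann_q 1 by move=> z; rewrite Cmod_1 /ann_q => ->; lra.
have cq : circ ann_q (/ q) by move=> z; rewrite Cmod_inv' /ann_q => ->; lra.
have M1 := inH_is_mean _ _ tame_ann_q _ _ _ inH_shift_fun erefl c1.
have M2 := inH_is_mean _ _ tame_ann_q _ _ _ inH_shift_fun erefl cq.
rewrite (mean_indep _ _ tame_ann_q _ _ _ _ inH_shift_fun erefl cq c1) in M2.
have M3 : is_mean (fun z => shift_fun (/ q * z)) 1 (mean shift_fun 1).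
  move: M2; rewrite /is_mean; apply: is_RInt_ext => t _; by rewrite Cmult_1_l.
have := is_mean_sub _ _ _ _ _ M1 M3.
have -> : mean shift_fun 1 - mean shift_fun 1 = 0 by ring.
apply: is_mean_ext => z; rewrite Cmod_1 => z1.
have z0 := circle_neq0 z z1.
have z20 : / z ^ 2 <> 0 by apply: Cinv_neq0; exact: Cpow_nz.
have z20' : z ^ 2 <> 0 by exact: Cpow_nz.
(* The means over |z| = 1 and |z| = 1 / |q| agree by Cauchy's theorem, so
   [shift_fun z - shift_fun (z / q)] has mean 0; antisymmetry turns the minus into a plus. *)
suff -> : shift_fun (/ q * z) = - shift_fun (/ z) by ring.
rewrite /shift_fun /shift_factor.
have e1 s : q * s * (/ q * z) = s * z by field.
have e2 s : s * / (/ q * z) = q * s * / z by field.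
have e3 : / (/ q * z) ^ 2 = q * (q * / z ^ 2) by rewrite /=; field.
rewrite !e1 !e2 e3 !theta_mulp //; last exact: Cmult_neq_0.
rewrite !CinvK.
have -> : (/ z) ^ 2 = / z ^ 2 by exact: Cpow_inv'.
rewrite theta_inv // CinvK /=; field; by split.
Qed.

Lemma beta_kernel_shift z : Cmod z = 1%R ->
  theta_pairs p a b c d s5 * beta_kernel (q * t0) a b c d s5 z - theta_pairs p a b c d t0 * beta_kernel t0 a b c d (q * s5) z =
  - t0 * theta p (s5 / t0) * (shift_fun z + shift_fun (/ z)).
Proof.
move=> z1; have z0 := circle_neq0 z z1; have [? [? [? [? [? ?]]]]] := nz.
have Az : ann_p p z by apply: (circ1 p hp0 hp); rewrite Cmod_1.
have := theta_identity p hp0 hp t0 s5 a b c d _ _ _ _ _ _ bal lt0 l5 l5p z Az.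
move=> /(_ ltac:(done) ltac:(done) ltac:(done) ltac:(done) ltac:(done) ltac:(done)).
have gz (s : C) : s <> 0 -> (Cmod s < 1)%R -> G (q * s * z) = theta p (s * z) * G (s * z).
  move=> s0 s1; rewrite -egamma_mulq //; first by rewrite Cmult_assoc.
    exact: Cmult_neq_0.
  by rewrite Cmod_mult z1; lra.
have gz' (s : C) : s <> 0 -> (Cmod s < 1)%R -> G (q * s * / z) = theta p (s / z) * G (s * / z).
  move=> s0 s1; rewrite -egamma_mulq //; first by rewrite -Cmult_assoc.
    by apply: Cmult_neq_0 => //; exact: Cinv_neq0.
  by rewrite Cmod_mult Cmod_inv' z1 Rinv_1; lra.
rewrite /beta_kernel /gamma_pm /shift_fun /shift_factor !CinvK !gz // !gz' // Cpow_inv' CinvK /inv_gamma_pm2.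
have z20 : z ^ 2 <> 0 by exact: Cpow_nz.
rewrite (theta_inv q (z ^ 2)) // /theta_base /theta_diff /theta_prod /theta_prod_inv.
set T0 := theta_pairs _ _ _ _ _ _; set T5 := theta_pairs _ _ _ _ _ _.
move=> E.
pose GG := G (t0 * z) * G (t0 * / z) * G (a * z) * G (a * / z) * G (b * z) * G (b * / z) *
  G (c * z) * G (c * / z) * G (d * z) * G (d * / z) * G (s5 * z) * G (s5 * / z).
(* The prefactor is theta(z^(-2); q) / z: it completes the z theta(z^2; p) of [theta_base] to
   [inv_gamma_pm2], and [GG] supplies the unshifted gammas. *)
have := congr1 (fun x => (- / z ^ 2 * theta q (z ^ 2) / z) * GG * x) E.
rewrite Cmult_0_r => {}E.
set k := t0 * theta p (s5 / t0) in E *.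
apply: esym; rewrite -[LHS]Cplus_0_r -E /GG /k; field; exact: z0.
Qed.

(** The pair (t0, s5) contributes q t0 s5 on both sides and pairs among a, b, c, d do not change. In
    the mixed pairs Gamma(q x) = theta(x; p) Gamma(x) raises the unshifted argument; it applies
    because the complementary product has modulus below 1, so |p| < |x|. *)
Lemma inv_gamma_prod_shift : exists X,
  inv_gamma_prod (q * t0) a b c d s5 = theta_pairs p a b c d s5 * X /\ inv_gamma_prod t0 a b c d (q * s5) = theta_pairs p a b c d t0 * X.
Proof.
have sh (x y w : C) : x * y * w = p -> (Cmod x < 1)%R -> (Cmod y < 1)%R -> (Cmod w < 1)%R ->
    iG (x * y) = theta p (x * y) * iG (q * (x * y)).
  move=> E x1 y1 w1; apply: inv_egamma_mulq; split; first exact: Cmod_pair E w1.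
  exact: Cmod_mul_lt1.
exists (iG (q * (t0 * a)) * iG (q * (t0 * b)) * iG (q * (t0 * c)) * iG (q * (t0 * d)) * iG (q * (t0 * s5)) *
  (iG (q * (s5 * a)) * iG (q * (s5 * b)) * iG (q * (s5 * c)) * iG (q * (s5 * d))) *
  (iG (a * b) * iG (a * c) * iG (a * d) * iG (b * c) * iG (b * d) * iG (c * d))).
split.
  rewrite /inv_gamma_prod /theta_pairs !(Cmult_comm _ s5).
  rewrite (sh s5 a (t0 * b * c * d)) ?(sh s5 b (t0 * a * c * d)) ?(sh s5 c (t0 * a * b * d))
    ?(sh s5 d (t0 * a * b * c)) //; try (exact: Cmod_mul4_lt1); try (by rewrite -bal; ring).
  have e x : q * t0 * x = q * (t0 * x) by rewrite Cmult_assoc.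
  have e' : s5 * (q * t0) = q * (s5 * t0) by ring.
  by rewrite !e e'; ring.
rewrite /inv_gamma_prod /theta_pairs.
rewrite (sh t0 a (s5 * b * c * d)) ?(sh t0 b (s5 * a * c * d)) ?(sh t0 c (s5 * a * b * d))
    ?(sh t0 d (s5 * a * b * c)) //; try (exact: Cmod_mul4_lt1); try (by rewrite -bal; ring).
have e x : x * (q * s5) = q * (s5 * x) by ring.
by rewrite !e (Cmult_comm s5 t0); ring.
Qed.

(** The factors [theta_pairs] attached to the integrals are exactly those produced by the gamma
    products, so they match without any division. *)
Lemma norm_beta_shift : norm_beta (q * t0) a b c d s5 = norm_beta t0 a b c d (q * s5).
Proof.
have [X [E1 E2]] := inv_gamma_prod_shift.
have lq (x : C) : (Cmod x < 1)%R -> (Cmod (q * x) < 1)%R by exact: Cmod_mul_lt1.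
have M1 := beta_kernel_is_mean (q * t0) a b c d s5 (lq _ lt0) lta ltb ltc ltd lt5.
have M2 := beta_kernel_is_mean t0 a b c d (q * s5) lt0 lta ltb ltc ltd (lq _ lt5).
have M3 := is_mean_sub _ _ _ _ _ (is_mean_scal _ _ _ (theta_pairs p a b c d s5) M1)
  (is_mean_scal _ _ _ (theta_pairs p a b c d t0) M2).
have M4 := is_mean_scal _ _ _ (- t0 * theta p (s5 / t0)) shift_fun_mean.
rewrite Cmult_0_r in M4.
have E : theta_pairs p a b c d s5 * mean (beta_kernel (q * t0) a b c d s5) 1 -
    theta_pairs p a b c d t0 * mean (beta_kernel t0 a b c d (q * s5)) 1 = 0.
  apply: (is_mean_unique _ _ _ _ M3); apply: is_mean_ext M4 => z; rewrite Cmod_1 => z1.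
  by rewrite beta_kernel_shift.
rewrite /norm_beta E1 E2.
have comm (m T : C) : m * (T * X) = (T * m) * X by ring.
rewrite !comm.
apply: (f_equal (fun y => y * X)).
by rewrite -[RHS]Cplus_0_l -E; ring.
Qed.

End Shift.
End NormBeta.

(** * Constancy in the parameters *)

Section Const.
Variables p q : C.
Hypotheses (hp0 : p <> 0) (hq0 : q <> 0) (hp : (Cmod p < 1)%R) (hq : (Cmod q < 1)%R).

Local Notation J := (norm_beta p q).

Lemma small_param_mul B f g : tame B -> small_param B f -> small_param B g -> small_param B (fun u => f u * g u).
Proof.
move=> tB [Hf Hf' [R0 R01 fR]] [Hg Hg' [R1 R11 gR]]; have tA := tame_unit_circle; split.
- exact: inH_mul.
- by apply: inH_ext (inH_mul _ _ tA tB _ _ Hf' Hg') => z u _ _; rewrite CinvM.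
exists (R0 * R1)%R; first nra.
move=> u Bu; rewrite Cmod_mult; apply: Rmult_le_compat; auto; exact: Cmod_ge_0.
Qed.

(** Here [w] stands for the product of the other four parameters. By balancing it is p q / (f g),
    the argument that governs the poles of 1 / Gamma(f g). *)
Lemma inH_inv_egamma_pair B f g w : tame B -> small_param B f -> small_param B g -> small_param B w ->
  (forall u, B u -> f u * g u * w u = p * q) ->
  inH B unit_circle (fun u _ => / egamma p q (f u * g u)).
Proof.
move=> tB Hf Hg [_ _ [R0 R01 wR]] E; have tA := tame_unit_circle.
have [H1 H2 _] := small_param_mul _ _ _ tB Hf Hg.
apply: (inH_swap unit_circle B (fun _ u => / egamma p q (f u * g u))).
apply: (inH_inv_egamma p q hp hq _ _ (fun _ u => f u * g u) R0) => // z u _ Bu.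
have fg0 : f u * g u <> 0.
  move=> H; have := E u Bu; rewrite H Cmult_0_l => /esym; exact: Cmult_neq_0.
have -> : p * q * / (f u * g u) = w u by rewrite -(E u Bu); field; split=> H; apply: fg0; rewrite H; ring.
exact: wR.
Qed.

Lemma inH_norm_beta B f0 f1 f2 f3 f4 f5 : tame B ->
  small_param B f0 -> small_param B f1 -> small_param B f2 -> small_param B f3 -> small_param B f4 -> small_param B f5 ->
  (forall u, B u -> f0 u * f1 u * f2 u * f3 u * f4 u * f5 u = p * q) ->
  inH B unit_circle (fun u _ => J (f0 u) (f1 u) (f2 u) (f3 u) (f4 u) (f5 u)).
Proof.
move=> tB g0 g1 g2 g3 g4 g5 E; have tA := tame_unit_circle.
have g4m f g h k : small_param B f -> small_param B g -> small_param B h -> small_param B k ->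
    small_param B (fun u => f u * g u * h u * k u).
  by move=> *; do 3 (apply: small_param_mul => //).
apply: inH_mul => //.
  exact: (inH_mean _ _ tA _ _ unit_circle (inH_beta_kernel p q hp hq B f0 f1 f2 f3 f4 f5 tB g0 g1 g2 g3 g4 g5) unit_circle_circ1).
have pr f g h k l m : small_param B f -> small_param B g -> small_param B h -> small_param B k -> small_param B l -> small_param B m ->
    (forall u, B u -> f u * g u * (h u * k u * l u * m u) = p * q) ->
    inH B unit_circle (fun u _ => / egamma p q (f u * g u)).
  move=> *; apply: (inH_inv_egamma_pair B f g (fun u => h u * k u * l u * m u)) => //; exact: g4m.
have e x y : y = p * q -> x = y -> x = p * q by move=> -> ->.
repeat apply: inH_mul => //;
  [ apply: (pr _ _ f2 f3 f4 f5) | apply: (pr _ _ f1 f3 f4 f5) | apply: (pr _ _ f1 f2 f4 f5)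
  | apply: (pr _ _ f1 f2 f3 f5) | apply: (pr _ _ f1 f2 f3 f4) | apply: (pr _ _ f0 f3 f4 f5)
  | apply: (pr _ _ f0 f2 f4 f5) | apply: (pr _ _ f0 f2 f3 f5) | apply: (pr _ _ f0 f2 f3 f4)
  | apply: (pr _ _ f0 f1 f4 f5) | apply: (pr _ _ f0 f1 f3 f5) | apply: (pr _ _ f0 f1 f3 f4)
  | apply: (pr _ _ f0 f1 f2 f5) | apply: (pr _ _ f0 f1 f2 f4) | apply: (pr _ _ f0 f1 f2 f3) ] => // u Bu;
  apply: e (E u Bu) _; ring.
Qed.

Lemma small_param_id al be : (0 < al)%R -> (be < 1)%R -> small_param (fun u => al <= Cmod u <= be)%R (fun u => u).
Proof.
move=> al0 be1; split; [exact: inH_u|exact: inH_uinv|].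
exists (Rmax be 0); first by split; [exact: Rmax_r|apply: Rmax_lub_lt; lra].
by move=> u [_ ub]; apply: Rle_trans (Rmax_l _ _).
Qed.

Lemma small_param_inv al be (c : C) : (0 < al)%R -> (Cmod c < al)%R ->
  small_param (fun u => al <= Cmod u <= be)%R (fun u => c / u).
Proof.
move=> al0 cal; have tA := tame_unit_circle; have tB := tame_ann al be al0; split.
- by apply: inH_scal => //; exact: inH_uinv.
- apply: inH_ext (inH_scal _ _ tA tB (/ c) _ (inH_u _ _)) => z u _ _.
  by rewrite /Cdiv CinvM CinvK.
have c0 := Cmod_ge_0 c.
have i0 : (0 < / al)%R by exact: Rinv_0_lt_compat.
exists (Cmod c * / al)%R.
  split; first nra.
  by apply: (Rmult_lt_reg_r al) => //; rewrite Rmult_assoc Rinv_l; lra.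
move=> u [u1 u2]; rewrite Cmod_mult Cmod_inv'; apply: Rmult_le_compat_l => //.
exact: Rinv_le_contravar.
Qed.

Lemma inH_norm_beta_pair al be t1 t2 t3 t4 (c : C) : (0 < al)%R -> (be < 1)%R -> (Cmod c < al)%R ->
  (Cmod t1 < 1)%R -> (Cmod t2 < 1)%R -> (Cmod t3 < 1)%R -> (Cmod t4 < 1)%R ->
  c * t1 * t2 * t3 * t4 = p * q ->
  inH (fun u => al <= Cmod u <= be)%R unit_circle (fun u _ => J u t1 t2 t3 t4 (c / u)).
Proof.
move=> al0 be1 cal l1 l2 l3 l4 E; have tB := tame_ann al be al0.
apply: (inH_norm_beta _ (fun u => u) (fun _ => t1) (fun _ => t2) (fun _ => t3) (fun _ => t4) (fun u => c / u)) => //;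
  try exact: small_param_const.
- exact: small_param_id.
- exact: small_param_inv.
move=> u [u1 _]; rewrite -E; field; apply: Cmod_neq0; lra.
Qed.

Lemma norm_beta_pair_const t1 t2 t3 t4 (c x y : C) :
  (Cmod t1 < 1)%R -> (Cmod t2 < 1)%R -> (Cmod t3 < 1)%R -> (Cmod t4 < 1)%R ->
  c * t1 * t2 * t3 * t4 = p * q -> (Cmod c < Cmod q)%R ->
  (Cmod c < Cmod x < 1)%R -> (Cmod c < Cmod y < 1)%R ->
  J x t1 t2 t3 t4 (c / x) = J y t1 t2 t3 t4 (c / y).
Proof.
move=> l1 l2 l3 l4 E cq [x1 x2] [y1 y2].
have p0 := Cmod_p_gt0 p hp0; have q0 : (0 < Cmod q)%R by exact/Cmod_gt_0.
have cn : c <> 0.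
  move=> H; move: E; rewrite H !Cmult_0_l => /esym; exact: Cmult_neq_0.
have c0 : (0 < Cmod c)%R by exact/Cmod_gt_0.
(* The modulus of t0 s5, where t0 = z and s5 = c / (q z); the assumption |c| < |q| says m < 1. *)
pose m := (Cmod c / Cmod q)%R.
have m0 : (0 < m)%R by apply: Rdiv_lt_0_compat.
have cE : (Cmod c = m * Cmod q)%R by rewrite /m; field; lra.
have m1 : (m < 1)%R by apply: (Rmult_lt_reg_r (Cmod q)) => //; rewrite -cE; lra.
have pm : (Cmod p < m)%R.
  apply: (Rmult_lt_reg_r (Cmod q)) => //; rewrite -cE -Cmod_mult -E.
  have -> : c * t1 * t2 * t3 * t4 = c * (t1 * t2 * t3 * t4) by ring.
  rewrite Cmod_mult; have := Cmod_mul4_lt1 t1 t2 t3 t4 l1 l2 l3 l4; nra.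
have mp : (m < m * m / Cmod p)%R.
  by apply: (Rmult_lt_reg_r (Cmod p)) => //; rewrite /Rdiv Rmult_assoc Rinv_l; [nra|lra].
(* On the circle |z| = r with r^2 = s, [norm_beta_shift] has |t0| = r and |s5| = m / r. Then m < s
   gives |s5| < |t0|, and s < m^2 / |p| gives |p| < |s5|^2. Such an s exists because |p| < m, by
   balancing. *)
pose s := ((m + Rmin 1 (m * m / Cmod p)) / 2)%R.
have mm : (m < Rmin 1 (m * m / Cmod p))%R by exact: Rmin_glb_lt.
have sm : (m < s)%R by rewrite /s; lra.
have s1 : (s < 1)%R by rewrite /s; have := Rmin_l 1 (m * m / Cmod p); lra.
have sp : (s < m * m / Cmod p)%R by rewrite /s; have := Rmin_r 1 (m * m / Cmod p); lra.
have sp' : (s * Cmod p < m * m)%R.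
  have := Rmult_lt_compat_r _ _ _ p0 sp; rewrite /Rdiv Rmult_assoc Rinv_l; lra.
pose r := sqrt s.
have rr : (r * r = s)%R by apply: sqrt_sqrt; lra.
have r0 : (0 < r)%R by apply: sqrt_lt_R0; lra.
have r1 : (r < 1)%R by nra.
pose al := Rmin (Rmin (Cmod x) (Cmod y)) (Cmod q * r)%R.
pose be := Rmax (Rmax (Cmod x) (Cmod y)) r.
have cal : (Cmod c < al)%R by apply: Rmin_glb_lt; [exact: Rmin_glb_lt|rewrite cE; nra].
have be1 : (be < 1)%R by do 2 (apply: Rmax_lub_lt => //).
have al0 : (0 < al)%R by lra.
have HJ := inH_norm_beta_pair al be t1 t2 t3 t4 c al0 be1 cal l1 l2 l3 l4 E.
have a1 : (al <= Cmod x)%R := Rle_trans _ _ _ (Rmin_l _ _) (Rmin_l _ _).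
have a2 : (al <= Cmod y)%R := Rle_trans _ _ _ (Rmin_l _ _) (Rmin_r _ _).
have a3 : (al <= Cmod q * r)%R := Rmin_r _ _.
have b1 : (Cmod x <= be)%R := Rle_trans _ _ _ (Rmax_l _ _) (Rmax_l _ _).
have b2 : (Cmod y <= be)%R := Rle_trans _ _ _ (Rmax_r _ _) (Rmax_l _ _).
have b3 : (r <= be)%R := Rmax_r _ _.
have rm : Cmod (RtoC r) = r by rewrite Cmod_R Rabs_pos_eq; lra.
have cst w : (al <= Cmod w <= be)%R -> J w t1 t2 t3 t4 (c / w) =
    mean (fun u => J u t1 t2 t3 t4 (c / u)) (RtoC r); last by rewrite !cst.
move=> Aw; apply: (qperiodic_const _ _ (tame_ann al be al0) tame_unit_circle
  (fun u _ => J u t1 t2 t3 t4 (c / u)) 1 q (RtoC r) w HJ) => //.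
- by rewrite /unit_circle Cmod_1; lra.
- by move=> z; rewrite rm => ->; split=> //; nra.
- by move=> z; rewrite Cmod_mult rm => ->; split=> //; nra.
- by move=> z ->.
move=> z; rewrite rm => zr.
have z0 : z <> 0 by apply: Cmod_neq0; lra.
have sE : Cmod (c / (q * z)) = (m / r)%R.
  rewrite Cmod_div; last exact: Cmult_neq_0.
  by rewrite Cmod_mult zr cE; field; lra.
have -> : c / z = q * (c / (q * z)) by field.
have mr : (m / r < r)%R.
  by apply: (Rmult_lt_reg_r r) => //; rewrite /Rdiv Rmult_assoc Rinv_l; lra.
have mr' : (Cmod p < m / r * (m / r))%R.
  apply: (Rmult_lt_reg_r s); first lra.
  have -> : (m / r * (m / r) * s = m * m)%R by rewrite -rr; field; lra.
  lra.
apply: norm_beta_shift => //; rewrite ?sE ?zr //.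
rewrite -[RHS]Cmult_1_r -(Cinv_r q hq0) Cmult_assoc -E; field; by split.
Qed.

Lemma norm_beta_pair_ident t1 t2 t3 t4 (c x k : C) (r : R) :
  (Cmod t1 < 1)%R -> (Cmod t2 < 1)%R -> (Cmod t3 < 1)%R -> (Cmod t4 < 1)%R ->
  c * t1 * t2 * t3 * t4 = p * q ->
  (Cmod c < Cmod x < 1)%R -> (Cmod c < r < 1)%R ->
  (forall u, Cmod u = r -> J u t1 t2 t3 t4 (c / u) = k) ->
  J x t1 t2 t3 t4 (c / x) = k.
Proof.
move=> l1 l2 l3 l4 E [x1 x2] [r1 r2] H; have c0 := Cmod_ge_0 c.
pose al := Rmin (Cmod x) r; pose be := Rmax (Cmod x) r.
have cal : (Cmod c < al)%R by apply: Rmin_glb_lt.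
have be1 : (be < 1)%R by apply: Rmax_lub_lt.
have al0 : (0 < al)%R by lra.
have HJ := inH_norm_beta_pair al be t1 t2 t3 t4 c al0 be1 cal l1 l2 l3 l4 E.
have rm : Cmod (RtoC r) = r by rewrite Cmod_R Rabs_pos_eq; lra.
apply: (identity_const _ _ (tame_ann al be al0) tame_unit_circle
  (fun u _ => J u t1 t2 t3 t4 (c / u)) 1 (RtoC r) x k HJ).
- by rewrite /unit_circle Cmod_1; lra.
- by move=> z; rewrite rm => ->; split; [exact: Rmin_r|exact: Rmax_r].
- by move=> z ->; split; [exact: Rmin_l|exact: Rmax_l].
by move=> z; rewrite rm; exact: H.
Qed.

Lemma mean_ext f g w : (forall z, f z = g z) -> mean f w = mean g w.
Proof.
move=> fg; rewrite /mean; congr Cmult.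
by apply: (@RInt_ext C_R_CompleteNormedModule) => t _; rewrite fg.
Qed.

(* The sixth parameter is eliminated by the balancing condition. *)
Definition norm_beta5 (t0 t1 t2 t3 t4 : C) : C := J t0 t1 t2 t3 t4 (p * q / (t0 * t1 * t2 * t3 * t4)).

Lemma norm_beta5_swap01 t0 t1 t2 t3 t4 : norm_beta5 t0 t1 t2 t3 t4 = norm_beta5 t1 t0 t2 t3 t4.
Proof.
rewrite /norm_beta5 (Cmult_comm t1 t0); set t5 := p * q / _.
apply: (f_equal2 Cmult); first by apply: mean_ext => z; rewrite /beta_kernel; ring.
by rewrite /inv_gamma_prod (Cmult_comm t1 t0); ring.
Qed.

Lemma norm_beta5_swap12 t0 t1 t2 t3 t4 : norm_beta5 t0 t1 t2 t3 t4 = norm_beta5 t0 t2 t1 t3 t4.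
Proof.
rewrite /norm_beta5; have -> : t0 * t2 * t1 * t3 * t4 = t0 * t1 * t2 * t3 * t4 by ring.
set t5 := p * q / _.
apply: (f_equal2 Cmult); first by apply: mean_ext => z; rewrite /beta_kernel; ring.
by rewrite /inv_gamma_prod (Cmult_comm t2 t1); ring.
Qed.

Lemma norm_beta5_swap23 t0 t1 t2 t3 t4 : norm_beta5 t0 t1 t2 t3 t4 = norm_beta5 t0 t1 t3 t2 t4.
Proof.
rewrite /norm_beta5; have -> : t0 * t1 * t3 * t2 * t4 = t0 * t1 * t2 * t3 * t4 by ring.
set t5 := p * q / _.
apply: (f_equal2 Cmult); first by apply: mean_ext => z; rewrite /beta_kernel; ring.
by rewrite /inv_gamma_prod (Cmult_comm t3 t2); ring.
Qed.

Lemma norm_beta5_swap34 t0 t1 t2 t3 t4 : norm_beta5 t0 t1 t2 t3 t4 = norm_beta5 t0 t1 t2 t4 t3.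
Proof.
rewrite /norm_beta5; have -> : t0 * t1 * t2 * t4 * t3 = t0 * t1 * t2 * t3 * t4 by ring.
set t5 := p * q / _.
apply: (f_equal2 Cmult); first by apply: mean_ext => z; rewrite /beta_kernel; ring.
by rewrite /inv_gamma_prod (Cmult_comm t4 t3); ring.
Qed.

(** Brings each parameter in turn to the first place, the only one that the following lemmas
    move. *)
Lemma norm_beta5_rot t0 t1 t2 t3 t4 : norm_beta5 t0 t1 t2 t3 t4 = norm_beta5 t1 t2 t3 t4 t0.
Proof. by rewrite norm_beta5_swap01 norm_beta5_swap12 norm_beta5_swap23 norm_beta5_swap34. Qed.

Lemma norm_beta5E (u t1 t2 t3 t4 : C) :
  norm_beta5 u t1 t2 t3 t4 = J u t1 t2 t3 t4 (p * q / (t1 * t2 * t3 * t4) / u).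
Proof.
rewrite /norm_beta5; congr (norm_beta p q u t1 t2 t3 t4 _).
by rewrite /Cdiv !CinvM; ring.
Qed.

Section Radius.
Variable r : R.
Hypotheses (r0 : (0 < r)%R) (r1 : (r < 1)%R) (rp : (Cmod p < r * r * r * r * r)%R).

Definition near1 (x : C) : Prop := (r <= Cmod x < 1)%R.

(** The condition |p| < r^5 is made for this: c = p q / (t1 t2 t3 t4) has |c| < r |q|. So |c| < |q|,
    as [norm_beta_pair_const] asks, and |c| < r <= |x|, |y|. *)
Lemma norm_beta5_move0 x y t1 t2 t3 t4 : near1 x -> near1 y ->
  near1 t1 -> near1 t2 -> near1 t3 -> near1 t4 -> norm_beta5 x t1 t2 t3 t4 = norm_beta5 y t1 t2 t3 t4.
Proof.
move=> [x1 x2] [y1 y2] [a1 b1] [a2 b2] [a3 b3] [a4 b4].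
have q0 : (0 < Cmod q)%R by exact/Cmod_gt_0.
have p0 := Cmod_p_gt0 p hp0.
have rr2 : (0 < r * r)%R by nra.
have rr3 : (0 < r * r * r)%R by nra.
have rr4 : (0 < r * r * r * r)%R by nra.
have T : (r * r * r * r <= Cmod (t1 * t2 * t3 * t4))%R.
  by rewrite !Cmod_mult; do 3 (apply: Rmult_le_compat => //; try lra).
have Tn : t1 * t2 * t3 * t4 <> 0 by apply: Cmod_neq0; lra.
have cB : (Cmod (p * q / (t1 * t2 * t3 * t4)) < r * Cmod q)%R.
  rewrite Cmod_div // Cmod_mult.
  apply: (Rmult_lt_reg_r (Cmod (t1 * t2 * t3 * t4))); first lra.
  rewrite /Rdiv Rmult_assoc Rinv_l; last lra.
  rewrite Rmult_1_r.
  have : (r * (r * r * r * r) <= r * Cmod (t1 * t2 * t3 * t4))%R by apply: Rmult_le_compat_l; lra.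
  nra.
rewrite !norm_beta5E; apply: norm_beta_pair_const => //; try lra; try (split; nra).
- field; by repeat split; move=> H; apply: Tn; rewrite H; ring.
nra.
Qed.

Lemma norm_beta5_const x0 x1 x2 x3 x4 y0 y1 y2 y3 y4 :
  near1 x0 -> near1 x1 -> near1 x2 -> near1 x3 -> near1 x4 ->
  near1 y0 -> near1 y1 -> near1 y2 -> near1 y3 -> near1 y4 ->
  norm_beta5 x0 x1 x2 x3 x4 = norm_beta5 y0 y1 y2 y3 y4.
Proof.
move=> *.
rewrite (norm_beta5_move0 x0 y0) // norm_beta5_rot (norm_beta5_move0 x1 y1) // norm_beta5_rot (norm_beta5_move0 x2 y2) //.
by rewrite norm_beta5_rot (norm_beta5_move0 x3 y3) // norm_beta5_rot (norm_beta5_move0 x4 y4) // norm_beta5_rot.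
Qed.

Lemma norm_beta5_lift0 (t0 t1 t2 t3 t4 k : C) :
  (Cmod t0 <= r)%R -> (Cmod t1 < 1)%R -> (Cmod t2 < 1)%R -> (Cmod t3 < 1)%R -> (Cmod t4 < 1)%R ->
  (Cmod (p * q) < Cmod (t0 * t1 * t2 * t3 * t4))%R ->
  (forall u : C, Cmod u = r -> norm_beta5 u t1 t2 t3 t4 = k) -> norm_beta5 t0 t1 t2 t3 t4 = k.
Proof.
move=> l0 l1 l2 l3 l4 B H.
have pq0 := Cmod_ge_0 (p * q).
have n0 : t0 * t1 * t2 * t3 * t4 <> 0 by apply: Cmod_neq0; lra.
have Tn : t1 * t2 * t3 * t4 <> 0 by move=> E; apply: n0; rewrite -!Cmult_assoc (Cmult_assoc t1) (Cmult_assoc (t1 * t2)) E; ring.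
have T0 : (0 < Cmod (t1 * t2 * t3 * t4))%R by exact/Cmod_gt_0.
have cB : (Cmod (p * q / (t1 * t2 * t3 * t4)) < Cmod t0)%R.
  rewrite Cmod_div //; apply: (Rmult_lt_reg_r (Cmod (t1 * t2 * t3 * t4))) => //.
  rewrite /Rdiv Rmult_assoc Rinv_l; last lra.
  rewrite Rmult_1_r -Cmod_mult.
  by have -> : t0 * (t1 * t2 * t3 * t4) = t0 * t1 * t2 * t3 * t4 by ring.
rewrite norm_beta5E; apply: (norm_beta_pair_ident _ _ _ _ _ _ _ r) => //; try (split; lra).
  field; by repeat split; move=> E; apply: Tn; rewrite E; ring.
by move=> u /H <-; rewrite norm_beta5E.
Qed.

(** The parameters are replaced one at a time by arbitrary ones of modulus [r]. Since moduli only
    increase, |t0 t1 t2 t3 t4| stays above |p q|, so the eliminated sixth parameter stays in the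
    unit disc. *)
Lemma norm_beta5_lift (t0 t1 t2 t3 t4 k : C) :
  (Cmod t0 <= r)%R -> (Cmod t1 <= r)%R -> (Cmod t2 <= r)%R -> (Cmod t3 <= r)%R -> (Cmod t4 <= r)%R ->
  (Cmod (p * q) < Cmod (t0 * t1 * t2 * t3 * t4))%R ->
  (forall x0 x1 x2 x3 x4, Cmod x0 = r -> Cmod x1 = r -> Cmod x2 = r -> Cmod x3 = r -> Cmod x4 = r ->
     norm_beta5 x0 x1 x2 x3 x4 = k) -> norm_beta5 t0 t1 t2 t3 t4 = k.
Proof.
move=> l0 l1 l2 l3 l4 B H.
have up (x u y : C) : (Cmod x <= r)%R -> Cmod u = r -> (Cmod (p * q) < Cmod (x * y))%R ->
    (Cmod (p * q) < Cmod (u * y))%R.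
  move=> xr ur; rewrite !(Cmod_mult _ y) ur => h; apply: Rlt_le_trans h _.
  by apply: Rmult_le_compat_r => //; exact: Cmod_ge_0.
have as5 (x y z v w : C) : x * y * z * v * w = x * (y * z * v * w) by ring.
have as5' (x y z v w : C) : x * (y * z * v * w) = y * z * v * w * x by ring.
apply: norm_beta5_lift0 => //; try lra.
move=> x0 E0; rewrite as5 in B; have {}B := up _ _ _ l0 E0 B; rewrite as5' in B.
rewrite norm_beta5_rot; apply: norm_beta5_lift0 => //; try lra.
move=> x1 E1; rewrite as5 in B; have {}B := up _ _ _ l1 E1 B; rewrite as5' in B.
rewrite norm_beta5_rot; apply: norm_beta5_lift0 => //; try lra.
move=> x2 E2; rewrite as5 in B; have {}B := up _ _ _ l2 E2 B; rewrite as5' in B.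
rewrite norm_beta5_rot; apply: norm_beta5_lift0 => //; try lra.
move=> x3 E3; rewrite as5 in B; have {}B := up _ _ _ l3 E3 B; rewrite as5' in B.
rewrite norm_beta5_rot; apply: norm_beta5_lift0 => //; try lra.
by move=> x4 E4; rewrite norm_beta5_rot; apply: H.
Qed.

End Radius.
End Const.

(** * Concentration of the Poisson kernel *)

Lemma sub_eq0 (x y : C) : x - y = 0 -> x = y.
Proof. by move=> H; have -> : x = x - y + y by [ring]; rewrite H Cplus_0_l. Qed.

Lemma Ci2 : Ci * Ci = - (1).
Proof. by rewrite /Ci /Cmult /Copp /=; congr pair; ring. Qed.

Lemma Ci_neq0 : Ci <> 0.
Proof. by apply: Cmod_neq0; rewrite Cmod_Ci; lra. Qed.

Lemma Cconj_circle z : Cmod z = 1%R -> Cconj z = / z.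
Proof.
move=> z1; have z0 := circle_neq0 z z1.
have := Cmod2_conj z; rewrite z1 pow1 => H.
have -> : Cconj z = / z * (z * Cconj z) by field.
by rewrite -H Cmult_1_r.
Qed.

(* Modulo 1 + z^2, a Laurent polynomial in z is the affine interpolant of its values at +-i. *)
Lemma lpoly_div P : lpoly P -> exists al be Q, lpoly Q /\
  forall z u : C, z <> 0 -> P z u = al u + be u * z + (1 + z ^ 2) * Q z u.
Proof.
elim=> {P} [c a b m n|P1 P2 _ [a1 [b1 [Q1 [H1 E1]]]] _ [a2 [b2 [Q2 [H2 E2]]]]]; last first.
  exists (fun u => a1 u + a2 u), (fun u => b1 u + b2 u), (fun z u => Q1 z u + Q2 z u).
  by split; [exact: lpoly_add|move=> z u z0; rewrite E1 // E2 //; ring].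
have L (al be : C) : exists k l Q, lpoly Q /\ forall (z : C) u, z <> 0 ->
    c * lmono a b m n z u = (k * (u ^ m * (/ u) ^ n)) + (l * (u ^ m * (/ u) ^ n)) * z + (1 + z ^ 2) * Q z u.
  elim: a => [|a [k [l [Q [HQ E]]]]].
    elim: b => [|b [k [l [Q [HQ E]]]]].
      exists c, 0, (fun z u => 0 * lmono 0 0 0 0 z u); split; first exact: lpoly_mono.
      by move=> z u z0; rewrite /lmono /=; ring.
    have [S HS SE] := lpoly_mul _ _ (lpoly_mono 1 0 1 0 0) HQ.
    exists l, (- k), (fun z u => S z u + k * lmono 0 1 m n z u); split.
      by apply: lpoly_add => //; exact: lpoly_mono.
    move=> z u z0; rewrite SE.
    have -> : c * lmono 0 b.+1 m n z u = / z * (c * lmono 0 b m n z u) by rewrite /lmono /=; ring.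
    by rewrite E // /lmono /=; field.
  have [S HS SE] := lpoly_mul _ _ (lpoly_mono 1 1 0 0 0) HQ.
  exists (- l), k, (fun z u => S z u + l * lmono 0 0 m n z u); split.
    by apply: lpoly_add => //; exact: lpoly_mono.
  move=> z u z0; rewrite SE.
  have -> : c * lmono a.+1 b m n z u = z * (c * lmono a b m n z u) by rewrite /lmono /=; ring.
  by rewrite E // /lmono /=; ring.
have [k [l [Q [HQ E]]]] := L 0 0.
by exists (fun u => k * (u ^ m * (/ u) ^ n)), (fun u => l * (u ^ m * (/ u) ^ n)), Q.
Qed.

Section Poisson.
Variable r : R.
Hypothesis r01 : (0 < r < 1)%R.

(** On |z| = 1, [poisson] is the Poisson kernel (1 - r^2) / |1 + r z^2|^2 ([poisson_real]), peaked
    at z = i and z = - i. The sum of two geometric series shows that it is in [inH] and that its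
    mean is 1. *)
Definition half_poisson (z : C) : C := / (1 - (- r * z ^ 2)).
Definition poisson (z : C) : C := half_poisson z + half_poisson (/ z) - 1.

Lemma half_poisson_neq0 (z : C) : (Cmod z <= 1)%R -> 1 - (- r * z ^ 2) <> 0.
Proof.
move=> z1; apply: sub1_neq0.
rewrite Cmod_mult Cmod_opp Cmod_R Cmod_pow Rabs_pos_eq; last lra.
have : (Cmod z ^ 2 <= 1)%R by have := Cmod_ge_0 z; rewrite /=; nra.
have := pow2_ge_0 (Cmod z); nra.
Qed.

Lemma inH_half_poisson (A B : C -> Prop) : tame A -> tame B -> (forall z, A z -> (Cmod z <= 1)%R) ->
  inH A B (fun z _ => half_poisson z).
Proof.
move=> tA tB A1; apply: (inH_geom _ _ tA tB (fun z _ => - r * z ^ 2) r).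
- by apply: inH_scal => //; apply: inH_pow => //; exact: inH_z.
- lra.
move=> z u /A1 z1 _; rewrite Cmod_mult Cmod_opp Cmod_R Cmod_pow Rabs_pos_eq; last lra.
have : (Cmod z ^ 2 <= 1)%R by have := Cmod_ge_0 z; rewrite /=; nra.
have := pow2_ge_0 (Cmod z); nra.
Qed.

Lemma unit_circle_le z : unit_circle z -> (Cmod z <= 1)%R. Proof. by case. Qed.

Lemma inH_poisson B : tame B -> inH unit_circle B (fun z _ => poisson z).
Proof.
move=> tB; have tA := tame_unit_circle.
apply: inH_sub => //; last exact: inH_const.
apply: inH_add; first by apply: inH_half_poisson => //; exact: unit_circle_le.
apply: (inH_geom _ _ tA tB (fun z _ => - r * (/ z) ^ 2) r).
- by apply: inH_scal => //; apply: inH_pow => //; exact: inH_zinv.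
- lra.
move=> z u [z1 z2] _; rewrite Cmod_mult Cmod_opp Cmod_R Cmod_pow Cmod_inv' Rabs_pos_eq; last lra.
have -> : Cmod z = 1%R by lra.
by rewrite Rinv_1 pow1; lra.
Qed.

Lemma mean_half_poisson : is_mean half_poisson 1 1.
Proof.
have tB := tame_one.
have M := inH_is_mean _ _ tame_unit_circle _ _ _ (inH_half_poisson _ _ tame_unit_circle tB unit_circle_le) erefl unit_circle_circ1.
suff E : mean half_poisson 1 = 1 by move: M; rewrite E.
apply: sub_eq0; apply: Cmod_le_eps0 => eps e0.
(* half_poisson is regular inside the disk: shrink the circle to the origin. *)
pose d := Rmin (1 / 2) (Rmin eps 1 * (1 - r)).
have m1 : (0 < Rmin eps 1 <= 1)%R by split; [apply: Rmin_glb_lt; lra|exact: Rmin_r].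
have m2 : (Rmin eps 1 <= eps)%R := Rmin_l _ _.
have d0 : (0 < d)%R by apply: Rmin_glb_lt; nra.
have d1 : (d <= 1 / 2)%R := Rmin_l _ _.
have d2 : (d <= Rmin eps 1 * (1 - r))%R := Rmin_r _ _.
have tD := tame_ann d 1 d0.
have dm : Cmod (RtoC d) = d by rewrite Cmod_R Rabs_pos_eq; lra.
have HD := inH_half_poisson _ (eq (RtoC 1)) tD tB (fun z H => proj2 H).
have c1 : circ (fun z => d <= Cmod z <= 1)%R 1 by move=> z; rewrite Cmod_1 => ->; lra.
have cd : circ (fun z => d <= Cmod z <= 1)%R d by move=> z; rewrite dm => ->; lra.
rewrite (mean_indep _ _ tD _ _ _ _ HD erefl c1 cd).
apply: (is_mean_close _ _ _ _ _ _ (inH_is_mean _ _ tD _ _ _ HD erefl cd) (is_mean_const 1 d)).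
move=> z; rewrite dm => zd.
have z1 : (Cmod z <= 1)%R by lra.
have n0 := half_poisson_neq0 z z1.
have -> : half_poisson z - 1 = - r * z ^ 2 * half_poisson z.
  have -> : half_poisson z - 1 = half_poisson z - half_poisson z * (1 - (- r * z ^ 2)).
    by congr Cminus; rewrite /half_poisson Cinv_l.
  ring.
rewrite Cmod_mult Cmod_mult Cmod_opp Cmod_R Cmod_pow zd Rabs_pos_eq; last lra.
rewrite /half_poisson Cmod_inv'.
have lo : (1 - r <= Cmod (1 - (- r * z ^ 2)))%R.
  have := Cmod_triangle (1 - (- r * z ^ 2)) (- r * z ^ 2).
  have -> : 1 - (- r * z ^ 2) + - r * z ^ 2 = 1 by ring.
  rewrite Cmod_1 Cmod_mult Cmod_opp Cmod_R Cmod_pow zd Rabs_pos_eq; last lra.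
  have : (r * d ^ 2 <= r * 1)%R by apply: Rmult_le_compat_l; rewrite /=; nra.
  lra.
apply: (Rle_trans _ (d * / (1 - r))%R).
  have rd : (0 <= r * d ^ 2 <= d)%R.
    have dd : (0 <= d * d <= d)%R by nra.
    by rewrite /= Rmult_1_r; nra.
  apply: Rmult_le_compat; try lra.
    by apply/Rlt_le/Rinv_0_lt_compat; lra.
  by apply: Rinv_le_contravar; lra.
apply: (Rmult_le_reg_r (1 - r)); first lra.
by rewrite Rmult_assoc Rinv_l; nra.
Qed.

Lemma mean_poisson : is_mean poisson 1 1.
Proof.
have tB := tame_one.
have E1 : / RtoC 1 = 1 by field.
have c1 : circ unit_circle (/ 1) by rewrite E1; exact: unit_circle_circ1.
have M := mean_inv _ _ tame_unit_circle _ _ _ (inH_half_poisson _ _ tame_unit_circle tB unit_circle_le) erefl unit_circle_circ1 c1.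
rewrite E1 (is_mean_mean _ _ _ mean_half_poisson) in M.
have := is_mean_sub _ _ _ _ _ (is_mean_add _ _ _ _ _ mean_half_poisson M) (is_mean_const 1 1).
by have -> : 1 + 1 - 1 = RtoC 1 by ring.
Qed.

Lemma poissonE z : Cmod z = 1%R ->
  (1 + r * z ^ 2) * (1 + r * / z ^ 2) * poisson z = 1 - r * r.
Proof.
move=> z1; have z0 := circle_neq0 z z1.
have n1 := half_poisson_neq0 z (Req_le _ _ z1).
have z1' : Cmod (/ z) = 1%R by rewrite Cmod_inv' z1 Rinv_1.
have n2 := half_poisson_neq0 (/ z) (Req_le _ _ z1').
rewrite /poisson /half_poisson.
have e1 : 1 + r * z ^ 2 = 1 - (- r * z ^ 2) by ring.
have e2 : 1 + r * / z ^ 2 = 1 - (- r * (/ z) ^ 2) by rewrite Cpow_inv'; ring.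
rewrite e1 e2.
have -> : RtoC 1 - r * r = (1 - (- r * z ^ 2)) + (1 - (- r * (/ z) ^ 2))
   - (1 - (- r * z ^ 2)) * (1 - (- r * (/ z) ^ 2)).
  by rewrite Cpow_inv'; field.
by move: (1 - _) (1 - _) n1 n2 => x y n1 n2; field.
Qed.

Lemma poisson_real z : Cmod z = 1%R ->
  poisson z = RtoC ((1 - r * r) / Cmod (1 + r * z ^ 2) ^ 2)%R.
Proof.
move=> z1; have z0 := circle_neq0 z z1.
have n1 : 1 + r * z ^ 2 <> 0.
  by have := half_poisson_neq0 z (Req_le _ _ z1); have -> : 1 - (- r * z ^ 2) = 1 + r * z ^ 2 by ring.
have c : Cconj (1 + r * z ^ 2) = 1 + r * / z ^ 2.
  have cR (x : R) : Cconj x = x by rewrite /Cconj /RtoC /= Ropp_0.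
  by rewrite Cplus_conj Cmult_conj Cpow_conj (Cconj_circle z) // Cpow_inv' !cR.
have m0 : (0 < Cmod (1 + r * z ^ 2))%R by exact/Cmod_gt_0.
have m2 : (Cmod (1 + r * z ^ 2) ^ 2 <> 0)%R by apply: pow_nonzero; lra.
rewrite RtoC_div // RtoC_minus RtoC_mult -(poissonE z z1) -c -Cmod2_conj.
field; by move=> /RtoC_inj.
Qed.

(** The kernel is positive with mean 1, so the first term contributes c1; times |1 + r z^2|^2 it is
    the constant 1 - r^2, which tends to 0 as r -> 1. *)
Lemma poisson_bound f v (c1 c2 : R) : (0 <= c1)%R -> (0 <= c2)%R ->
  is_mean (fun z => poisson z * f z) 1 v ->
  (forall z, Cmod z = 1%R -> (Cmod (f z) <= c1 + c2 * Cmod (1 + r * z ^ 2) ^ 2)%R) ->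
  (Cmod v <= c1 + c2 * (1 - r * r))%R.
Proof.
move=> c10 c20 Hv Hf.
have p0 := PI_RGT_0.
have H1 := @is_RInt_fct_extend_fst R_NormedModule R_NormedModule _ _ _ _ mean_poisson.
pose g := fun t => (c1 * fst (poisson (1 * expi t)) + c2 * (1 - r * r))%R.
have Hg : is_RInt g 0 (2 * PI) (2 * PI * (c1 + c2 * (1 - r * r)))%R.
  have -> : (2 * PI * (c1 + c2 * (1 - r * r)) =
    plus (scal c1 (fst (RtoC (2 * PI) * 1)%C)) (scal (2 * PI - 0) (c2 * (1 - r * r))))%R.
    by rewrite /plus /scal /= /mult /=; ring.
  apply: is_RInt_plus; last exact: is_RInt_const.
  exact: (is_RInt_scal _ _ _ c1 _ H1).
have := @norm_RInt_le C_R_NormedModule _ g 0 (2 * PI) _ _ _ _ Hv Hg.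
rewrite -Cmod_norm Cmod_mult Cmod_R Rabs_pos_eq; last lra.
move=> H; apply: (Rmult_le_reg_l (2 * PI)%R); first lra.
apply: H; first lra.
move=> t _; rewrite -Cmod_norm /g.
have t1 : Cmod (1 * expi t) = 1%R by rewrite Cmod_mult Cmod_1 Cmod_expi; ring.
move: (1 * expi t) t1 => z t1.
rewrite Cmod_mult poisson_real // Cmod_R /=.
have n0 : (0 < Cmod (1 + r * z ^ 2))%R.
  apply/Cmod_gt_0.
  by have := half_poisson_neq0 z (Req_le _ _ t1); have -> : 1 - (- r * z ^ 2) = 1 + r * z ^ 2 by ring.
have := Hf z t1; move: (Cmod (1 + _)) n0 => m n0.
set k := ((1 - r * r) / _)%R.
have kE : (k * m ^ 2 = 1 - r * r)%R by rewrite /k /=; field; lra.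
have k0 : (0 <= k)%R.
  by apply: Rmult_le_pos; [nra|apply/Rlt_le/Rinv_0_lt_compat; rewrite /=; nra].
rewrite Rabs_pos_eq // -kE => Hz.
by apply: Rle_trans (Rmult_le_compat_l _ _ _ k0 Hz) _; lra.
Qed.

(** The kernel is even and z is odd: starting the circle at -1 instead of 1 changes the sign of the
    mean. *)
Lemma mean_poisson_z : is_mean (fun z => poisson z * z) 1 0.
Proof.
have tA := tame_unit_circle; have tB := tame_one.
have H : inH unit_circle (eq (RtoC 1)) (fun z _ => poisson z * z).
  by apply: inH_mul => //; [exact: inH_poisson|exact: inH_z].
have cm : circ unit_circle (- (1)) by apply: unit_circle_circ; rewrite Cmod_opp Cmod_1.
have M1 := inH_is_mean _ _ tA _ _ _ H erefl unit_circle_circ1.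
have M2 := inH_is_mean _ _ tA _ _ _ H erefl cm.
rewrite (mean_indep _ _ tA _ _ _ _ H erefl cm unit_circle_circ1) in M2.
suff <- : mean (fun z => poisson z * z) 1 = 0 by exact: M1.
apply: Ceq_opp_eq0.
have M3 := is_mean_scal _ _ _ (- (1)) M1.
have -> : - mean (fun z => poisson z * z) 1 = - (1) * mean (fun z => poisson z * z) 1 by ring.
apply: (is_mean_unique _ _ _ _ _ M3); move: M2; rewrite /is_mean.
apply: is_RInt_ext => t _.
have pt z : poisson (- (1) * z) * (- (1) * z) = - (1) * (poisson (1 * z) * (1 * z)).
  rewrite /poisson /half_poisson !Cpow_inv'.
  have -> : (- (1) * z) ^ 2 = z ^ 2 by rewrite /=; ring.
  have -> : (1 * z) ^ 2 = z ^ 2 by rewrite /=; ring.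
  ring.
by rewrite pt.
Qed.

End Poisson.

(** Uniform in [u], because in [pinch] the parameters u = s and r = s^2 move together. By
    [lpoly_div] the affine part of an approximant has mean [al u], the average of its values at i
    and - i. The remainder carries the factor 1 + z^2, which is small where the kernel is large. *)
Lemma poisson_limit (B : C -> Prop) F : tame B -> inH unit_circle B F ->
  forall eps, (0 < eps)%R -> exists2 d, (0 < d < 1)%R & forall r u, (1 - d < r < 1)%R -> B u ->
    (Cmod (mean (fun z => poisson r z * F z u)%C 1 - (F Ci u + F (- Ci)%C u) / 2) <= eps)%R.
Proof.
move=> tB HF eps e0; have tA := tame_unit_circle.
have e4 : (0 < eps / 4)%R by lra.
have [P [HP PE]] := HF _ e4.
have [al [be [Q [HQ QE]]]] := lpoly_div _ HP.
have [[M M0 HM] _] := lpoly_blip _ _ tA tB _ HQ.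
(* AM-GM: |1 + r z^2| <= h / 2 + |1 + r z^2|^2 / (2 h) *)
pose h := (eps / (4 * (M + 1)))%R.
have h0 : (0 < h)%R by apply: Rdiv_lt_0_compat; lra.
have hM : (h * (M + 1) = eps / 4)%R by rewrite /h; field; lra.
(* With 1 - r <= h / 2 and 1 - r^2 <= 2 (1 - r) <= h^2, the contributions to |m3| add up to at most
   2 h M. *)
pose d := Rmin (1 / 2) (Rmin (h / 2) (h * h / 2)).
have d0 : (0 < d)%R by apply: Rmin_glb_lt; [lra|apply: Rmin_glb_lt; nra].
have d1 : (d <= 1 / 2)%R := Rmin_l _ _.
have d2 : (d <= h / 2)%R := Rle_trans _ _ _ (Rmin_r _ _) (Rmin_l _ _).
have d3 : (d <= h * h / 2)%R := Rle_trans _ _ _ (Rmin_r _ _) (Rmin_r _ _).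
exists d; first lra.
move=> r u rd Bu.
have r01 : (0 < r < 1)%R by lra.
have UC : unit_circle Ci by rewrite /unit_circle Cmod_Ci; lra.
have UC' : unit_circle (- Ci) by rewrite /unit_circle Cmod_opp Cmod_Ci; lra.
have HK := inH_poisson r r01 B tB.
have H1 : inH unit_circle B (fun z u => poisson r z * F z u) by exact: inH_mul.
have H2 : inH unit_circle B (fun z u => poisson r z * (F z u - P z u)).
  by apply: inH_mul => //; apply: inH_sub => //; exact: inH_lpoly.
have H3 : inH unit_circle B (fun z u => poisson r z * ((1 + z ^ 2) * Q z u)).
  apply: inH_mul => //; apply: inH_mul => //; last exact: inH_lpoly.
  by apply: inH_add; [exact: inH_const|apply: inH_pow => //; exact: inH_z].
have M1 := inH_is_mean _ _ tA _ _ _ H1 Bu unit_circle_circ1.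
have M2 := inH_is_mean _ _ tA _ _ _ H2 Bu unit_circle_circ1.
have M3 := inH_is_mean _ _ tA _ _ _ H3 Bu unit_circle_circ1.
set m1 := mean _ _ in M1 *; set m2 := mean _ _ in M2; set m3 := mean _ _ in M3.
have E : m1 = m2 + (al u * 1 + be u * 0 + m3).
  apply: (is_mean_unique _ _ _ _ M1).
  apply: is_mean_ext (is_mean_add _ _ _ _ _ M2 (is_mean_add _ _ _ _ _
    (is_mean_add _ _ _ _ _ (is_mean_scal _ _ _ (al u) (mean_poisson r r01))
       (is_mean_scal _ _ _ (be u) (mean_poisson_z r r01))) M3)).
  move=> z; rewrite Cmod_1 => z1; have z0 := circle_neq0 z z1.
  by rewrite (QE z u z0); ring.
have B2 : (Cmod m2 <= eps / 4)%R.
  have := poisson_bound r r01 _ _ (eps / 4) 0 _ _ M2.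
  rewrite Rmult_0_l Rplus_0_r; apply; try lra.
  move=> z z1; rewrite Rmult_0_l Rplus_0_r; apply: PE => //; rewrite /unit_circle; lra.
have B3 : (Cmod m3 <= M * (1 - r + h / 2) + M * / (2 * h) * (1 - r * r))%R.
  have ih : (0 < / (2 * h))%R by apply: Rinv_0_lt_compat; lra.
  have hm : (0 <= M * (1 - r + h / 2))%R by apply: Rmult_le_pos; lra.
  apply: (poisson_bound r r01 _ _ _ _ _ _ M3) => //; first by nra.
  move=> z z1; rewrite Cmod_mult Rmult_comm.
  have Uz : unit_circle z by rewrite /unit_circle; lra.
  apply: (Rle_trans _ (M * Cmod (1 + z ^ 2))%R).
    by apply: Rmult_le_compat_r; [exact: Cmod_ge_0|exact: HM].
  have -> : (M * (1 - r + h / 2) + M * / (2 * h) * Cmod (1 + r * z ^ 2) ^ 2 =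
    M * (1 - r + (h / 2 + / (2 * h) * Cmod (1 + r * z ^ 2) ^ 2)))%R by ring.
  apply: Rmult_le_compat_l => //.
  have -> : 1 + z ^ 2 = RtoC (1 - r) * z ^ 2 + (1 + r * z ^ 2) by rewrite RtoC_minus; ring.
  apply: Rle_trans (Cmod_triangle _ _) _.
  rewrite Cmod_mult Cmod_R Cmod_pow z1 pow1 Rabs_pos_eq; last lra.
  set y := Cmod (1 + r * z ^ 2).
  have : (0 <= / (2 * h) * (y - h) ^ 2)%R by apply: Rmult_le_pos; [lra|exact: pow2_ge_0].
  have -> : (/ (2 * h) * (y - h) ^ 2 = h / 2 + / (2 * h) * y ^ 2 - y)%R by field; lra.
  lra.
have B3' : (Cmod m3 <= eps / 4 * 2)%R.
  apply: Rle_trans B3 _.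
  have h1 : (1 - r * r <= h * h)%R by nra.
  have h2 : (/ (2 * h) * (1 - r * r) <= h / 2)%R.
    apply: (Rmult_le_reg_l (2 * h)); first lra.
    rewrite -Rmult_assoc Rinv_r; last lra.
    nra.
  have : (1 - r + h / 2 + / (2 * h) * (1 - r * r) <= 2 * h)%R by lra.
  nra.
have EC : P Ci u = al u + be u * Ci.
  have -> := QE Ci u Ci_neq0; rewrite /= Cmult_1_r Ci2; ring.
have EC' : P (- Ci) u = al u - be u * Ci.
  have nC : - Ci <> 0 by apply: Copp_neq0; exact: Ci_neq0.
  have -> := QE (- Ci) u nC.
  have -> : (- Ci) ^ 2 = - (1) by rewrite -Ci2 /=; ring.
  ring.
have D1 := PE Ci u UC Bu; have D2 := PE (- Ci) u UC' Bu.
have two : RtoC 2 <> 0 by move=> /RtoC_inj; lra.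
have -> : m1 - (F Ci u + F (- Ci) u) / 2 =
  m2 + (m3 + - ((F Ci u - P Ci u) / 2 + (F (- Ci) u - P (- Ci) u) / 2)).
  by rewrite E EC EC'; field.
apply: Rle_trans (Cmod_triangle _ _) _.
apply: Rle_trans (Rplus_le_compat_l _ _ _ (Cmod_triangle _ _)) _.
rewrite Cmod_opp.
have := Cmod_triangle ((F Ci u - P Ci u) / 2) ((F (- Ci) u - P (- Ci) u) / 2).
rewrite !Cmod_div // Cmod_R Rabs_pos_eq; lra.
Qed.

(** * Pinching the contour *)

Section Pinch.
Variables p q : C.
Hypotheses (hp0 : p <> 0) (hq0 : q <> 0) (hp : (Cmod p < 1)%R) (hq : (Cmod q < 1)%R).

Local Notation G := (egamma p q).
Local Notation iG x := (/ egamma p q x).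

Lemma egamma_refl (x : C) : (Cmod (p * q) < Cmod x < 1)%R -> G x * G (p * q / x) = 1.
Proof.
move=> [x1 x2].
have x0 : x <> 0 by apply: Cmod_neq0; have := Cmod_ge_0 (p * q); lra.
have pq0 : p * q <> 0 by exact: Cmult_neq_0.
rewrite /egamma.
have -> : p * q / (p * q / x) = x by field; repeat split.
have := dpoch_neq0 p q hp hq x x2.
have := dpoch_neq0 p q hp hq (p * q / x) (Cmod_div_lt _ _ x1).
by move=> *; field.
Qed.

(* (1 - x) Gamma(x), in a form that is regular on the circle |x| = 1. *)
Definition egamma_reg (x : C) : C := G (q * x) * (/ dpoch 0 p (p * x) * / dpoch 0 p (p * / x)).

Lemma egamma_regE (x : C) : (Cmod p < Cmod x < 1)%R -> G x = / (1 - x) * egamma_reg x.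
Proof.
move=> [x1 x2].
have x0 : x <> 0 by apply: Cmod_neq0; have := Cmod_ge_0 p; lra.
have n1 := sub1_neq0 x x2.
rewrite /egamma_reg egamma_mulq // /theta dpoch0_rec // -/(Cdiv p x).
have := dpoch_neq0 0 p Cmod_lt1_0 hp (p * x) (Cmod_mul_lt1 _ _ hp x2).
have := dpoch_neq0 0 p Cmod_lt1_0 hp (p / x) (Cmod_div_lt _ _ x1).
by move=> *; field.
Qed.

(** For e = 1 and e = -1, the values that the arguments of [egamma_reg] take at the pinch points. *)
Lemma egamma_reg_unit (e : C) : e * e = 1 -> Cmod e = 1%R ->
  egamma_reg e = / (dpoch 0 p (p * e) * dpoch 0 q (q * e)).
Proof.
move=> ee e1; have e0 := circle_neq0 e e1.
have ie : / e = e.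
  have E : / e * (e * e) = e by field.
  by rewrite -[RHS]E ee Cmult_1_r.
have pe : (Cmod (p * e) < 1)%R by rewrite Cmod_mult e1; lra.
have qe : (Cmod (q * e) < 1)%R by rewrite Cmod_mult e1; lra.
rewrite /egamma_reg /egamma ie.
have -> : p * q / (q * e) = p * e by rewrite /Cdiv CinvM ie; field.
rewrite (dpoch_rec' p q (p * e)) // (dpoch_rec p q (q * e)) //.
have -> : p * (q * e) = q * (p * e) by ring.
have := dpoch_neq0 0 p Cmod_lt1_0 hp _ pe.
have := dpoch_neq0 0 q Cmod_lt1_0 hq _ qe.
have := dpoch_neq0 p q hp hq _ (Cmod_mul_lt1 _ _ hq pe).
by move=> *; field.
Qed.

Lemma inH_egamma_reg (A B : C -> Prop) x (R0 : R) : tame A -> tame B ->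
  inH A B x -> inH A B (fun z u => / x z u) -> (0 <= R0 < 1)%R ->
  (forall z u, A z -> B u -> (Cmod (x z u) <= 1)%R) ->
  (forall z u, A z -> B u -> (Cmod (p * / x z u) <= R0)%R) ->
  inH A B (fun z u => egamma_reg (x z u)).
Proof.
move=> tA tB Hx Hx' R01 x1 xR.
have c1 (c : C) z u : A z -> B u -> (Cmod (c * x z u) <= Cmod c)%R.
  by move=> Az Bu; rewrite Cmod_mult; have := x1 z u Az Bu; have := Cmod_ge_0 c; nra.
apply: inH_mul => //; last apply: inH_mul => //.
- apply: (inH_egamma p q hp hq _ _ (fun z u => q * x z u) (Cmod q)) => //.
  + exact: inH_scal.
  + by apply: inH_ext (inH_scal _ _ tA tB (/ q) _ Hx') => z u _ _; rewrite CinvM.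
  + by split=> //; exact: Cmod_ge_0.
  by move=> z u; exact: c1.
- apply: (inH_inv_dpoch 0 p Cmod_lt1_0 hp _ _ (fun z u => p * x z u) (Cmod p)) => //.
  + exact: inH_scal.
  + by split=> //; exact: Cmod_ge_0.
  by move=> z u; exact: c1.
by apply: (inH_inv_dpoch 0 p Cmod_lt1_0 hp _ _ (fun z u => p * / x z u) R0) => //; exact: inH_scal.
Qed.

Lemma inH_inv_egamma_reg (A B : C -> Prop) x (R0 : R) : tame A -> tame B ->
  inH A B x -> inH A B (fun z u => / x z u) -> (0 <= R0 < 1)%R ->
  (forall z u, A z -> B u -> (Cmod (p * / x z u) <= R0)%R) ->
  inH A B (fun z u => / egamma_reg (x z u)).
Proof.
move=> tA tB Hx Hx' R01 xR.
apply: (inH_ext _ _ (fun z u => / G (q * x z u) * (dpoch 0 p (p * x z u) * dpoch 0 p (p * / x z u)))).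
  by move=> z u _ _; rewrite /egamma_reg !CinvM !CinvK.
apply: inH_mul => //; last first.
  by apply: inH_mul => //; apply: inH_dpoch => //; try exact: Cmod_lt1_0; exact: inH_scal.
apply: (inH_inv_egamma p q hp hq _ _ (fun z u => q * x z u) R0) => //.
- exact: inH_scal.
- by apply: inH_ext (inH_scal _ _ tA tB (/ q) _ Hx') => z u _ _; rewrite CinvM.
move=> z u Az Bu.
have -> : p * q * / (q * x z u) = p * / x z u.
  by rewrite CinvM -[RHS]Cmult_1_r -(Cinv_r q hq0); ring.
exact: xR.
Qed.

Variable r : R.
Hypotheses (r0 : (0 < r)%R) (r1 : (r < 1)%R) (rp : (Cmod p < r * r * r * r * r)%R).

Definition pinch_ann (u : C) : Prop := (r <= Cmod u <= 1)%R.

Lemma tame_pinch_ann : tame pinch_ann. Proof. exact: tame_ann. Qed.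

Definition pinch_t5 (u : C) : C := p * q / (u * u * r * r * r).

Let rc0 : RtoC r <> 0. Proof. by move=> /RtoC_inj; lra. Qed.
Let rm : Cmod (RtoC r) = r. Proof. by rewrite Cmod_R Rabs_pos_eq; lra. Qed.
Let r2 : (0 < r * r < r)%R. Proof. nra. Qed.
Let r3 : (0 < r * r * r < r * r)%R. Proof. nra. Qed.
Let r5 : (0 < r * r * r * r * r < r * r * r)%R. Proof. nra. Qed.

(** The second term bounds |t5| and |p q / x| for the pairs x without t5; [r] bounds |p q / x| for
    the pairs with t5. *)
Definition pinch_bound : R := Rmax r (Cmod (p * q) / (r * r * r * r * r)).

Lemma pq_r5 : (Cmod (p * q) < r * r * r * r * r)%R.
Proof. rewrite Cmod_mult; have := Cmod_ge_0 p; have := Cmod_ge_0 q; nra. Qed.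

Lemma pinch_bound_lt1 : (0 <= pinch_bound < 1)%R.
Proof.
split; first by apply: Rle_trans (Rmax_l _ _); lra.
apply: Rmax_lub_lt => //; apply: (Rmult_lt_reg_r (r * r * r * r * r)); first lra.
by rewrite /Rdiv Rmult_assoc Rinv_l; have := pq_r5; lra.
Qed.

Lemma pq_div_le (x : C) : (r * r * r * r * r <= Cmod x)%R -> (Cmod (p * q * / x) <= pinch_bound)%R.
Proof.
move=> H; apply: Rle_trans (Rmax_r _ _); rewrite Cmod_mult Cmod_inv'.
apply: Rmult_le_compat_l; first exact: Cmod_ge_0.
by apply: Rinv_le_contravar; lra.
Qed.

Lemma pinch_ann_sq u : pinch_ann u -> (r * r <= Cmod (u * u) <= 1)%R.
Proof. by move=> [u1 u2]; rewrite Cmod_mult; split; nra. Qed.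

Lemma pinch_ann_neq0 u : pinch_ann u -> u <> 0.
Proof. by move=> [u1 _]; apply: Cmod_neq0; lra. Qed.

Lemma inH_inv_sq (c : C) : inH unit_circle pinch_ann (fun _ u => c * (/ u * / u)).
Proof.
have tA := tame_unit_circle; have tB := tame_pinch_ann; have Hu' := inH_uinv unit_circle pinch_ann.
by apply: inH_scal => //; exact: inH_mul.
Qed.

Lemma pinch_t5E u : pinch_t5 u = p * q / (r * r * r) * (/ u * / u).
Proof. by rewrite /pinch_t5 /Cdiv !CinvM; ring. Qed.

Lemma pinch_t5_inv u : / pinch_t5 u = r * r * r / (p * q) * (u * u).
Proof. by rewrite /pinch_t5 /Cdiv !CinvM !CinvK; ring. Qed.

Lemma small_pinch_t5 : small_param pinch_ann pinch_t5.
Proof.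
have tA := tame_unit_circle; have tB := tame_pinch_ann; have Hu := inH_u unit_circle pinch_ann; split.
- by apply: inH_ext (inH_inv_sq (p * q / (r * r * r))) => z u _ _; rewrite pinch_t5E.
- apply: (inH_ext _ _ (fun _ u => r * r * r / (p * q) * (u * u))).
    by move=> z u _ _; rewrite pinch_t5_inv.
  by apply: inH_scal => //; exact: inH_mul.
exists pinch_bound; first exact: pinch_bound_lt1.
move=> u Bu; apply: pq_div_le.
have -> : u * u * r * r * r = (u * u) * (r * r * r) by ring.
rewrite Cmod_mult !(Cmod_mult (_ * _)) !(Cmod_mult r) rm.
have := pinch_ann_sq u Bu; nra.
Qed.

Definition pinch_gammas (u : C) : C :=
  iG (Ci * u * r) * iG (Ci * u * r) * iG (Ci * u * r) * iG (Ci * u * pinch_t5 u) *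
  (iG (- Ci * u * r) * iG (- Ci * u * r) * iG (- Ci * u * r) * iG (- Ci * u * pinch_t5 u)) *
  (iG (r * r) * iG (r * r) * iG (r * pinch_t5 u)) * (iG (r * r) * iG (r * pinch_t5 u)) * iG (r * pinch_t5 u).

(* The integrand at t = (i u, - i u, r, r, r, t5) over the product of the Gamma(t_j t_k),
   without its factor (1 - u^2) / ((1 + u^2 z^2) (1 + u^2 / z^2)). *)
Definition pinch_integrand (z u : C) : C :=
  inv_gamma_pm2 p q z * (egamma_reg (Ci * u * z) * egamma_reg (Ci * u * / z) * egamma_reg (- Ci * u * z) * egamma_reg (- Ci * u * / z)) *
  (gamma_pm p q r z * gamma_pm p q r z * gamma_pm p q r z * gamma_pm p q (pinch_t5 u) z) * / egamma_reg (u * u) * pinch_gammas u.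

Lemma inH_inv_egamma_pinch x : inH unit_circle pinch_ann (fun _ u => x u) -> inH unit_circle pinch_ann (fun _ u => / x u) ->
  (forall u, pinch_ann u -> (Cmod (p * q * / x u) <= pinch_bound)%R) -> inH unit_circle pinch_ann (fun _ u => iG (x u)).
Proof.
move=> Hx Hx' xR; have tA := tame_unit_circle; have tB := tame_pinch_ann.
by apply: (inH_inv_egamma p q hp hq _ _ (fun _ u => x u) pinch_bound tA tB Hx Hx' pinch_bound_lt1) => z u _; exact: xR.
Qed.

Lemma inH_pinch_gammas : inH unit_circle pinch_ann (fun _ u => pinch_gammas u).
Proof.
have tA := tame_unit_circle; have tB := tame_pinch_ann.
have Hu := inH_u unit_circle pinch_ann; have Hu' := inH_uinv unit_circle pinch_ann.
have [H5 H5' _] := small_pinch_t5.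
have ir : (r <= pinch_bound)%R := Rmax_l _ _.
have H1 (c : C) : Cmod c = 1%R -> inH unit_circle pinch_ann (fun _ u => iG (c * u * r)).
  move=> c1; apply: (inH_inv_egamma_pinch (fun u => c * u * r)).
  - by apply: inH_mul => //; [exact: inH_scal|exact: inH_const].
  - apply: (inH_ext _ _ (fun _ u => / c * / u * / r)); first by move=> *; rewrite !CinvM.
    by apply: inH_mul => //; [exact: inH_scal|exact: inH_const].
  move=> u Bu; apply: pq_div_le; rewrite !Cmod_mult c1 rm.
  case: Bu => u1 u2; nra.
have H2 (c : C) : Cmod c = 1%R -> inH unit_circle pinch_ann (fun _ u => iG (c * u * pinch_t5 u)).
  move=> c1; have c0 := circle_neq0 c c1; apply: (inH_inv_egamma_pinch (fun u => c * u * pinch_t5 u)).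
  - by apply: inH_mul => //; exact: inH_scal.
  - apply: (inH_ext _ _ (fun _ u => / c * / u * / pinch_t5 u)); first by move=> *; rewrite !CinvM.
    by apply: inH_mul => //; exact: inH_scal.
  move=> u Bu; have u0 := pinch_ann_neq0 _ Bu.
  have -> : p * q * / (c * u * pinch_t5 u) = / c * u * (r * r * r).
    by rewrite CinvM pinch_t5_inv; field; repeat split.
  rewrite !Cmod_mult Cmod_inv' c1 rm; case: Bu => u1 u2; rewrite Rinv_1; nra.
have H3 : inH unit_circle pinch_ann (fun _ _ => iG (r * r)) by exact: inH_const.
have H4 : inH unit_circle pinch_ann (fun _ u => iG (r * pinch_t5 u)).
  apply: (inH_inv_egamma_pinch (fun u => r * pinch_t5 u)); first exact: inH_scal.
    apply: (inH_ext _ _ (fun _ u => / r * / pinch_t5 u)); first by move=> *; rewrite !CinvM.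
    exact: inH_scal.
  move=> u Bu; have u0 := pinch_ann_neq0 _ Bu.
  have -> : p * q * / (r * pinch_t5 u) = u * u * (r * r).
    by rewrite CinvM pinch_t5_inv; field; repeat split.
  by rewrite (Cmod_mult (u * u)) (Cmod_mult r) rm; have := pinch_ann_sq u Bu; nra.
have m1 : Cmod Ci = 1%R := Cmod_Ci.
have m2 : Cmod (- Ci) = 1%R by rewrite Cmod_opp Cmod_Ci.
have mul f g := inH_mul _ _ tA tB f g.
apply: (mul _ _ _ H4); apply: (mul _ _ _ (mul _ _ H3 H4)).
apply: (mul _ _ _ (mul _ _ (mul _ _ H3 H3) H4)).
have q4 (c : C) : Cmod c = 1%R -> inH unit_circle pinch_ann (fun _ u => iG (c * u * r) * iG (c * u * r) *
    iG (c * u * r) * iG (c * u * pinch_t5 u)).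
  move=> c1; have h1 := H1 _ c1; have h2 := H2 _ c1.
  exact: (mul _ _ (mul _ _ (mul _ _ h1 h1) h1) h2).
exact: (mul _ _ (q4 _ m1) (q4 _ m2)).
Qed.

Lemma inH_pinch_integrand : inH unit_circle pinch_ann pinch_integrand.
Proof.
have tA := tame_unit_circle; have tB := tame_pinch_ann.
have Hu := inH_u unit_circle pinch_ann; have Hu' := inH_uinv unit_circle pinch_ann.
have Hz := inH_z unit_circle pinch_ann; have Hz' := inH_zinv unit_circle pinch_ann.
have gr : small_param pinch_ann (fun _ => RtoC r) by apply: small_param_const => //; rewrite rm.
have pr : (0 <= Cmod p / (r * r) < 1)%R.
  have p0 := Cmod_ge_0 p; split.
    by apply: Rmult_le_pos => //; apply/Rlt_le/Rinv_0_lt_compat; lra.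
  apply: (Rmult_lt_reg_r (r * r)); first lra.
  by rewrite /Rdiv Rmult_assoc Rinv_l; nra.
have pd (x : C) : (r * r <= Cmod x)%R -> (Cmod (p * / x) <= Cmod p / (r * r))%R.
  move=> H; rewrite Cmod_mult Cmod_inv'; apply: Rmult_le_compat_l; first exact: Cmod_ge_0.
  by apply: Rinv_le_contravar; lra.
have H1 (c : C) : Cmod c = 1%R -> inH unit_circle pinch_ann (fun z u => egamma_reg (c * u * z)).
  move=> c1; apply: (inH_egamma_reg _ _ (fun z u => c * u * z) (Cmod p / (r * r))) => //.
  - by apply: inH_mul => //; exact: inH_scal.
  - apply: (inH_ext _ _ (fun z u => / c * / u * / z)); first by move=> *; rewrite !CinvM.
    by apply: inH_mul => //; exact: inH_scal.
  - by move=> z u [z1 z2] [u1 u2]; rewrite !Cmod_mult c1; nra.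
  by move=> z u [z1 z2] [u1 u2]; apply: pd; rewrite !Cmod_mult c1; nra.
have H2 (c : C) : Cmod c = 1%R -> inH unit_circle pinch_ann (fun z u => egamma_reg (c * u * / z)).
  move=> c1; apply: (inH_egamma_reg _ _ (fun z u => c * u * / z) (Cmod p / (r * r))) => //.
  - by apply: inH_mul => //; exact: inH_scal.
  - apply: (inH_ext _ _ (fun z u => / c * / u * z)); first by move=> *; rewrite !CinvM CinvK.
    by apply: inH_mul => //; exact: inH_scal.
  - move=> z u [z1 z2] [u1 u2]; rewrite !Cmod_mult Cmod_inv' c1.
    have -> : Cmod z = 1%R by lra.
    rewrite Rinv_1; nra.
  move=> z u [z1 z2] [u1 u2]; apply: pd; rewrite !Cmod_mult Cmod_inv' c1.
  have -> : Cmod z = 1%R by lra.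
  rewrite Rinv_1; nra.
have H3 : inH unit_circle pinch_ann (fun _ u => / egamma_reg (u * u)).
  apply: (inH_inv_egamma_reg _ _ (fun _ u => u * u) (Cmod p / (r * r))) => //.
  - exact: inH_mul.
  - apply: (inH_ext _ _ (fun _ u => / u * / u)); first by move=> *; rewrite !CinvM.
    exact: inH_mul.
  by move=> z u _ Bu; apply: pd; have := pinch_ann_sq u Bu; lra.
have m1 : Cmod Ci = 1%R := Cmod_Ci.
have m2 : Cmod (- Ci) = 1%R by rewrite Cmod_opp Cmod_Ci.
have Hr : inH unit_circle pinch_ann (fun z _ => gamma_pm p q r z) by exact: (inH_gamma_pm p q hp hq _ (fun _ => RtoC r)).
have mul f g := inH_mul _ _ tA tB f g.
have HT := inH_gamma_pm p q hp hq _ pinch_t5 tB small_pinch_t5.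
have HW := inH_inv_gamma_pm2 p q hp hq _ _ tA tB.
exact: (mul _ _ (mul _ _ (mul _ _ (mul _ _ HW
  (mul _ _ (mul _ _ (mul _ _ (H1 _ m1) (H2 _ m1)) (H1 _ m2)) (H2 _ m2)))
  (mul _ _ (mul _ _ (mul _ _ Hr Hr) Hr) HT)) H3) inH_pinch_gammas).
Qed.

(** The singular factor is (1 - s^2) / ((1 + s^2 z^2)(1 + s^2 / z^2)), with 1 - s^2 coming from 1 /
    Gamma(s^2); the factor 1 + s^2 completes its numerator to the 1 - s^4 of the Poisson kernel of
    parameter s^2. *)
Lemma norm_beta5_mean (s : R) : (r <= s < 1)%R ->
  (1 + s * s) * norm_beta5 p q (Ci * s) (- Ci * s) r r r = mean (fun z => poisson (s * s) z * pinch_integrand z s) 1.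
Proof.
move=> [s1 s2].
have sm : Cmod (RtoC s) = s by rewrite Cmod_R Rabs_pos_eq; lra.
have Bs : pinch_ann s by rewrite /pinch_ann sm; lra.
have ss : (0 < s * s < 1)%R by nra.
have ssm : Cmod (s * s) = (s * s)%R by rewrite Cmod_mult sm.
have T01 : Ci * s * (- Ci * s) = s * s.
  have -> : Ci * s * (- Ci * s) = - (Ci * Ci) * (s * s) by ring.
  by rewrite Ci2; ring.
have E5 : p * q / (Ci * s * (- Ci * s) * r * r * r) = pinch_t5 s by rewrite T01.
have l0 : (Cmod (Ci * s) < 1)%R by rewrite Cmod_mult Cmod_Ci sm; lra.
have l1 : (Cmod (- Ci * s) < 1)%R by rewrite Cmod_mult Cmod_opp Cmod_Ci sm; lra.
have lr : (Cmod r < 1)%R by rewrite rm.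
have l5 : (Cmod (pinch_t5 s) < 1)%R.
  have [_ _ [R0 R01 H]] := small_pinch_t5; have := H _ Bs; lra.
have M := beta_kernel_is_mean p q hp hq _ _ _ _ _ _ l0 l1 lr lr lr l5.
rewrite /norm_beta5 E5 /norm_beta; apply: esym; apply: is_mean_mean.
have {}M := is_mean_scal _ _ _ ((1 + s * s) * inv_gamma_prod p q (Ci * s) (- Ci * s) r r r (pinch_t5 s)) M.
have -> : forall a b c : C, a * (b * c) = a * c * b by move=> a b c; ring.
apply: is_mean_ext M => z; rewrite Cmod_1 => z1; have z0 := circle_neq0 z z1.
have pn (c w : C) : Cmod c = 1%R -> Cmod w = 1%R -> G (c * s * w) = / (1 - c * s * w) * egamma_reg (c * s * w).
  by move=> c1 w1; apply: egamma_regE; rewrite !Cmod_mult c1 w1 sm; split; nra.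
have n1 (c w : C) : Cmod c = 1%R -> Cmod w = 1%R -> 1 - c * s * w <> 0.
  by move=> c1 w1; apply: sub1_neq0; rewrite !Cmod_mult c1 w1 sm; lra.
have m1 : Cmod Ci = 1%R := Cmod_Ci.
have m2 : Cmod (- Ci) = 1%R by rewrite Cmod_opp Cmod_Ci.
have z1' : Cmod (/ z) = 1%R by rewrite Cmod_inv' z1 Rinv_1.
have GT : iG (s * s) = (1 - s * s) * / egamma_reg (s * s).
  rewrite egamma_regE ?CinvM ?CinvK // ssm; split; last lra.
  by apply: Rlt_le_trans rp _; nra.
rewrite /inv_gamma_prod T01 GT /beta_kernel /gamma_pm (pn Ci z) // (pn Ci (/ z)) // (pn (- Ci) z) // (pn (- Ci) (/ z)) // /pinch_integrand /pinch_gammas /gamma_pm.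
have f1 : (1 - Ci * s * z) * (1 - - Ci * s * z) = 1 + RtoC (s * s) * z ^ 2.
  have -> : (1 - Ci * s * z) * (1 - - Ci * s * z) = 1 - (Ci * Ci) * (s * s) * z ^ 2 by ring.
  by rewrite Ci2 RtoC_mult; ring.
have f2 : (1 - Ci * s * / z) * (1 - - Ci * s * / z) = 1 + RtoC (s * s) * / z ^ 2.
  have -> : (1 - Ci * s * / z) * (1 - - Ci * s * / z) = 1 - (Ci * Ci) * (s * s) * (/ z) ^ 2 by ring.
  by rewrite Ci2 RtoC_mult Cpow_inv'; ring.
have a1 := n1 Ci z m1 z1; have a2 := n1 (- Ci) z m2 z1.
have a3 := n1 Ci (/ z) m1 z1'; have a4 := n1 (- Ci) (/ z) m2 z1'.
have KE := poissonE (s * s) ss z z1; rewrite -f1 -f2 in KE.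
have -> : poisson (s * s) z = (1 - s * s * (s * s)) * (/ (1 - Ci * s * z) * / (1 - - Ci * s * z) *
    (/ (1 - Ci * s * / z) * / (1 - - Ci * s * / z))).
  move: KE a1 a2 a3 a4; rewrite RtoC_mult.
  move: (1 - _) (1 - _) (1 - _) (1 - _) => x1 x2 x3 x4 KE a1 a2 a3 a4.
  by rewrite -KE; field; repeat split.
ring.
Qed.

(** At u = 1 the gammas at i t and - i t cancel against [pinch_gammas], and Gamma(r^2) Gamma(r t5) =
    1 by reflection, since r t5 = p q / r^2. There remain theta(-1; p) theta(-1; q), whose constant
    is 4, and the regular parts at 1 and -1; the factors (-p; p)_oo and (-q; q)_oo cancel. *)
Lemma pinch_integrand_value (z : C) : z = Ci \/ z = - Ci -> pinch_integrand z 1 = 4 / (dpoch 0 p p * dpoch 0 q q).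
Proof.
move=> zE.
have pq := pq_r5.
have HP1 := dpoch_neq0 0 p Cmod_lt1_0 hp p hp.
have HQ1 := dpoch_neq0 0 q Cmod_lt1_0 hq q hq.
have mp : (Cmod (- p) < 1)%R by rewrite Cmod_opp.
have mq : (Cmod (- q) < 1)%R by rewrite Cmod_opp.
have HP2 := dpoch_neq0 0 p Cmod_lt1_0 hp (- p) mp.
have HQ2 := dpoch_neq0 0 q Cmod_lt1_0 hq (- q) mq.
have g1 : egamma_reg 1 = / (dpoch 0 p p * dpoch 0 q q).
  by rewrite egamma_reg_unit ?Cmod_1 ?Cmult_1_r.
have g2 : egamma_reg (- (1)) = / (dpoch 0 p (- p) * dpoch 0 q (- q)).
  rewrite egamma_reg_unit ?Cmod_opp ?Cmod_1 //; last ring.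
  by congr (/ (dpoch 0 p _ * dpoch 0 q _)); ring.
have thm1 (x : C) : (Cmod x < 1)%R -> theta x (- (1)) = 2 * dpoch 0 x (- x) * dpoch 0 x (- x).
  move=> x1; rewrite /theta dpoch0_rec //.
  have -> : x * - (1) = - x by ring.
  have -> : x / - (1) = - x by field.
  by congr (_ * _ * _); ring.
have c0 := Ci_neq0.
have z2 : z * z = - (1).
  by case: zE => ->; rewrite -Ci2; ring.
have iz : / z = - z.
  have z0 : z <> 0 by case: zE => -> //; exact: Copp_neq0.
  have -> : - z = / z * - (z * z) by field.
  by rewrite z2; field.
have W : inv_gamma_pm2 p q z = 4 * (dpoch 0 p (- p) * dpoch 0 p (- p) * (dpoch 0 q (- q) * dpoch 0 q (- q))).
  rewrite /inv_gamma_pm2 -Cpow_inv' iz /= !Cmult_1_r.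
  have -> : - z * - z = z * z by ring.
  rewrite z2 !thm1 //.
  have -> : RtoC 4 = 2 * 2 by rewrite -RtoC_mult; congr RtoC; ring.
  ring.
have t5m : Cmod (pinch_t5 1) = (Cmod (p * q) / (r * r * r))%R.
  rewrite /pinch_t5 Cmod_div; last by do 4 (apply: Cmult_neq_0 => //); apply: Cmod_neq0; rewrite Cmod_1; lra.
  by rewrite !Cmod_mult !Cmod_1 rm !Rmult_1_l.
have pq0 : (0 < Cmod (p * q))%R by apply/Cmod_gt_0; exact: Cmult_neq_0.
have t5b : (Cmod (p * q) < Cmod (pinch_t5 1) < 1)%R.
  have e : (Cmod (p * q) / (r * r * r) * (r * r * r) = Cmod (p * q))%R by field; lra.
  by rewrite t5m; split; apply: (Rmult_lt_reg_r (r * r * r)); try lra; rewrite e; nra.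
have gn (c t : C) : Cmod c = 1%R -> (Cmod (p * q) < Cmod t < 1)%R -> G (c * t) <> 0.
  by move=> c1 tb; apply: egamma_neq0 => //; rewrite (Cmod_mult c) c1 Rmult_1_l.
have m1 : Cmod Ci = 1%R := Cmod_Ci.
have m2 : Cmod (- Ci) = 1%R by rewrite Cmod_opp Cmod_Ci.
have rb : (Cmod (p * q) < Cmod r < 1)%R by rewrite rm; split => //; nra.
have rrb : (Cmod (p * q) < Cmod (r * r) < 1)%R by rewrite (Cmod_mult r) rm; split; nra.
have refl := egamma_refl (r * r) rrb.
have e5 : r * pinch_t5 1 = p * q / (r * r).
  by rewrite /pinch_t5; field; exact: rc0.
rewrite -e5 in refl.
have Gp t : gamma_pm p q t z = G (Ci * t) * G (- Ci * t).
  rewrite /gamma_pm iz; case: zE => ->.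
    by congr (G _ * G _); ring.
  by rewrite Cmult_comm; congr (G _ * G _); ring.
have ii : - (Ci * Ci) = 1 by rewrite Ci2; ring.
have S : egamma_reg (Ci * 1 * z) * egamma_reg (Ci * 1 * / z) * egamma_reg (- Ci * 1 * z) * egamma_reg (- Ci * 1 * / z) =
    egamma_reg 1 * egamma_reg 1 * (egamma_reg (- (1)) * egamma_reg (- (1))).
  rewrite iz.
  have [[e1 e2]|[e1 e2]] : (Ci * 1 * z = - (1) /\ Ci * 1 * - z = 1) \/
      (Ci * 1 * z = 1 /\ Ci * 1 * - z = - (1)).
  - case: zE => ->; [left|right].
      by split; [rewrite -[RHS]Ci2|rewrite -[RHS]ii]; ring.
    by split; [rewrite -[RHS]ii|rewrite -[RHS]Ci2]; ring.
  - have e3 : - Ci * 1 * z = Ci * 1 * - z by ring.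
    have e4 : - Ci * 1 * - z = Ci * 1 * z by ring.
    by rewrite e3 e4 e1 e2; ring.
  have e3 : - Ci * 1 * z = Ci * 1 * - z by ring.
  have e4 : - Ci * 1 * - z = Ci * 1 * z by ring.
  by rewrite e3 e4 e1 e2; ring.
rewrite /pinch_integrand S W !Gp /pinch_gammas !Cmult_1_r g1 g2.
have a1 := gn Ci r m1 rb; have a2 := gn (- Ci) r m2 rb.
have a3 := gn Ci (pinch_t5 1) m1 t5b; have a4 := gn (- Ci) (pinch_t5 1) m2 t5b.
have b1 : G (r * r) <> 0 by exact: egamma_neq0.
have b2 : G (r * pinch_t5 1) = / G (r * r).
  have -> : G (r * pinch_t5 1) = / G (r * r) * (G (r * r) * G (r * pinch_t5 1)) by field.
  by rewrite refl Cmult_1_r.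
rewrite b2; field.
by repeat split.
Qed.

(** As s -> 1 in [norm_beta5_mean], the left side tends to 2 k and the right side to the average of
    [pinch_integrand] at z = i and z = - i with u = 1. *)
Lemma pinch (k : C) : (forall s : R, (r <= s < 1)%R -> norm_beta5 p q (Ci * s) (- Ci * s) r r r = k) ->
  k = 2 / (dpoch 0 p p * dpoch 0 q q).
Proof.
move=> H; set V := 4 / (dpoch 0 p p * dpoch 0 q q).
have tA := tame_unit_circle; have tB := tame_pinch_ann.
suff E : 2 * k = V.
  have two : RtoC 2 <> 0 by move=> /RtoC_inj; lra.
  have -> : k = 2 * k / 2 by field.
  rewrite E /V; have -> : RtoC 4 = 2 * 2 by rewrite -RtoC_mult; congr RtoC; ring.
  have HP1 := dpoch_neq0 0 p Cmod_lt1_0 hp p hp.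
  have HQ1 := dpoch_neq0 0 q Cmod_lt1_0 hq q hq.
  by field; repeat split.
apply: sub_eq0; apply: Cmod_le_eps0 => eps e0.
have e3 : (0 < eps / 3)%R by lra.
have [d [d0 d1] Hd] := poisson_limit pinch_ann pinch_integrand tB inH_pinch_integrand _ e3.
have [g g0 Hg] := inH_cont _ _ tA tB _ inH_pinch_integrand _ e3.
have k0 := Cmod_ge_0 k.
(* For s = 1 - h the four bounds give, in order: s^2 > 1 - d for the Poisson limit, |s - 1| < g for
   continuity in u, s >= r, and (1 - s^2) |k| <= eps / 3. *)
pose h := Rmin (Rmin (d / 4) (g / 2)) (Rmin (1 - r) (eps / (6 * (Cmod k + 1)))).
have h0 : (0 < h)%R.
  apply: Rmin_glb_lt; apply: Rmin_glb_lt; try lra.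
  by apply: Rdiv_lt_0_compat; lra.
have h1 : (h <= d / 4)%R := Rle_trans _ _ _ (Rmin_l _ _) (Rmin_l _ _).
have h2 : (h <= g / 2)%R := Rle_trans _ _ _ (Rmin_l _ _) (Rmin_r _ _).
have h3 : (h <= 1 - r)%R := Rle_trans _ _ _ (Rmin_r _ _) (Rmin_l _ _).
have h4 : (h <= eps / (6 * (Cmod k + 1)))%R := Rle_trans _ _ _ (Rmin_r _ _) (Rmin_r _ _).
pose s := (1 - h)%R.
have sb : (r <= s < 1)%R by rewrite /s; lra.
have sm : Cmod (RtoC s) = s by rewrite Cmod_R Rabs_pos_eq; lra.
have Bs : pinch_ann s by rewrite /pinch_ann sm; lra.
have B1 : pinch_ann 1 by rewrite /pinch_ann Cmod_1; lra.
have ssb : (1 - d < s * s < 1)%R by rewrite /s; nra.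
have D := Hd (s * s)%R s ssb Bs.
have K := norm_beta5_mean s sb; rewrite H // in K.
rewrite -K in D.
have near z : Cmod z = 1%R -> (Cmod (pinch_integrand z s - pinch_integrand z 1) < eps / 3)%R.
  move=> z1; have Uz : unit_circle z by rewrite /unit_circle; lra.
  apply: Hg => //.
    have -> : z - z = 0 by ring.
    by rewrite Cmod_0.
  have -> : RtoC s - 1 = - RtoC h by rewrite /s RtoC_minus; ring.
  rewrite Cmod_opp Cmod_R Rabs_pos_eq; lra.
have N1 := near Ci Cmod_Ci.
have N2 := near (- Ci) (ltac:(by rewrite Cmod_opp Cmod_Ci)).
rewrite (pinch_integrand_value Ci) -/V in N1; last by left.
rewrite (pinch_integrand_value (- Ci)) -/V in N2; last by right.
have two : RtoC 2 <> 0 by move=> /RtoC_inj; lra.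
have -> : 2 * k - V = ((1 + s * s) * k - (pinch_integrand Ci s + pinch_integrand (- Ci) s) / 2) +
   (((pinch_integrand Ci s - V) / 2 + (pinch_integrand (- Ci) s - V) / 2) + RtoC (1 - s * s) * k).
  by rewrite RtoC_minus RtoC_mult; field.
apply: Rle_trans (Cmod_triangle _ _) _.
apply: Rle_trans (Rplus_le_compat_l _ _ _ (Cmod_triangle _ _)) _.
have T1 := Cmod_triangle ((pinch_integrand Ci s - V) / 2) ((pinch_integrand (- Ci) s - V) / 2).
rewrite !Cmod_div // !(Cmod_R 2) (Rabs_pos_eq 2) in T1; last lra.
have T2 : (Cmod (RtoC (1 - s * s) * k) <= eps / 3)%R.
  rewrite Cmod_mult Cmod_R Rabs_pos_eq; last lra.
  have s3 : (1 - s * s <= 2 * (eps / (6 * (Cmod k + 1))))%R by rewrite /s; nra.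
  apply: (Rle_trans _ (2 * (eps / (6 * (Cmod k + 1))) * (Cmod k + 1))%R).
    by apply: Rmult_le_compat; lra.
  by right; field; lra.
lra.
Qed.

End Pinch.

(** * The value of the integral *)

Lemma norm_beta_value (p q t0 t1 t2 t3 t4 t5 : C) : p <> 0 -> q <> 0 -> (Cmod p < 1)%R -> (Cmod q < 1)%R ->
  (Cmod t0 < 1)%R -> (Cmod t1 < 1)%R -> (Cmod t2 < 1)%R ->
  (Cmod t3 < 1)%R -> (Cmod t4 < 1)%R -> (Cmod t5 < 1)%R ->
  t0 * t1 * t2 * t3 * t4 * t5 = p * q ->
  norm_beta p q t0 t1 t2 t3 t4 t5 = 2 / (dpoch 0 p p * dpoch 0 q q).
Proof.
move=> hp0 hq0 hp hq l0 l1 l2 l3 l4 l5 bal.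
have pq0 : (0 < Cmod (p * q))%R by apply/Cmod_gt_0; exact: Cmult_neq_0.
have n5 : t0 * t1 * t2 * t3 * t4 <> 0.
  by move=> H; rewrite -bal H Cmult_0_l Cmod_0 in pq0; lra.
have E5 : t5 = p * q / (t0 * t1 * t2 * t3 * t4).
  rewrite -bal; field; by repeat split; move=> H; apply: n5; rewrite H; ring.
have B : (Cmod (p * q) < Cmod (t0 * t1 * t2 * t3 * t4))%R.
  rewrite -bal Cmod_mult in pq0 *; have := Cmod_ge_0 t5.
  have := proj1 (Cmod_gt_0 _) n5; nra.
have -> : norm_beta p q t0 t1 t2 t3 t4 t5 = norm_beta5 p q t0 t1 t2 t3 t4 by rewrite /norm_beta5 -E5.
have p0 := Cmod_ge_0 p.
(* Bernoulli: r^5 >= 1 - 5 x > 1 - 6 x = |p|. In addition [r] dominates |t0|, ..., |t4|, so that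
   [norm_beta5_lift] applies. *)
pose x := ((1 - Cmod p) / 6)%R.
pose r := Rmax (1 - x) (Rmax (Cmod t0) (Rmax (Cmod t1) (Rmax (Cmod t2) (Rmax (Cmod t3) (Cmod t4))))).
have xb : (0 < x < 1)%R by rewrite /x; lra.
have r1 : (r < 1)%R by apply: Rmax_lub_lt; [lra|do 4 (apply: Rmax_lub_lt => //)].
have rx : (1 - x <= r)%R := Rmax_l _ _.
have r0 : (0 < r)%R by lra.
have rp : (Cmod p < r * r * r * r * r)%R.
  have m (a k : R) : (0 < k)%R -> (1 - k * x <= a)%R -> (0 < a)%R -> (1 - (k + 1) * x <= a * r)%R.
    move=> k0 Ha a0.
    have h : (a * (1 - x) <= a * r)%R by apply: Rmult_le_compat_l; lra.
    have h' : ((1 - k * x) * (1 - x) <= a * (1 - x))%R by apply: Rmult_le_compat_r; lra.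
    nra.
  have m1 := m r 1%R ltac:(lra) ltac:(lra) r0.
  have q2 : (0 < r * r)%R by nra.
  have m2 := m (r * r)%R 2%R ltac:(lra) ltac:(lra) q2.
  have q3 : (0 < r * r * r)%R by nra.
  have m3 := m (r * r * r)%R 3%R ltac:(lra) ltac:(lra) q3.
  have q4 : (0 < r * r * r * r)%R by nra.
  have m4 := m (r * r * r * r)%R 4%R ltac:(lra) ltac:(lra) q4.
  have xE : (6 * x = 1 - Cmod p)%R by rewrite /x; field.
  lra.
have rm : Cmod (RtoC r) = r by rewrite Cmod_R Rabs_pos_eq; lra.
have nr (c : C) : Cmod c = r -> near1 r c by move=> cr; rewrite /near1 cr; lra.
have nrr := nr _ rm.
(* The constant is represented by its value at (r, ..., r); [pinch] evaluates it along (i s, - i s,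
   r, r, r), whose entries have modulus in [r, 1). *)
rewrite -(pinch p q hp0 hq0 hp hq r r0 r1 rp (norm_beta5 p q r r r r r)); last first.
  move=> s sb; have sm : Cmod (RtoC s) = s by rewrite Cmod_R Rabs_pos_eq; lra.
  apply: (norm_beta5_const p q hp0 hq0 hp hq r r0 rp) => //;
    by rewrite /near1 Cmod_mult ?Cmod_opp Cmod_Ci sm Rmult_1_l.
apply: (norm_beta5_lift p q hp0 hq0 hp hq r r1) => //.
- by apply: Rle_trans (Rmax_r _ _); exact: Rmax_l.
- by do 2 (apply: (fun h => Rle_trans _ _ _ h (Rmax_r _ _))); exact: Rmax_l.
- by do 3 (apply: (fun h => Rle_trans _ _ _ h (Rmax_r _ _))); exact: Rmax_l.
- by do 4 (apply: (fun h => Rle_trans _ _ _ h (Rmax_r _ _))); exact: Rmax_l.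
- by do 5 (apply: (fun h => Rle_trans _ _ _ h (Rmax_r _ _))); exact: Rle_refl.
move=> x0 x1 x2 x3 x4 /nr ? /nr ? /nr ? /nr ? /nr ?.
exact: (norm_beta5_const p q hp0 hq0 hp hq r r0 rp).
Qed.

Theorem theorem1 (p q : C) (t : 'I_6 -> C)
  (hp0 : p <> 0) (hq0 : q <> 0)
  (hp : (Cmod p < 1)%R) (hq : (Cmod q < 1)%R)
  (ht : forall j : 'I_6, (Cmod (t j) < 1)%R)
  (balancing : \Cprod_(j < 6) t j = p * q) :
  ex_circle_int (beta_integrand p q t) /\
  kappa p q * circle_int (beta_integrand p q t) =
    \Cprod_(j < 6) \Cprod_(k < 6 | (j < k)%N) ellGamma p q (t j * t k).
Proof.
have Dn (x : C) : (Cmod x < 1)%R -> dpoch p q x <> 0 by exact: dpoch_neq0.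
have pmE (s z : C) : Cmod z = 1%R -> (Cmod s < 1)%R -> ellGamma_pm p q s z = gamma_pm p q s z.
  by move=> z1 s1; rewrite /ellGamma_pm !ellGammaE //; apply: Dn; rewrite Cmod_mult ?Cmod_inv' z1 ?Rinv_1; lra.
have ggE j k : ellGamma p q (t j * t k) = egamma p q (t j * t k).
  by apply: ellGammaE => //; apply: Dn; exact: Cmod_mul_lt1.
rewrite !big_ord_recl big_ord0 Cmult_1_r in balancing.
move: (ht ord0) (ht (lift ord0 ord0)) (ht (lift ord0 (lift ord0 ord0)))
  (ht (lift ord0 (lift ord0 (lift ord0 ord0)))) (ht (lift ord0 (lift ord0 (lift ord0 (lift ord0 ord0)))))
  (ht (lift ord0 (lift ord0 (lift ord0 (lift ord0 (lift ord0 ord0)))))) balancing.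
set s0 := t ord0; set s1 := t (lift ord0 ord0); set s2 := t (lift ord0 (lift ord0 ord0)).
set s3 := t (lift ord0 (lift ord0 (lift ord0 ord0))).
set s4 := t (lift ord0 (lift ord0 (lift ord0 (lift ord0 ord0)))).
set s5 := t (lift ord0 (lift ord0 (lift ord0 (lift ord0 (lift ord0 ord0))))).
move=> l0 l1 l2 l3 l4 l5; rewrite !Cmult_assoc => bal.
have M := beta_kernel_is_mean p q hp hq _ _ _ _ _ _ l0 l1 l2 l3 l4 l5.
have JV := norm_beta_value p q _ _ _ _ _ _ hp0 hq0 hp hq l0 l1 l2 l3 l4 l5 bal.
rewrite /norm_beta in JV; move: M JV.
set m := mean _ _ => M JV.
(* On the circle dz / z = i d(theta); the factor 1 is the starting point in [is_mean]. *)
have pull x : circle_pullback (beta_integrand p q t) x = Ci * beta_kernel p q s0 s1 s2 s3 s4 s5 (1 * expi x).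
  have e1 := Cmod_expi x; have e0 := expi_neq0 x.
  rewrite /circle_pullback /beta_integrand holo_ext_pm2 // /beta_kernel Cmult_1_l.
  rewrite !big_ord_recl big_ord0 !pmE // -/s0 -/s1 -/s2 -/s3 -/s4 -/s5.
  by rewrite /Cdiv; field.
have I : @is_RInt C_R_NormedModule (circle_pullback (beta_integrand p q t)) 0 (2 * PI)
    (Ci * (RtoC (2 * PI) * m)).
  apply: (@is_RInt_ext C_R_NormedModule _ _ _ _ _ (fun x _ => esym (pull x))).
  exact: is_RInt_Cscal.
split; first by exists (Ci * (RtoC (2 * PI) * m)).
rewrite /circle_int (@is_RInt_unique C_R_CompleteNormedModule _ _ _ _ I).
rewrite /kappa !qpochE //.
have P1 := dpoch_neq0 0 p Cmod_lt1_0 hp p hp.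
have Q1 := dpoch_neq0 0 q Cmod_lt1_0 hq q hq.
have two : RtoC 2 <> 0 by move=> /RtoC_inj; lra.
have pi0 : RtoC PI <> 0 by move=> /RtoC_inj; have := PI_RGT_0; lra.
have ci0 := Ci_neq0.
have -> : dpoch 0 p p * dpoch 0 q q / (4 * PI * Ci) * (Ci * (RtoC (2 * PI) * m)) =
    dpoch 0 p p * dpoch 0 q q / 2 * m.
  have -> : RtoC 4 = 2 * 2 by rewrite -RtoC_mult; congr RtoC; ring.
  by rewrite RtoC_mult; field; repeat split.
set X := inv_gamma_prod _ _ _ _ _ _ _ _ in JV.
have E : dpoch 0 p p * dpoch 0 q q / 2 * m * X = 1.
  have -> : dpoch 0 p p * dpoch 0 q q / 2 * m * X = dpoch 0 p p * dpoch 0 q q / 2 * (m * X) by ring.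
  by rewrite JV; field; repeat split.
(* The evaluation itself shows that the product of inverse gammas does not vanish. *)
have X0 : X <> 0.
  by move=> H; move: E; rewrite H Cmult_0_r => /esym /RtoC_inj; lra.
have -> : dpoch 0 p p * dpoch 0 q q / 2 * m = / X.
  have -> : / X = (dpoch 0 p p * dpoch 0 q q / 2 * m * X) * / X by rewrite E Cmult_1_l.
  by field; repeat split.
rewrite /X /inv_gamma_prod /egamma !CinvM !CinvK.
(* The condition j < k becomes a factor 1 outside the triangle, so that the double product unfolds
   by [big_ord_recl]. *)
under eq_bigr => j _ do rewrite big_mkcond.
rewrite !big_ord_recl !big_ord0 /= !ggE -/s0 -/s1 -/s2 -/s3 -/s4 -/s5.
rewrite /egamma; ring.
Qed.
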